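(* Let $\theta:\mathbb{Z}^d\to\mathbb{R}^d$ be an embedding. For $f,g\in L^2(\mathbb{R}^d)$ and $a\in l^1(\mathbb{Z}^d)$, suppose that $[f,g]_\theta\in l^1(\mathbb{Z}^d)$. Then $$\hat f\,\widehat{\circ_\theta}\,\hat a=\mathcal{F}_{\mathbb{R}^d}(f\circ_\theta a)\qquad\text{and}\qquad[\![\hat f,\hat g]\!]_\theta=\mathcal{F}_{\mathbb{Z}^d}([f,g]_\theta),$$ where $\mathcal{F}_{\mathbb{R}^d}$ is the Fourier transform on $\mathbb{R}^d$ and $\mathcal{F}_{\mathbb{Z}^d}$ is the Fourier transform on $\mathbb{Z}^d$. Furthermore, if $p,q\in L^2(\widehat{\mathbb{R}^d})$, then for $\gamma\in\mathbb{Z}^d$ $$\mathcal{F}_{\mathbb{T}^d}([\![p,q]\!]_\theta)(\gamma)=[\check p,\check q]_\theta(\gamma),$$ where $\check p,\check q\in L^2(\mathbb{R}^d)$ are the inverse Fourier transforms of $p,q$ and $\mathcal{F}_{\mathbb{T}^d}$ is the Fourier transform on $\mathbb{T}^d$.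
   Context: Conventions. $\mathbb{T}^d=\mathbb{R}^d/\mathbb{Z}^d$ with normalised Haar measure; $\widehat{\mathbb{R}^d}$ is identified with $\mathbb{R}^d$ through $(x,\xi)=e^{2\pi i x\cdot\xi}$; $(\gamma,\zeta)=e^{2\pi i\gamma\cdot\zeta}$ for $\gamma\in\mathbb{Z}^d,\zeta\in\mathbb{T}^d$. $\mathcal{F}_{\mathbb{R}^d}f(\xi)=\hat f(\xi)=\int_{\mathbb{R}^d}f(x)(x,\xi)\,dx$ (extended to $L^2$ by Plancherel); $\mathcal{F}_{\mathbb{Z}^d}a(\zeta)=\hat a(\zeta)=\sum_{\gamma\in\mathbb{Z}^d}a(\gamma)(\gamma,\zeta)$; $\mathcal{F}_{\mathbb{T}^d}b(\gamma)=\int_{\mathbb{T}^d}b(\zeta)(-\gamma,\zeta)\,d\zeta$. $\iota:\mathbb{Z}^d\to\mathbb{R}^d$ is the natural inclusion and $\hat\iota:\widehat{\mathbb{R}^d}\to\mathbb{T}^d$ the quotient map. An embedding $\theta$ is an injective group homomorphism that is a homeomorphism onto its image; $A_\theta$ is the unique nonsingular linear map of $\mathbb{R}^d$ with $\theta=A_\theta\iota$, and $\hat\theta=\hat\iota A_\theta^*:\widehat{\mathbb{R}^d}\to\mathbb{T}^d$. Operations: $[f,g]_\theta(\gamma)=\int_{\mathbb{R}^d}\overline{f(x-\theta(\gamma))}g(x)\,dx$; $(f\circ_\theta a)(x)=\sum_{\gamma\in\mathbb{Z}^d}a(\gamma)f(x-\theta(\gamma))$; $[\![p,q]\!]_\theta(\zeta)=\frac{1}{|\det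 A_\theta|}\sum_{\hat\theta(\xi)=\zeta}\overline{p(\xi)}q(\xi)$ for a.e. $\zeta\in\mathbb{T}^d$; $(p\,\widehat{\circ_\theta}\,b)(\xi)=p(\xi)b(\hat\theta(\xi))$ for $b\in C(\mathbb{T}^d)$. *)

(* Defs.v *)
From HB Require Import structures.
From mathcomp Require Import all_boot all_order all_algebra.
From mathcomp Require Import all_classical all_reals all_analysis.
From mathcomp Require Import complex.

Set Implicit Arguments.
Unset Strict Implicit.
Unset Printing Implicit Defensive.
Import Order.TTheory GRing.Theory Num.Theory.
Import numFieldNormedType.Exports.
Import Normc.

Local Open Scope classical_set_scope.
Local Open Scope ring_scope.
Local Open Scope complex_scope.
Local Open Scope quotient_scope.

(* R^d is 'cV[R]_d, with the sigma-algebra generated by the coordinate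
   functions, i.e. its Borel sigma-algebra. *)
Section measurable_cV.
Context {R : realType} (d : nat).

Let coord : 'I_d -> 'cV[R]_d -> measurableTypeR R := fun i x => x i 0.

Let cV_set0 : g_sigma_preimage coord set0.
Proof. exact: sigma_algebra0. Qed.

Let cV_setC A : g_sigma_preimage coord A -> g_sigma_preimage coord (~` A).
Proof. exact: sigma_algebraC. Qed.

Let cV_bigcup (F : _^nat) : (forall i, g_sigma_preimage coord (F i)) ->
  g_sigma_preimage coord (\bigcup_i (F i)).
Proof. exact: sigma_algebra_bigcup. Qed.

HB.instance Definition _ := @isMeasurable.Build
  default_measure_display 'cV[R]_d (g_sigma_preimage coord) cV_set0 cV_setC cV_bigcup.

Lemma measurable_coord (i : 'I_d) :
  measurable_fun [set: 'cV[R]_d] (fun x : 'cV[R]_d => x i 0 : measurableTypeR R).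
Proof.
move=> _ Y mY; rewrite setTI; apply: sub_sigma_algebra => /=.
rewrite -bigcup_seq/=; exists i => /=; first by rewrite mem_index_enum.
by exists Y => //; rewrite setTI.
Qed.

Lemma measurable_fun_cV disp (T : measurableType disp) (f : T -> 'cV[R]_d) :
  (forall i, measurable_fun setT (fun t => f t i 0 : measurableTypeR R)) ->
  measurable_fun setT f.
Proof.
move=> mf _ Y mY; rewrite setTI.
have := @g_sigma_preimage_comp _ _ d _ coord _ f.
move=> /(congr1 (fun S : set (set T) => S (f @^-1` Y))) E.
have : preimage_set_system setT f (g_sigma_preimage coord) (f @^-1` Y).
  by exists Y => //; rewrite setTI.
rewrite -E; apply: smallest_sub; first exact: sigma_algebra_measurable.
rewrite -bigcup_seq; apply: bigcup_sub => i _ A [B mB <-].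
exact: mf.
Qed.

End measurable_cV.

Section lebesgue_cV.
Context {R : realType}.

Definition cV_cons d (p : measurableTypeR R * 'cV[R]_d) : 'cV[R]_d.+1 :=
  \col_i (if unlift ord0 i is Some j then p.2 j 0 else p.1).

Definition cV_uncons d (v : 'cV[R]_d.+1) : measurableTypeR R * 'cV[R]_d :=
  (v ord0 0, \col_j v (lift ord0 j) 0).

Lemma cV_consK d : cancel (@cV_cons d) (@cV_uncons d).
Proof.
case=> x v; rewrite /cV_uncons /cV_cons mxE unlift_none; congr pair.
by apply/colP => j; rewrite !mxE liftK.
Qed.

Lemma measurable_cV_cons d : measurable_fun setT (@cV_cons d).
Proof.
apply: measurable_fun_cV => i.
rewrite (_ : (fun _ => _) = (fun p : measurableTypeR R * 'cV[R]_d =>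
    if unlift ord0 i is Some j then p.2 j 0 else p.1)); last first.
  by apply/funext => p; rewrite mxE.
case: unliftP => [j _|_]; last exact: measurable_fst.
apply: (measurableT_comp (measurable_coord j)); exact: measurable_snd.
Qed.

Lemma measurable_cV_uncons d : measurable_fun setT (@cV_uncons d).
Proof.
apply/measurable_fun_pairP; split; first exact: measurable_coord.
apply: measurable_fun_cV => i.
rewrite (_ : (fun _ => _) = (fun p : 'cV[R]_d.+1 => p (lift ord0 i) 0)).
  exact: measurable_coord.
by apply/funext => p; rewrite /= mxE.
Qed.

Section step.
Variables (d : nat) (m : {sigma_finite_measure set 'cV[R]_d -> \bar R}).

Definition lebesgue_step : set 'cV[R]_d.+1 -> \bar R :=
  pushforward ((@lebesgue_measure R) \x m)%E (@cV_cons d).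

Let step0 : lebesgue_step set0 = 0%E.
Proof. by rewrite /lebesgue_step /pushforward preimage_set0 measure0. Qed.

Let step_ge0 A : (0 <= lebesgue_step A)%E.
Proof. by rewrite /lebesgue_step /pushforward; exact: measure_ge0. Qed.

Let step_sigma_additive : semi_sigma_additive lebesgue_step.
Proof.
move=> F mF tF mUF; rewrite /lebesgue_step /pushforward preimage_bigcup.
have mS n : measurable (@cV_cons d @^-1` F n).
  by rewrite -[X in measurable X]setTI; exact: measurable_cV_cons.
apply: measure_semi_sigma_additive => //.
- apply/trivIsetP => /= i j _ _ ij; rewrite -preimage_setI.
  by move/trivIsetP : tF => /(_ _ _ _ _ ij) ->//; rewrite preimage_set0.
- exact: bigcup_measurable.
Qed.

HB.instance Definition _ := isMeasure.Build _ _ _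
  lebesgue_step step0 step_ge0 step_sigma_additive.

Let step_sigma_finite : sigma_finite setT lebesgue_step.
Proof.
have /sigma_finiteP[F [TF ndF Foo]] := sigma_finiteT (@lebesgue_measure R).
have /sigma_finiteP[G [TG ndG Goo]] := sigma_finiteT m.
exists (fun k => @cV_uncons d @^-1` (F k `*` G k)) => [|k].
  apply/seteqP; split=> // v _.
  have [k _ Fk] : (\bigcup_k F k) (cV_uncons v).1 by rewrite -TF.
  have [l _ Gl] : (\bigcup_k G k) (cV_uncons v).2 by rewrite -TG.
  exists (maxn k l) => //; split.
  - by move: Fk; exact/subsetPset/ndF/leq_maxl.
  - by move: Gl; exact/subsetPset/ndG/leq_maxr.
have [mF Fkoo] := Foo k; have [mG Gkoo] := Goo k; split.
  rewrite -[X in measurable X]setTI; apply: measurable_cV_uncons => //.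
  exact: measurableX.
rewrite /lebesgue_step /pushforward -comp_preimage.
rewrite (_ : _ \o _ = id); last by apply/funext => p /=; rewrite cV_consK.
by rewrite preimage_id product_measure1E// lte_mul_pinfty// ge0_fin_numE.
Qed.

HB.instance Definition _ := Measure_isSigmaFinite.Build _ _ _
  lebesgue_step step_sigma_finite.

End step.

(* Lebesgue measure on R^d, as the d-fold product of [lebesgue_measure]. *)
Fixpoint lebesgue_cV d : {sigma_finite_measure set 'cV[R]_d -> \bar R} :=
  match d with
  | 0 => (\d_ (0 : 'cV[R]_0))%R
  | d'.+1 => lebesgue_step (lebesgue_cV d')
  end.

Lemma lebesgue_cV_box d (A : 'I_d -> set (measurableTypeR R)) :
  (forall i, measurable (A i)) ->
  lebesgue_cV d [set x | forall i, A i (x i 0)] =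
  (\prod_(i < d) lebesgue_measure (A i))%E.
Proof.
elim: d A => [|d IH] A mA.
  rewrite big_ord0 /= diracE mem_set//= => i.
  by case: i.
rewrite big_ord_recl /= -IH; last by move=> i; exact: mA.
have mB : measurable [set x : 'cV[R]_d | forall i, A (lift ord0 i) (x i 0)].
  rewrite (_ : mkset _ = \bigcap_(i in [set: 'I_d])
      ((fun x : 'cV[R]_d => x i 0 : measurableTypeR R) @^-1` A (lift ord0 i))).
    apply: fin_bigcap_measurable => // i _.
    by rewrite -[X in measurable X]setTI; exact: measurable_coord.
  by apply/seteqP; split=> x /= H i; [move=> _|]; exact: H.
rewrite -product_measure1E//= /lebesgue_step /pushforward; congr (_ _).
apply/seteqP; split=> -[x v] /=.
  move=> H; split; first by have := H ord0; rewrite mxE unlift_none.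
  by move=> i; have := H (lift ord0 i); rewrite mxE liftK.
by case=> /= Hx Hv i; rewrite mxE; case: unliftP => [j ->|->].
Qed.

End lebesgue_cV.

(* [integral_C] and [sum_C] are meaningful when the integrand is integrable,
   resp. the family absolutely summable; they inherit the default values of
   [Rintegral] and [fine] otherwise. *)
Section complex_integral_sum.
Context {R : realType}.

Definition measurable_fun_C disp (T : measurableType disp) (f : T -> R[i]) :=
  measurable_fun setT (fun x => complex.Re (f x) : measurableTypeR R) /\
  measurable_fun setT (fun x => complex.Im (f x) : measurableTypeR R).

Definition integral_C disp (T : measurableType disp)
    (mu : {measure set T -> \bar R}) (f : T -> R[i]) : R[i] :=
  (\int[mu]_x complex.Re (f x)) +i* (\int[mu]_x complex.Im (f x)).

Definition L_C disp (T : measurableType disp)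
    (mu : {measure set T -> \bar R}) (p : \bar R) (f : T -> R[i]) :=
  measurable_fun_C f /\ finite_norm mu p (fun x => normc (f x)).

Definition cvg_L2_C disp (T : measurableType disp)
    (mu : {measure set T -> \bar R}) (u : (T -> R[i])^nat) (f : T -> R[i]) :=
  (fun n => Lnorm mu 2%:E (fun x => (normc (u n x - f x))%:E)) @ \oo --> 0%E.

Definition sum_R (I : choiceType) (D : set I) (f : I -> R) : R :=
  fine (esum D (EFin \o f)^\+ - esum D (EFin \o f)^\-)%E.

Definition sum_C (I : choiceType) (D : set I) (f : I -> R[i]) : R[i] :=
  sum_R D (fun i => complex.Re (f i)) +i* sum_R D (fun i => complex.Im (f i)).

Definition l1_C (I : choiceType) (a : I -> R[i]) :=
  summable setT (fun i => (normc (a i))%:E).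

(* e^(2 pi i t) *)
Definition expi2pi (t : R) : R[i] := cos (2 * pi * t) +i* sin (2 * pi * t).

End complex_integral_sum.

Section groups.
Context {R : realType} {d : nat}.

Definition dotmul (x y : 'cV[R]_d) : R := \sum_i x i 0 * y i 0.

Definition iota_Z (g : 'cV[int]_d) : 'cV[R]_d := map_mx intr g.

Definition torus_rel (x y : 'cV[R]_d) : bool :=
  `[< exists g : 'cV[int]_d, x - y = iota_Z g >].

Let torus_rel_refl : reflexive torus_rel.
Proof.
by move=> x; apply/asboolP; exists 0; apply/colP => i; rewrite subrr !mxE.
Qed.

Let torus_rel_sym : symmetric torus_rel.
Proof.
suff H x y : torus_rel x y -> torus_rel y x by move=> x y; apply/idP/idP; exact: H.
move=> /asboolP[g xyg]; apply/asboolP; exists (- g).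
by rewrite -opprB xyg; apply/colP => i; rewrite !mxE rmorphN.
Qed.

Let torus_rel_trans : transitive torus_rel.
Proof.
move=> y x z /asboolP[g xyg] /asboolP[h yzh]; apply/asboolP; exists (g + h).
rewrite -(subrKA y) xyg yzh.
by apply/colP => i; rewrite !mxE rmorphD.
Qed.

Canonical torus_equiv : equiv_rel 'cV[R]_d :=
  EquivRel torus_rel torus_rel_refl torus_rel_sym torus_rel_trans.

End groups.

(* T^d = R^d / Z^d *)
Definition torus (R : realType) (d : nat) : Type :=
  {eq_quot (@torus_equiv R d)}.

Section torus.
Context {R : realType} {d : nat}.
Local Notation torus := (torus R d).

HB.instance Definition _ := Choice.on torus.
HB.instance Definition _ := EqQuotient.on torus.

Definition hat_iota (x : 'cV[R]_d) : torus := \pi_torus x.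

HB.instance Definition _ := isPointed.Build torus (hat_iota 0).

Definition torus_measurable : set (set torus) :=
  image_set_system setT hat_iota measurable.

Let torus_set0 : torus_measurable set0.
Proof. by rewrite /torus_measurable /image_set_system /= preimage_set0 setI0. Qed.

Let torus_setC A : torus_measurable A -> torus_measurable (~` A).
Proof.
rewrite /torus_measurable /image_set_system /= !setTI preimage_setC.
exact: measurableC.
Qed.

Let torus_bigcup (F : _^nat) : (forall i, torus_measurable (F i)) ->
  torus_measurable (\bigcup_i (F i)).
Proof.
rewrite /torus_measurable /image_set_system /= => mF.
rewrite setTI preimage_bigcup; apply: bigcup_measurable => i _.
by have := mF i; rewrite setTI.
Qed.

HB.instance Definition _ := @isMeasurable.Build
  default_measure_display torus torus_measurable torus_set0 torus_setC torus_bigcup.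

Lemma measurable_hat_iota : measurable_fun setT hat_iota.
Proof. by move=> _ Y; rewrite setTI /measurable/= /torus_measurable /image_set_system /= setTI. Qed.

Definition unit_cube : set 'cV[R]_d := [set x | forall i, 0 <= x i 0 < 1].

Lemma measurable_unit_cube : measurable unit_cube.
Proof.
rewrite (_ : unit_cube = \bigcap_(i in [set: 'I_d])
    ((fun x : 'cV[R]_d => x i 0 : measurableTypeR R) @^-1` `[0, 1[%classic)).
  apply: fin_bigcap_measurable => // i _.
  by rewrite -[X in measurable X]setTI; apply: measurable_coord.
apply/seteqP; split=> x /= H i; first by move=> _ /=; rewrite in_itv /=; exact: H.
by have := H i I; rewrite /= in_itv.
Qed.

(* Normalised Haar measure on T^d: the image of Lebesgue measure on [0,1)^d. *)
Definition haar : set torus -> \bar R :=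
  pushforward (mrestr (lebesgue_cV d) measurable_unit_cube) hat_iota.

Let haar0 : haar set0 = 0%E.
Proof. by rewrite /haar /pushforward preimage_set0 measure0. Qed.

Let haar_ge0 A : (0 <= haar A)%E.
Proof. by rewrite /haar /pushforward; exact: measure_ge0. Qed.

Let haar_sigma_additive : semi_sigma_additive haar.
Proof.
move=> F mF tF mUF; rewrite /haar /pushforward preimage_bigcup.
have mS n : measurable (hat_iota @^-1` F n).
  by rewrite -[X in measurable X]setTI; exact: measurable_hat_iota.
apply: measure_semi_sigma_additive => //.
- apply/trivIsetP => /= i j _ _ ij; rewrite -preimage_setI.
  by move/trivIsetP : tF => /(_ _ _ _ _ ij) ->//; rewrite preimage_set0.
- exact: bigcup_measurable.
Qed.

HB.instance Definition _ := isMeasure.Build _ _ _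
  haar haar0 haar_ge0 haar_sigma_additive.

Let haarT : haar setT = 1%E.
Proof.
rewrite /haar /pushforward /mrestr preimage_setT setTI.
have -> : unit_cube = [set x : 'cV[R]_d | forall i : 'I_d,
    (fun=> `[0%R, 1%R[%classic : set (measurableTypeR R)) i (x i 0)].
  by apply/seteqP; split=> x /= H i; have := H i; rewrite /= in_itv.
have := @lebesgue_cV_box R d (fun=> `[0%R, 1%R[%classic).
move=> -> //; rewrite big1// => i _.
by rewrite lebesgue_measure_itv /= lte01 oppr0 adde0.
Qed.

HB.instance Definition _ := Measure_isProbability.Build _ _ _ haar haarT.

(* (g, z) = e^(2 pi i g.z); independent of the representative of z. *)
Definition torus_char (g : 'cV[int]_d) (z : torus) : R[i] :=
  expi2pi (dotmul (iota_Z g) (repr z)).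

End torus.

Section fourier.
Context {R : realType} {d : nat}.
Local Notation Rd := 'cV[R]_d.
Local Notation Zd := 'cV[int]_d.
Local Notation leb := (lebesgue_cV d).

Definition L2 (f : Rd -> R[i]) := L_C leb 2%:E f.

(* The kernel is e^(2 pi i x.xi), with a plus sign. *)
Definition fourier_L1 (f : Rd -> R[i]) (xi : Rd) : R[i] :=
  integral_C leb (fun x => f x * expi2pi (dotmul x xi)).

(* [h] represents the extension by continuity (Plancherel) of [fourier_L1],
   from the integrable elements of L^2 to L^2, at [f]. *)
Definition is_fourier (f h : Rd -> R[i]) :=
  [/\ L2 f, L2 h &
      exists u : (Rd -> R[i])^nat,
        [/\ forall n, L_C leb 1%E (u n) /\ L2 (u n),
            cvg_L2_C leb u f &
            cvg_L2_C leb (fun n => fourier_L1 (u n)) h]].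

(* L^2 functions are taken up to equality almost everywhere: [fourier f] and
   [inv_fourier p] are representatives of the image and of the preimage under
   the unitary Fourier transform of L^2. *)
Definition fourier (f : Rd -> R[i]) : Rd -> R[i] :=
  xget (fun=> 0) [set h | is_fourier f h].

Definition inv_fourier (p : Rd -> R[i]) : Rd -> R[i] :=
  xget (fun=> 0) [set f | is_fourier f p].

Definition fourier_Z (a : Zd -> R[i]) (z : torus R d) : R[i] :=
  sum_C setT (fun g => a g * torus_char g z).

Definition fourier_T (b : torus R d -> R[i]) (g : Zd) : R[i] :=
  integral_C haar (fun z => b z * torus_char (- g) z).

End fourier.

Section embedding.
Context {R : realType} {d : nat}.
Local Notation Rd := 'cV[R]_d.
Local Notation Zd := 'cV[int]_d.
Local Notation leb := (lebesgue_cV d).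

(* Z^d is discrete; the last condition is the continuity of the inverse of
   theta on its image, for the subspace topology. *)
Definition is_embedding (theta : {additive Zd -> Rd}) :=
  [/\ injective theta,
      continuous (theta : discrete_topology Zd -> Rd) &
      exists2 inv : Rd -> discrete_topology Zd,
        cancel theta inv & {within range theta, continuous inv}].

Variable theta : {additive Zd -> Rd}.

(* The unique nonsingular linear map with theta = A iota. *)
Definition emb_mx : 'M[R]_d :=
  xget 0 [set A : 'M[R]_d |
    A \in unitmx /\ forall g : Zd, theta g = A *m iota_Z g].

Definition hat_theta (xi : Rd) : torus R d := hat_iota (emb_mx^T *m xi).

(* [f, g]_theta *)
Definition bracket (f g : Rd -> R[i]) (c : Zd) : R[i] :=
  integral_C leb (fun x => (f (x - theta c))^* * g x).

(* f o_theta a *)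
Definition action (f : Rd -> R[i]) (a : Zd -> R[i]) (x : Rd) : R[i] :=
  sum_C setT (fun c => a c * f (x - theta c)).

(* [[p, q]]_theta *)
Definition dual_bracket (p q : Rd -> R[i]) (z : torus R d) : R[i] :=
  (`|\det emb_mx|^-1)%:C *
  sum_C [set xi | hat_theta xi = z] (fun xi => (p xi)^* * q xi).

(* p o^_theta b *)
Definition dual_action (p : Rd -> R[i]) (b : torus R d -> R[i]) (xi : Rd) : R[i] :=
  p xi * b (hat_theta xi).

End embedding.

(* Main.v *)
(** The identities for [dual_bracket] come from unfolding: multiplying the
    periodisation of conj(p) q by a character and integrating over the torus
    gives the integral over R^d of conj(e_c p) q, where e_c is the character of
    theta(c); by Parseval and the translation rule this is [f, g]_theta(c) when
    p, q are the transforms of f, g.  This is the third claim, and it says that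
    the two sides of the second one have the same Fourier coefficients, hence
    agree a.e. because the characters are total on the torus.  The first claim
    is Fubini's theorem for integrable f, and extends to L^2 since f |-> f o a
    is bounded by the l^1 norm of a.

    The Fourier theory behind this is obtained from the torus.  If f lives on
    the unit cube, the values of its transform on t + Z^d are the Fourier
    coefficients of f times a character, so integrating Parseval's identity on
    the cube over t gives Plancherel's identity; scaling and truncation give it
    on L^2.  Surjectivity follows from the multiplication formula.  The
    characters are total because the sets whose indicator functions preserve
    the annihilator of the characters form a sigma-algebra, which contains the
    slabs b < x_i. *)
Require Import Defs.
(* Imported before the rest: [fingroup] would otherwise shadow the [repr] of
   quotient types. *)
From mathcomp Require Import fingroup perm.
From mathcomp Require Import all_boot all_order all_algebra.
From mathcomp Require Import all_classical all_reals all_analysis.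
From mathcomp Require Import measurable_realfun complex ring lra.
Import Order.TTheory GRing.Theory Num.Theory.
Import numFieldNormedType.Exports.

Set Implicit Arguments.
Unset Strict Implicit.
Unset Printing Implicit Defensive.
Local Open Scope classical_set_scope.
Local Open Scope ring_scope.
Local Open Scope complex_scope.
Local Notation leb := lebesgue_cV.
Local Notation normc := Normc.normc.
Local Notation Re := complex.Re.
Local Notation Im := complex.Im.

(** * Complex-valued functions and L^2 *)

(** Two features of the statement shape the proof. The transforms are representatives picked by
    [xget], and [is_fourier] admits any approximating sequence; so existence, uniqueness almost
    everywhere and surjectivity come before any identity. Moreover [integral_C] and [sum_C] are
    total, with default values, so their algebra is available only where absolute convergence is
    known; on the fibres of [hat_theta] and for [action] on L^2 this is almost everywhere, and comes
    from integrating a sum of nonnegative terms. Hence the recurring order: nonnegative functions,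
    then positive and negative parts, then real and imaginary parts. Two prerequisites are tacit in
    the overview. The determinant in [dual_bracket] requires the linear change of variables, which
    is reduced to triangular factors since Lebesgue measure is an iterated product. The matrix of
    [theta] must be invertible, and this is where the topology of an embedding enters: the map
    sending (m, n) to (m + n sqrt 2, 0) is an injective homomorphism given by a singular matrix, and
    only the discreteness of the image excludes it. *)

Section complex_algebra.
Context {R : realType}.
Implicit Types z w : R[i].

(** The squared modulus, kept polynomial in the two components so that identities close by [ring]
    and no square root appears. *)
Definition sqn z : R := Re z ^+ 2 + Im z ^+ 2.

Lemma ReM z w : Re (z * w) =
  Re z * Re w - Im z * Im w.
Proof. by case: z w => a b [c d]. Qed.

Lemma ImM z w : Im (z * w) =
  Re z * Im w + Im z * Re w.
Proof. by case: z w => a b [c d]. Qed.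

Lemma ReD z w : Re (z + w) = Re z + Re w.
Proof. by case: z w => a b [c d]. Qed.

Lemma ImD z w : Im (z + w) = Im z + Im w.
Proof. by case: z w => a b [c d]. Qed.

Lemma ReN z : Re (- z) = - Re z.
Proof. by case: z. Qed.

Lemma ImN z : Im (- z) = - Im z.
Proof. by case: z. Qed.

Lemma ReJ z : Re z^* = Re z.
Proof. by case: z. Qed.

Lemma ImJ z : Im z^* = - Im z.
Proof. by case: z. Qed.

Definition ReImE := (ReM, ImM, ReD, ImD, ReN, ImN, ReJ, ImJ).

Lemma complexP z w : Re z = Re w ->
  Im z = Im w -> z = w.
Proof. by case: z w => a b [c d] /= -> ->. Qed.

Lemma sqn_ge0 z : 0 <= sqn z.
Proof. by rewrite addr_ge0// sqr_ge0. Qed.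

Lemma sqn0 : sqn 0 = 0.
Proof. by rewrite /sqn /= expr0n addr0. Qed.

Lemma sqn_eq0 z : sqn z = 0 -> z = 0.
Proof.
move=> /eqP; rewrite paddr_eq0 ?sqr_ge0// !sqrf_eq0 => /andP[/eqP a /eqP b].
exact: complexP.
Qed.

Lemma sqnM z w : sqn (z * w) = sqn z * sqn w.
Proof. by rewrite /sqn !ReImE; ring. Qed.

Lemma sqnN z : sqn (- z) = sqn z.
Proof. by rewrite /sqn !ReImE; ring. Qed.

Lemma sqnB z w : sqn (z - w) = sqn (w - z).
Proof. by rewrite -sqnN opprB. Qed.

Lemma sqnJ z : sqn z^* = sqn z.
Proof. by rewrite /sqn !ReImE; ring. Qed.

Lemma sqnC (r : R) : sqn r%:C = r ^+ 2.
Proof. by rewrite /sqn /= expr0n addr0. Qed.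

Lemma mulJ_sqn z : z^* * z = (sqn z)%:C.
Proof. by apply: complexP; rewrite !ReImE/= /sqn; ring. Qed.

(** By the parallelogram law the two sides differ by [sqn (z - w)]. *)
Lemma sqnD_le z w : sqn (z + w) <= 2 * sqn z + 2 * sqn w.
Proof.
rewrite -subr_ge0 (_ : _ - _ = sqn (z - w)) ?sqn_ge0//.
by rewrite /sqn !ReImE; ring.
Qed.

Lemma normc_ge0 z : 0 <= normc z.
Proof. by case: z => a b /=; rewrite sqrtr_ge0. Qed.

Lemma sqr_normc z : normc z ^+ 2 = sqn z.
Proof. by case: z => a b /=; rewrite sqr_sqrtr// addr_ge0// sqr_ge0. Qed.

Lemma normcE z : normc z = Num.sqrt (sqn z).
Proof. by case: z. Qed.

Lemma Re_normc z : `|Re z| <= normc z.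
Proof.
by rewrite normcE -sqrtr_sqr ler_sqrt ?sqn_ge0// lerDl sqr_ge0.
Qed.

Lemma Im_normc z : `|Im z| <= normc z.
Proof.
by rewrite normcE -sqrtr_sqr ler_sqrt ?sqn_ge0// lerDr sqr_ge0.
Qed.

Lemma normc_ReIm z : normc z <= `|Re z| + `|Im z|.
Proof.
rewrite -(ler_pXn2r (ltn0Sn 1)) ?nnegrE ?normc_ge0 ?addr_ge0//.
rewrite sqr_normc /sqn sqrrD !real_normK ?num_real// -addrA [in leRHS]addrC.
have := mulr_ge0 (normr_ge0 (Re z)) (normr_ge0 (Im z)).
by rewrite mulr2n; lra.
Qed.

Lemma normcJ z : normc z^* = normc z.
Proof. by rewrite !normcE sqnJ. Qed.

(** A crude arithmetic-geometric bound; it is enough to make the product of two square-integrable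
    functions integrable. *)
Lemma normc_mul_le z w : normc (z * w) <= sqn z + sqn w.
Proof.
rewrite Normc.normcM -!sqr_normc.
have := sqr_ge0 (normc z - normc w).
have := sqr_ge0 (normc z); have := sqr_ge0 (normc w).
by rewrite sqrrB; rewrite mulr2n; lra.
Qed.

Lemma expi2piD s t : expi2pi (s + t) = expi2pi s * expi2pi t :> R[i].
Proof.
by apply: complexP; rewrite !ReImE /= mulrDr ?cosD ?sinD// addrC; ring.
Qed.

Lemma expi2pi0 : expi2pi 0 = 1 :> R[i].
Proof. by rewrite /expi2pi mulr0 cos0 sin0. Qed.

Lemma expi2piN t : expi2pi (- t) = (expi2pi t)^* :> R[i].
Proof. by rewrite /expi2pi mulrN cosN sinN. Qed.

Lemma sqn_expi2pi t : sqn (expi2pi t) = 1 :> R.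
Proof. by rewrite /sqn /= cos2Dsin2. Qed.

Lemma normc_expi2pi t : normc (expi2pi t) = 1 :> R.
Proof. by rewrite normcE sqn_expi2pi sqrtr1. Qed.

Lemma expi2pi_int (n : int) : expi2pi n%:~R = 1 :> R[i].
Proof.
have E (k : nat) : expi2pi k%:R = 1 :> R[i].
  elim: k => [|k IH]; first exact: expi2pi0.
  rewrite -natr1 expi2piD IH mul1r /expi2pi mulr1.
  by rewrite mulr_natl -(add0r (pi *+ 2)) cosD2pi sinD2pi cos0 sin0.
case: n => n; first exact: E.
by rewrite NegzE intrN expi2piN [_%:~R]/(n.+1%:R) E conjc1.
Qed.

Lemma expi2pi_half : expi2pi (2^-1) = -1 :> R[i].
Proof.
rewrite /expi2pi mulrAC divff ?mul1r ?cospi ?sinpi//.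
by apply: complexP; rewrite /= ?oppr0.
Qed.

End complex_algebra.

Section complex_measurable.
Context {R : realType} disp (T : measurableType disp).
Implicit Types f g : T -> R[i].

Lemma measurable_CD f g : measurable_fun_C f -> measurable_fun_C g ->
  measurable_fun_C (fun x => f x + g x).
Proof.
move=> [a b] [c d]; split; [under eq_fun do rewrite ReD|under eq_fun do rewrite ImD];
by apply: measurable_funD.
Qed.

Lemma measurable_CN f : measurable_fun_C f -> measurable_fun_C (fun x => - f x).
Proof.
move=> [a b]; split; [under eq_fun do rewrite ReN|under eq_fun do rewrite ImN];
by apply: measurable_funN.
Qed.

Lemma measurable_CB f g : measurable_fun_C f -> measurable_fun_C g ->
  measurable_fun_C (fun x => f x - g x).
Proof. by move=> mf mg; apply: measurable_CD => //; exact: measurable_CN. Qed.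

Lemma measurable_CM f g : measurable_fun_C f -> measurable_fun_C g ->
  measurable_fun_C (fun x => f x * g x).
Proof.
move=> [a b] [c d]; split; [under eq_fun do rewrite ReM|under eq_fun do rewrite ImM].
  by apply: measurable_funB; apply: measurable_funM.
by apply: measurable_funD; apply: measurable_funM.
Qed.

Lemma measurable_CJ f : measurable_fun_C f -> measurable_fun_C (fun x => (f x)^*).
Proof.
move=> [a b]; split; [under eq_fun do rewrite ReJ|under eq_fun do rewrite ImJ] => //.
exact: measurable_funN.
Qed.

Lemma measurable_Ccst (c : R[i]) : measurable_fun_C (fun _ : T => c).
Proof. by split; exact: measurable_cst. Qed.

Lemma measurable_Creal (f : T -> R) : measurable_fun setT f ->
  measurable_fun_C (fun x => (f x)%:C).
Proof. by move=> mf; split => //=; exact: measurable_cst. Qed.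

Lemma measurable_sqn f : measurable_fun_C f -> measurable_fun setT (fun x => sqn (f x)).
Proof. by move=> [a b]; apply: measurable_funD; exact: measurable_funX. Qed.

Lemma measurable_normc f : measurable_fun_C f ->
  measurable_fun setT (fun x => normc (f x)).
Proof.
move=> mf; under eq_fun do rewrite normcE.
apply: (measurableT_comp (continuous_measurable_fun (@sqrt_continuous R))).
exact: measurable_sqn.
Qed.

Lemma measurable_EFin_normc f : measurable_fun_C f ->
  measurable_fun setT (fun x => (normc (f x))%:E).
Proof. by move=> mf; apply/measurable_EFinP; exact: measurable_normc. Qed.

Lemma measurable_expi2pi (f : T -> R) : measurable_fun setT f ->
  measurable_fun_C (fun x => expi2pi (f x)).
Proof.
move=> mf; split => /=.
  apply: (measurableT_comp (continuous_measurable_fun (@continuous_cos R))).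
  exact: measurable_funM.
apply: (measurableT_comp (continuous_measurable_fun (@continuous_sin R))).
exact: measurable_funM.
Qed.

Lemma measurable_C_comp d' (T' : measurableType d') (h : T' -> T) f :
  measurable_fun_C f -> measurable_fun setT h -> measurable_fun_C (f \o h).
Proof.
by move=> [a b] mh; split; [apply: (measurableT_comp a)|apply: (measurableT_comp b)].
Qed.

Lemma measurable_C_indic f (A : set T) : measurable A -> measurable_fun_C f ->
  measurable_fun_C (fun x => (\1_A x)%:C * f x).
Proof.
move=> mA mf; apply: measurable_CM => //; apply: measurable_Creal.
exact: measurable_indic.
Qed.

Lemma measurable_C_cvg (u : (T -> R[i])^nat) f :
  (forall n, measurable_fun_C (u n)) ->
  (forall x, (fun n => Re (u n x)) @ \oo --> Re (f x)) ->
  (forall x, (fun n => Im (u n x)) @ \oo --> Im (f x)) ->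
  measurable_fun_C f.
Proof.
move=> mu cr ci; split.
- by apply: (measurable_fun_cvg (h := fun n x => Re (u n x))) => // m; exact: (mu m).1.
- by apply: (measurable_fun_cvg (h := fun n x => Im (u n x))) => // m; exact: (mu m).2.
Qed.

End complex_measurable.

Section cvgC.
Context {R : realType}.
Implicit Types (u v : (R[i])^nat) (l : R[i]).

(** Convergence is componentwise because [integral_C] and [sum_C] are themselves defined by
    components. *)
Definition cvgC u l :=
  ((fun n => Re (u n)) @ \oo --> Re l) /\
  ((fun n => Im (u n)) @ \oo --> Im l).

Lemma cvgC_unique u l l' : cvgC u l -> cvgC u l' -> l = l'.
Proof.
move=> [a b] [c d]; apply: complexP.
  by rewrite -(cvg_lim _ a)// -(cvg_lim _ c).
by rewrite -(cvg_lim _ b)// -(cvg_lim _ d).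
Qed.

Lemma cvgC_cst l : cvgC (fun=> l) l.
Proof. by split; exact: cvg_cst. Qed.

Lemma cvgCD u v l l' : cvgC u l -> cvgC v l' ->
  cvgC (fun n => u n + v n) (l + l').
Proof.
move=> [a b] [c d]; rewrite /cvgC ReD ImD; split.
  by under eq_fun do rewrite ReD; exact: cvgD.
by under eq_fun do rewrite ImD; exact: cvgD.
Qed.

Lemma cvgCM u v l l' : cvgC u l -> cvgC v l' ->
  cvgC (fun n => u n * v n) (l * l').
Proof.
move=> [a b] [c d]; rewrite /cvgC ReM ImM; split.
  by under eq_fun do rewrite ReM; apply: cvgB; exact: cvgM.
by under eq_fun do rewrite ImM; apply: cvgD; exact: cvgM.
Qed.

Lemma cvgCN u l : cvgC u l -> cvgC (fun n => - u n) (- l).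
Proof.
move=> [a b]; rewrite /cvgC ReN ImN; split.
  by under eq_fun do rewrite ReN; exact: cvgN.
by under eq_fun do rewrite ImN; exact: cvgN.
Qed.

Lemma cvgC_sqn u l : cvgC u l -> (fun n => sqn (u n)) @ \oo --> sqn l.
Proof.
by move=> [a b]; apply: cvgD; [rewrite expr2|rewrite expr2];
  under eq_fun do rewrite expr2; exact: cvgM.
Qed.

End cvgC.

(** * Integrals of complex functions and dominated convergence *)

Section complex_integral.
Context {R : realType} disp (T : measurableType disp).
Variable mu : {measure set T -> \bar R}.
Implicit Types f g : T -> R[i].

Definition integrable_C f :=
  measurable_fun_C f /\ (\int[mu]_x (normc (f x))%:E < +oo)%E.

Lemma integrable_C_le f (g : T -> R) : measurable_fun_C f ->
  mu.-integrable setT (EFin \o g) -> (forall x, normc (f x) <= g x) ->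
  integrable_C f.
Proof.
move=> mf /integrableP[mg ig] le; split => //; apply: le_lt_trans ig.
apply: ge0_le_integral => //=.
- by move=> x _; rewrite lee_fin normc_ge0.
- exact: measurable_EFin_normc.
- by apply/measurable_EFinP; apply: measurableT_comp => //; exact/measurable_EFinP.
- by move=> x _; rewrite lee_fin (le_trans (le x))// ler_norm.
Qed.

Lemma integrable_C_normc f : integrable_C f ->
  mu.-integrable setT (EFin \o (fun x => normc (f x))).
Proof.
move=> [mf i]; apply/integrableP; split.
  exact: measurable_EFin_normc.
by under eq_integral do rewrite /= ger0_norm ?normc_ge0//.
Qed.

Lemma integrable_CP f : integrable_C f <->
  mu.-integrable setT (EFin \o (fun x => Re (f x))) /\
  mu.-integrable setT (EFin \o (fun x => Im (f x))).
Proof.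
split=> [h|[hr hi]].
  have i := integrable_C_normc h.
  split; apply: (le_integrable _ _ _ i) => //.
  - by apply/measurable_EFinP; exact: h.1.1.
  - by move=> x _ /=; rewrite lee_fin [leRHS]ger0_norm ?normc_ge0// Re_normc.
  - by apply/measurable_EFinP; exact: h.1.2.
  - by move=> x _ /=; rewrite lee_fin [leRHS]ger0_norm ?normc_ge0// Im_normc.
apply: (@integrable_C_le _ (fun x => `|Re (f x)| + `|Im (f x)|)).
- by split; apply/measurable_EFinP; [exact: measurable_int hr|exact: measurable_int hi].
- rewrite (_ : _ \o _ = (abse \o (EFin \o (fun x => Re (f x))))
    \+ (abse \o (EFin \o (fun x => Im (f x)))))//.
  by apply: integrableD => //; exact: integrable_abse.
- by move=> x; exact: normc_ReIm.
Qed.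

Lemma integrable_CD f g : integrable_C f -> integrable_C g ->
  integrable_C (fun x => f x + g x).
Proof.
move=> /integrable_CP[a b] /integrable_CP[c d]; apply/integrable_CP; split.
  by under [X in EFin \o X]eq_fun do rewrite ReD; exact: (integrableD measurableT a c).
by under [X in EFin \o X]eq_fun do rewrite ImD; exact: (integrableD measurableT b d).
Qed.

Lemma integrable_CN f : integrable_C f -> integrable_C (fun x => - f x).
Proof.
move=> /integrable_CP[a b]; apply/integrable_CP; split.
  by under [X in EFin \o X]eq_fun do rewrite ReN; exact: (integrableN a).
by under [X in EFin \o X]eq_fun do rewrite ImN; exact: (integrableN b).
Qed.

Lemma integrable_CB f g : integrable_C f -> integrable_C g ->
  integrable_C (fun x => f x - g x).
Proof. by move=> a b; apply: integrable_CD => //; exact: integrable_CN. Qed.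

Lemma integrable_CJ f : integrable_C f -> integrable_C (fun x => (f x)^*).
Proof.
by move=> [a b]; split; [exact: measurable_CJ|under eq_integral do rewrite normcJ].
Qed.

Lemma integrable_CMb f g (M : R) : integrable_C f -> measurable_fun_C g ->
  (forall x, normc (g x) <= M) -> integrable_C (fun x => g x * f x).
Proof.
move=> i mg le; apply: (@integrable_C_le _ (fun x => M * normc (f x))).
- by apply: measurable_CM => //; exact: i.1.
- by exact: (integrableZl measurableT M (integrable_C_normc i)).
- by move=> x; rewrite Normc.normcM ler_wpM2r// normc_ge0.
Qed.

Lemma integrable_CZ (c : R[i]) f : integrable_C f -> integrable_C (fun x => c * f x).
Proof.
by move=> i; exact: (@integrable_CMb _ (fun=> c) (normc c)).
Qed.

Lemma integral_CD f g : integrable_C f -> integrable_C g ->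
  integral_C mu (fun x => f x + g x) = integral_C mu f + integral_C mu g.
Proof.
move=> /integrable_CP[a b] /integrable_CP[c d]; apply: complexP; rewrite !ReImE /=.
  by under eq_Rintegral do rewrite ReD; exact: RintegralD.
by under eq_Rintegral do rewrite ImD; exact: RintegralD.
Qed.

Lemma integral_CZ (c : R[i]) f : integrable_C f ->
  integral_C mu (fun x => c * f x) = c * integral_C mu f.
Proof.
move=> /integrable_CP[a b].
have Z (r : R) h : mu.-integrable setT (EFin \o h) ->
    mu.-integrable setT (EFin \o (fun x => r * h x)).
  by move=> i; exact: (integrableZl measurableT r i).
apply: complexP; rewrite !ReImE /=.
  under eq_Rintegral do rewrite ReM.
  by rewrite RintegralB ?RintegralZl//; exact: Z.
under eq_Rintegral do rewrite ImM.
by rewrite RintegralD ?RintegralZl//; exact: Z.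
Qed.

Lemma integral_CN f : integrable_C f ->
  integral_C mu (fun x => - f x) = - integral_C mu f.
Proof.
by move=> i; under eq_fun do rewrite -mulN1r; rewrite integral_CZ// mulN1r.
Qed.

Lemma integral_CB f g : integrable_C f -> integrable_C g ->
  integral_C mu (fun x => f x - g x) = integral_C mu f - integral_C mu g.
Proof.
by move=> a b; rewrite integral_CD ?integral_CN//; exact: integrable_CN.
Qed.

Lemma integral_CJ f : integrable_C f ->
  integral_C mu (fun x => (f x)^*) = (integral_C mu f)^*.
Proof.
move=> /integrable_CP[a b]; apply: complexP; rewrite !ReImE /=.
  by under eq_Rintegral do rewrite ReJ.
under eq_Rintegral do rewrite ImJ -mulN1r.
by rewrite RintegralZl// mulN1r.
Qed.

Lemma integral_C0 : integral_C mu (fun=> 0) = 0.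
Proof. by rewrite /integral_C /= /Rintegral integral0. Qed.

Lemma integral_C_real (g : T -> R) :
  integral_C mu (fun x => (g x)%:C) = (\int[mu]_x g x)%:C.
Proof. by apply: complexP => //=; rewrite /Rintegral integral0. Qed.

Lemma ae_eq_integral_C f g : measurable_fun_C f -> measurable_fun_C g ->
  {ae mu, forall x, f x = g x} -> integral_C mu f = integral_C mu g.
Proof.
move=> [a b] [c d] fg; apply: complexP; rewrite /= /Rintegral; congr fine;
(apply: ae_eq_integral => //; [exact/measurable_EFinP|exact/measurable_EFinP|
by apply: filterS fg => x -> _]).
Qed.

Lemma ae_integrable_C f g : measurable_fun_C g -> integrable_C f ->
  {ae mu, forall x, f x = g x} -> integrable_C g.
Proof.
move=> mg [mf i] fg; split => //.
rewrite (_ : (\int[mu]_x _)%E = (\int[mu]_x (normc (f x))%:E)%E)//.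
apply: ae_eq_integral => //.
- exact: measurable_EFin_normc.
- exact: measurable_EFin_normc.
- by apply: filterS fg => x -> _.
Qed.

Lemma ae_dominated_C (u : (T -> R[i])^nat) f (g : T -> R) :
  (forall n, measurable_fun_C (u n)) -> measurable_fun_C f ->
  {ae mu, forall x, cvgC (fun n => u n x) (f x)} ->
  {ae mu, forall x n, normc (u n x) <= g x} ->
  mu.-integrable setT (EFin \o g) ->
  integrable_C f /\ cvgC (fun n => integral_C mu (u n)) (integral_C mu f).
Proof.
move=> mu_ mf uf ug ig.
(* Here [re] stands for either component; domination by the modulus is what both share. *)
have aux (re : R[i] -> R) : (forall z, `|re z| <= normc z) ->
    (forall n, measurable_fun setT (fun x => re (u n x))) ->
    measurable_fun setT (fun x => re (f x)) ->
    {ae mu, forall x, (fun n => re (u n x)) @ \oo --> re (f x)} ->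
    mu.-integrable setT (EFin \o (fun x => re (f x))) /\
    ((fun n => \int[mu]_x re (u n x)) @ \oo --> \int[mu]_x re (f x)).
  move=> le m1 m2 cv.
  have [n|||||i _ c] := @dominated_convergence _ _ _ mu setT measurableT
    (fun n => EFin \o (fun x => re (u n x))) (EFin \o (fun x => re (f x))) (EFin \o g).
  - by apply/measurable_EFinP; exact: m1.
  - exact/measurable_EFinP.
  - by apply: filterS cv => x c _; apply/fine_cvgP; split => //=; exact: nearW.
  - exact: ig.
  - apply: filterS ug => x h n _ /=; rewrite lee_fin (le_trans (le _))//.
  - split; first exact: i.
    apply: fine_cvg; rewrite /Rintegral fineK//; exact: integrable_fin_num.
have [||||i1 c1] := aux (@complex.Re R).
- exact: Re_normc.
- by move=> n; exact: (mu_ n).1.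
- exact: mf.1.
- by apply: filterS uf => x [].
have [||||i2 c2] := aux (@complex.Im R).
- exact: Im_normc.
- by move=> n; exact: (mu_ n).2.
- exact: mf.2.
- by apply: filterS uf => x [].
by split; [apply/integrable_CP|split].
Qed.

Lemma dominated_C (u : (T -> R[i])^nat) f (g : T -> R) :
  (forall n, measurable_fun_C (u n)) ->
  (forall x, cvgC (fun n => u n x) (f x)) ->
  (forall n x, normc (u n x) <= g x) ->
  mu.-integrable setT (EFin \o g) ->
  integrable_C f /\ cvgC (fun n => integral_C mu (u n)) (integral_C mu f).
Proof.
move=> m c le i; apply: (@ae_dominated_C u f g) => //.
- by apply: (@measurable_C_cvg _ _ _ u) => // x; [exact: (c x).1|exact: (c x).2].
- exact: aeW.
- by apply: aeW.
Qed.

End complex_integral.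

(** * Square-integrable functions, inner product and convergence *)

Section square_integrable.
Context {R : realType} disp (T : measurableType disp).
Variable mu : {measure set T -> \bar R}.
Implicit Types f g h : T -> R[i].

(** The squared norm lives in the extended reals and involves no root; [N2_addle] plays the part of
    the triangle inequality, at the price of a factor two. *)
Definition N2 f : \bar R := (\int[mu]_x (sqn (f x))%:E)%E.

Definition L2c f := measurable_fun_C f /\ (N2 f < +oo)%E.

Definition n2 f : R := fine (N2 f).

Lemma N2_ge0 f : (0 <= N2 f)%E.
Proof. by apply: integral_ge0 => x _; rewrite lee_fin sqn_ge0. Qed.

Lemma n2_ge0 f : 0 <= n2 f.
Proof. exact/fine_ge0/N2_ge0. Qed.

Lemma measurable_EFin_sqn f : measurable_fun_C f ->
  measurable_fun setT (fun x => (sqn (f x))%:E).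
Proof. by move=> mf; apply/measurable_EFinP; exact: measurable_sqn. Qed.

Lemma N2_fin f : L2c f -> N2 f = (n2 f)%:E.
Proof. by move=> [_ i]; rewrite /n2 fineK// ge0_fin_numE// N2_ge0. Qed.

Lemma L2c_integrable f : L2c f -> mu.-integrable setT (EFin \o (fun x => sqn (f x))).
Proof.
move=> [mf i]; apply/integrableP; split; first exact: measurable_EFin_sqn.
by under eq_integral do rewrite /= ger0_norm ?sqn_ge0//.
Qed.

Lemma le_N2 f g (k : R) : 0 <= k -> measurable_fun_C f -> measurable_fun_C g ->
  (forall x, sqn (f x) <= k * sqn (g x)) -> (N2 f <= k%:E * N2 g)%E.
Proof.
move=> k0 mf mg le; rewrite /N2 -ge0_integralZl//.
- apply: ge0_le_integral => //.
  + by move=> x _; rewrite lee_fin sqn_ge0.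
  + exact: measurable_EFin_sqn.
  + by apply: measurable_funeM; exact: measurable_EFin_sqn.
  + by move=> x _; rewrite -EFinM lee_fin.
- exact: measurable_EFin_sqn.
- by move=> x _; rewrite lee_fin sqn_ge0.
Qed.

Lemma N2_addle f g : measurable_fun_C f -> measurable_fun_C g ->
  (N2 (fun x => f x + g x)%R <= 2%:E * N2 f + 2%:E * N2 g)%E.
Proof.
move=> mf mg; rewrite /N2 -!ge0_integralZl//; try exact: measurable_EFin_sqn;
  try by move=> x _; rewrite lee_fin sqn_ge0.
rewrite -ge0_integralD//; last 4 first.
- by move=> x _; rewrite -EFinM lee_fin mulr_ge0// sqn_ge0.
- by apply: measurable_funeM; exact: measurable_EFin_sqn.
- by move=> x _; rewrite -EFinM lee_fin mulr_ge0// sqn_ge0.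
- by apply: measurable_funeM; exact: measurable_EFin_sqn.
apply: ge0_le_integral => //.
- by move=> x _; rewrite lee_fin sqn_ge0.
- by apply: measurable_EFin_sqn; exact: measurable_CD.
- by apply: emeasurable_funD; apply: measurable_funeM; exact: measurable_EFin_sqn.
- by move=> x _; rewrite -!EFinM -EFinD lee_fin sqnD_le.
Qed.

Lemma N2N f : N2 (fun x => - f x) = N2 f.
Proof. by rewrite /N2; under eq_integral do rewrite sqnN. Qed.

Lemma N2BC f g : N2 (fun x => f x - g x) = N2 (fun x => g x - f x).
Proof. by rewrite /N2; under eq_integral do rewrite sqnB. Qed.

Lemma ae_eq_N2 f g : measurable_fun_C f -> measurable_fun_C g ->
  {ae mu, forall x, f x = g x} -> N2 f = N2 g.
Proof.
move=> mf mg fg; apply: ae_eq_integral => //; try exact: measurable_EFin_sqn.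
by apply: filterS fg => x -> _.
Qed.

Lemma N2_eq0 f : measurable_fun_C f -> N2 f = 0%E -> {ae mu, forall x, f x = 0}.
Proof.
move=> mf f0; have : (\int[mu]_x `|(sqn (f x))%:E| = 0)%E.
  by rewrite -f0 /N2; under eq_integral do rewrite /= ger0_norm ?sqn_ge0//.
move=> /(ae_eq_integral_abs mu measurableT (measurable_EFin_sqn mf)).
by apply: filterS => x /(_ I) [] /sqn_eq0.
Qed.

Lemma N20 : N2 (fun=> 0) = 0%E.
Proof. by rewrite /N2; under eq_integral do rewrite sqn0; rewrite integral0. Qed.

Lemma L2c0 : L2c (fun=> 0).
Proof. by split; [exact: measurable_Ccst|rewrite N20]. Qed.

Lemma L2cD f g : L2c f -> L2c g -> L2c (fun x => f x + g x).
Proof.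
move=> [mf i] [mg j]; split; first exact: measurable_CD.
apply: le_lt_trans (N2_addle mf mg) _.
by apply: lte_add_pinfty; apply: lte_mul_pinfty.
Qed.

Lemma L2cN f : L2c f -> L2c (fun x => - f x).
Proof. by move=> [mf i]; split; [exact: measurable_CN|rewrite N2N]. Qed.

Lemma L2cB f g : L2c f -> L2c g -> L2c (fun x => f x - g x).
Proof. by move=> hf hg; apply: L2cD => //; exact: L2cN. Qed.

Lemma L2cMb f g (M : R) : L2c f -> measurable_fun_C g ->
  (forall x, sqn (g x) <= M) -> L2c (fun x => g x * f x).
Proof.
move=> [mf i] mg le; split; first exact: measurable_CM.
have M0 : 0 <= `|M| by [].
have := @le_N2 (fun x => g x * f x) f _ M0 (measurable_CM mg mf) mf.
move=> /(_ _) /le_lt_trans; apply.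
  by move=> x; rewrite sqnM ler_wpM2r ?sqn_ge0// (le_trans (le x))// ler_norm.
by rewrite lte_mul_pinfty.
Qed.

Lemma L2cZ (c : R[i]) f : L2c f -> L2c (fun x => c * f x).
Proof. by move=> i; apply: (@L2cMb _ (fun=> c) (sqn c)). Qed.

Lemma sqn_indic (A : set T) x : sqn (\1_A x)%:C <= 1 :> R.
Proof.
by rewrite sqnC indicE; case: (_ \in _); rewrite /= ?expr0n ?expr1n ?lexx ?ler01.
Qed.

Lemma L2c_indic f (A : set T) : measurable A -> L2c f ->
  L2c (fun x => (\1_A x)%:C * f x).
Proof.
move=> mA i; apply: (@L2cMb _ _ 1) => //; last exact: sqn_indic.
by apply: measurable_Creal; exact: measurable_indic.
Qed.

Lemma L2cJ f : L2c f -> L2c (fun x => (f x)^*).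
Proof.
move=> [mf i]; split; first exact: measurable_CJ.
by rewrite /N2; under eq_integral do rewrite sqnJ.
Qed.

Lemma ae_L2c f g : measurable_fun_C g -> L2c f ->
  {ae mu, forall x, f x = g x} -> L2c g.
Proof. by move=> mg [mf i] fg; split => //; rewrite -(ae_eq_N2 mf mg fg). Qed.

Lemma L2c_mulJ f g : L2c f -> L2c g -> integrable_C mu (fun x => (f x)^* * g x).
Proof.
move=> hf hg.
apply: (@integrable_C_le _ _ _ _ _ (fun x => sqn (f x) + sqn (g x))).
- by apply: measurable_CM; [apply: measurable_CJ; exact: hf.1|exact: hg.1].
- exact: (integrableD measurableT (L2c_integrable hf) (L2c_integrable hg)).
- by move=> x; rewrite -[sqn (f x)]sqnJ normc_mul_le.
Qed.

Definition ip f g : R[i] := integral_C mu (fun x => (f x)^* * g x).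

Lemma ipDr f g h : L2c f -> L2c g -> L2c h ->
  ip f (fun x => g x + h x) = ip f g + ip f h.
Proof.
move=> hf hg hh; rewrite /ip -integral_CD; try exact: L2c_mulJ.
by congr integral_C; apply/funext => x; rewrite mulrDr.
Qed.

Lemma ipNr f g : L2c f -> L2c g -> ip f (fun x => - g x) = - ip f g.
Proof.
move=> hf hg; rewrite /ip -integral_CN; last exact: L2c_mulJ.
by congr integral_C; apply/funext => x; rewrite mulrN.
Qed.

Lemma ipBr f g h : L2c f -> L2c g -> L2c h ->
  ip f (fun x => g x - h x) = ip f g - ip f h.
Proof. by move=> hf hg hh; rewrite ipDr ?ipNr//; exact: L2cN. Qed.

Lemma ipZr f g c : L2c f -> L2c g -> ip f (fun x => c * g x) = c * ip f g.
Proof.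
move=> hf hg; rewrite /ip -integral_CZ; last exact: L2c_mulJ.
by congr integral_C; apply/funext => x; rewrite mulrCA.
Qed.

Lemma ipC f g : L2c f -> L2c g -> ip g f = (ip f g)^*.
Proof.
move=> hf hg; rewrite /ip -integral_CJ; last exact: L2c_mulJ.
by congr integral_C; apply/funext => x; rewrite rmorphM/= conjcK mulrC.
Qed.

Lemma ipff f : ip f f = (n2 f)%:C.
Proof.
by rewrite /ip; under eq_fun do rewrite mulJ_sqn; rewrite integral_C_real.
Qed.

Lemma n2D f g : L2c f -> L2c g ->
  n2 (fun x => f x + g x) = n2 f + n2 g + 2 * Re (ip f g).
Proof.
move=> hf hg; apply: complexI; rewrite -ipff ipDr//; last exact: L2cD.
have hD := L2cD hf hg.
rewrite (ipC hf hD) (ipC hg hD) !ipDr// (ipC hf hg) !ipff.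
by apply: complexP; rewrite !ReImE /=; ring.
Qed.

Lemma n2B f g : L2c f -> L2c g ->
  n2 (fun x => f x - g x) = n2 f + n2 g - 2 * Re (ip f g).
Proof.
by move=> hf hg; rewrite n2D ?ipNr ?ReN ?mulrN//; [rewrite /n2 N2N|exact: L2cN].
Qed.

Lemma n2Z (c : R[i]) f : L2c f -> n2 (fun x => c * f x) = sqn c * n2 f.
Proof.
move=> hf; rewrite /n2 /N2; under eq_integral do rewrite sqnM.
rewrite -[LHS]/(Rintegral _ _ _) RintegralZl//; exact: L2c_integrable.
Qed.

(** The squared norm of [f + t g] is a nonnegative quadratic polynomial in the real number [t]. *)
Lemma Re_ip_CS f g : L2c f -> L2c g ->
  Re (ip f g) ^+ 2 <= n2 f * n2 g.
Proof.
move=> hf hg; set b := Re _.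
have H (t : R) : 0 <= n2 f + t ^+ 2 * n2 g + 2 * (t * b).
  rewrite -[t ^+ 2]sqnC -n2Z// (_ : t * b = Re (ip f (fun x => t%:C * g x))).
    by rewrite -n2D ?n2_ge0//; exact: L2cZ.
  by rewrite ipZr// ReM/= mul0r subr0.
have [g0|g0] := eqVneq (n2 g) 0.
  rewrite g0 mulr0; have [->|b0] := eqVneq b 0; first by rewrite expr0n.
  (* The polynomial is now affine with slope [2 * b], and at this point it takes the value -1. *)
  have := H (- (n2 f + 1) / (2 * b)); rewrite g0 mulr0 addr0.
  rewrite (_ : 2 * _ = - (n2 f + 1)); last by field.
  by lra.
have gp : 0 < n2 g by rewrite lt_def g0 n2_ge0.
(* This is the minimiser of the quadratic. *)
have := H (- b / n2 g) => h.
have : 0 <= (n2 f + (- b / n2 g) ^+ 2 * n2 g + 2 * (- b / n2 g * b)) * n2 g.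
  by rewrite mulr_ge0// ltW.
rewrite (_ : _ * n2 g = n2 f * n2 g - b ^+ 2) ?subr_ge0//.
by field.
Qed.

(** Multiplying [g] by -i turns the imaginary part of the inner product into the real part. *)
Lemma Im_ip_CS f g : L2c f -> L2c g ->
  Im (ip f g) ^+ 2 <= n2 f * n2 g.
Proof.
move=> hf hg; have := Re_ip_CS hf (L2cZ (0 -i* 1) hg).
by rewrite ipZr// n2Z// /sqn ReM /= expr0n sqrrN expr1n add0r !(mul0r,mul1r) mulN1r opprK add0r.
Qed.

(** Stated in the extended reals, so that it makes sense before the limit is known to be
    square-integrable; see [L2cvg_L2c]. *)
Definition L2cvg (u : (T -> R[i])^nat) f :=
  forall e : R, 0 < e -> \forall n \near \oo, (N2 (fun x => u n x - f x)%R <= e%:E)%E.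

Lemma ip_cvgr (u : (T -> R[i])^nat) f g : (forall n, L2c (u n)) -> L2c f -> L2c g ->
  L2cvg u f -> cvgC (fun n => ip g (u n)) (ip g f).
Proof.
move=> hu hf hg uf.
have hw n : L2c (fun x => u n x - f x) by exact: L2cB.
have aux (re : R[i] -> R) : (forall z w, re (z - w) = re z - re w) ->
   (forall h, L2c h -> re (ip g h) ^+ 2 <= n2 g * n2 h) ->
   (fun n => re (ip g (u n))) @ \oo --> re (ip g f).
  move=> reB CS; apply/cvgrPdist_le => e e0.
  (* The added one covers the case where [n2 g] vanishes. *)
  have d0 : 0 < e ^+ 2 / (n2 g + 1).
    by rewrite divr_gt0 ?exprn_gt0// ltr_wpDl// n2_ge0.
  apply: filterS (uf _ d0) => n; rewrite N2_fin// lee_fin => le.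
  rewrite -(ler_pXn2r (ltn0Sn 1)) ?nnegrE ?(ltW e0)//.
  rewrite distrC real_normK ?num_real// -reB -ipBr// (le_trans (CS _ (hw n)))//.
  apply: le_trans (_ : (n2 g + 1) * n2 (fun x => u n x - f x) <= _).
    by rewrite ler_wpM2r ?n2_ge0// lerDl.
  by rewrite mulrC -ler_pdivlMr// ltr_wpDl// n2_ge0.
split; apply: aux.
- by move=> z w; rewrite ReD ReN.
- by move=> h hh; exact: Re_ip_CS.
- by move=> z w; rewrite ImD ImN.
- by move=> h hh; exact: Im_ip_CS.
Qed.

(** Expanding the square of [u n - f] expresses [n2 (u n)] through a null sequence and inner
    products against the fixed function [f], which [ip_cvgr] handles. *)
Lemma n2_cvg (u : (T -> R[i])^nat) f : (forall n, L2c (u n)) -> L2c f ->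
  L2cvg u f -> (fun n => n2 (u n)) @ \oo --> n2 f.
Proof.
move=> hu hf uf.
have hw n : L2c (fun x => u n x - f x) by exact: L2cB.
have E n : n2 (u n) = n2 (fun x => u n x - f x) - n2 f + 2 * Re (ip f (u n)).
  by rewrite n2B// (ipC hf (hu n)) ReJ; ring.
under eq_fun do rewrite E.
have E' : n2 f = 0 - n2 f + 2 * n2 f by ring.
rewrite {1}E'.
apply: cvgD.
  apply: cvgB; last exact: cvg_cst.
  apply/cvgrPdist_le => e e0; apply: filterS (uf _ e0) => n.
  by rewrite N2_fin// lee_fin sub0r normrN ger0_norm// n2_ge0.
apply: cvgM; first exact: cvg_cst.
have [+ _] := ip_cvgr hu hf hf uf.
by rewrite ipff.
Qed.

Lemma L2cvgD (u v : (T -> R[i])^nat) f g :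
  (forall n, measurable_fun_C (u n)) -> (forall n, measurable_fun_C (v n)) ->
  measurable_fun_C f -> measurable_fun_C g ->
  L2cvg u f -> L2cvg v g ->
  L2cvg (fun n x => u n x + v n x) (fun x => f x + g x).
Proof.
move=> mu_ mv mf mg uf vg e e0.
have e4 : 0 < e / 4 by rewrite divr_gt0.
apply: filterS2 (uf _ e4) (vg _ e4) => n le1 le2.
rewrite (_ : (fun x => _) = (fun x => (u n x - f x) + (v n x - g x))); last first.
  by apply/funext => x; rewrite opprD addrACA.
apply: le_trans (N2_addle _ _) _; try exact: measurable_CB.
apply: le_trans (_ : (2%:E * (e / 4)%:E + 2%:E * (e / 4)%:E <= _)%E).
  by apply: leeD; apply: lee_wpmul2l.
by rewrite -!EFinM -EFinD lee_fin; lra.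
Qed.

Lemma L2cvgMb (u : (T -> R[i])^nat) f g (M : R) :
  (forall n, measurable_fun_C (u n)) -> measurable_fun_C f -> measurable_fun_C g ->
  (forall x, sqn (g x) <= M) -> L2cvg u f ->
  L2cvg (fun n x => g x * u n x) (fun x => g x * f x).
Proof.
move=> mu_ mf mg le uf e e0.
have M0 : 0 < `|M| + 1 by rewrite ltr_wpDl.
have eM : 0 < e / (`|M| + 1) by rewrite divr_gt0.
apply: filterS (uf _ eM) => n le1.
apply: le_trans (@le_N2 _ (fun x => u n x - f x) (`|M| + 1) _ _ _ _) _.
- exact: ltW.
- by apply: measurable_CB; exact: measurable_CM.
- exact: measurable_CB.
- move=> x; rewrite -mulrBr sqnM ler_wpM2r ?sqn_ge0// (le_trans (le x))//.
  by rewrite (le_trans (ler_norm _))// lerDl.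
- apply: le_trans (lee_wpmul2l _ le1) _; first by rewrite lee_fin ltW.
  by rewrite -EFinM mulrCA divff ?gt_eqF// mulr1.
Qed.

Lemma L2cvg_L2c (u : (T -> R[i])^nat) f : (forall n, L2c (u n)) ->
  measurable_fun_C f -> L2cvg u f -> L2c f.
Proof.
move=> hu mf uf; have [n _ /(_ _ (leqnn _)) le] := uf _ ltr01.
rewrite (_ : f = (fun x => u n x - (u n x - f x))); last first.
  by apply/funext => x; rewrite subKr.
apply: L2cB => //; split; first by apply: measurable_CB => //; exact: (hu n).1.
exact: le_lt_trans le (ltry _).
Qed.

End square_integrable.

(** * Comparison of [N2] with the norms used in the statement *)

Section L2_norm_bridge.
Context {R : realType} disp (T : measurableType disp).
Variable mu : {measure set T -> \bar R}.
Implicit Types f g h : T -> R[i].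

Let N f := Lnorm mu 2%:E (fun x => (normc (f x))%:E).

Lemma Lnorm_sqrN2 f : (N f `^ 2 = N2 mu f)%E.
Proof.
rewrite /N powR_Lnorm ?pnatr_eq0//; apply: eq_integral => x _ /=.
by rewrite ger0_norm ?normc_ge0// powR_mulrn ?normc_ge0// sqr_normc.
Qed.

Lemma Lnorm_sqrtN2 f : (N f = N2 mu f `^ 2^-1)%E.
Proof.
rewrite /N unlock; congr (_ `^ _)%E; apply: eq_integral => x _ /=.
by rewrite ger0_norm ?normc_ge0// powR_mulrn ?normc_ge0// sqr_normc.
Qed.

Lemma L_C2P f : L_C mu 2%:E f <-> L2c mu f.
Proof.
split=> -[mf i]; split => //.
  by rewrite -Lnorm_sqrN2; apply: poweR_lty.
by rewrite /finite_norm -/(N f) Lnorm_sqrtN2; apply: poweR_lty.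
Qed.

Lemma L_C1P f : L_C mu 1%:E f <-> integrable_C mu f.
Proof.
rewrite /L_C /integrable_C /finite_norm Lnorm1.
rewrite (_ : (\int[mu]_x `|_|)%E = (\int[mu]_x (normc (f x))%:E)%E)//.
by apply: eq_integral => x _ /=; rewrite ger0_norm ?normc_ge0.
Qed.

Let le_poweR (x : \bar R) (e r : R) : 0 <= r -> 0 <= e -> (0 <= x)%E -> (x <= e%:E)%E ->
  (x `^ r <= (e `^ r)%:E)%E.
Proof.
move=> r0 e0 x0 xe; rewrite -poweR_EFin; apply: gt0_ler_poweR => //.
  by rewrite in_itv /= x0 leey.
by rewrite in_itv /= lee_fin e0 leey.
Qed.

Lemma cvg_L2_CP (u : (T -> R[i])^nat) f : cvg_L2_C mu u f <-> L2cvg mu u f.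
Proof.
pose w n x := u n x - f x.
have wE n : Lnorm mu 2%:E (fun x => (normc (u n x - f x))%:E) = N (w n) by [].
have N0 h : (0 <= N h)%E by exact: Lnorm_ge0.
split.
  rewrite /cvg_L2_C (_ : (fun n => _) = (fun n => N (w n)))// => /fine_cvgP[fin cv] e e0.
  have se0 : 0 < Num.sqrt e by rewrite sqrtr_gt0.
  have h : \forall n \near \oo, `|fine (N (w n))| <= Num.sqrt e.
    exact: (cvgr0_norm_le _ cv).
  apply: filterS2 fin h => n fn le.
  rewrite -/(w n) -Lnorm_sqrN2.
  have -> : e = Num.sqrt e `^ 2 by rewrite powR_mulrn ?sqrtr_ge0// sqr_sqrtr// ltW.
  apply: le_poweR => //.
  by rewrite -(fineK fn) lee_fin (le_trans (ler_norm _)).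
move=> uf.
have H e : 0 < e -> \forall n \near \oo, (N (w n) <= e%:E)%E.
  move=> e0; have e20 : 0 < e ^+ 2 by rewrite exprn_gt0.
  apply: filterS (uf _ e20) => n le; rewrite Lnorm_sqrtN2.
  have {1}-> : e = (e ^+ 2) `^ 2^-1.
    by rewrite -powR_mulrn ?ltW// -powRrM divff// powRr1// ltW.
  by apply: le_poweR => //; [exact: ltW|exact: N2_ge0].
rewrite /cvg_L2_C (_ : (fun n => _) = (fun n => N (w n)))//.
apply/fine_cvgP; split.
  apply: filterS (H _ ltr01) => n le; rewrite ge0_fin_numE//.
  exact: le_lt_trans le (ltry _).
apply/cvgrPdist_le => e e0; apply: filterS (H _ e0) => n le.
rewrite sub0r normrN ger0_norm ?fine_ge0//= -lee_fin fineK// ge0_fin_numE//.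
exact: le_lt_trans le (ltry _).
Qed.

End L2_norm_bridge.

(** * Completeness of L^2 *)

Section riesz_fischer.
Context {R : realType} disp (T : measurableType disp).
Variable mu : {measure set T -> \bar R}.
Implicit Types f g h : T -> R[i].

(** Lower semicontinuity of the norm under convergence almost everywhere. Applied to differences, it
    upgrades a Cauchy estimate with a pointwise limit to convergence in L^2. *)
Lemma N2_fatou (w : (T -> R[i])^nat) h (M : \bar R) :
  (forall n, measurable_fun_C (w n)) -> measurable_fun_C h ->
  {ae mu, forall x, cvgC (fun n => w n x) (h x)} ->
  (\forall n \near \oo, N2 mu (w n) <= M)%E -> (N2 mu h <= M)%E.
Proof.
move=> mw mh wh le.
have mlim : measurable_fun setT (fun x => limn_einf (fun n => (sqn (w n x))%:E)).
  rewrite /limn_einf; apply: measurableT_comp => //.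
  apply: measurable_fun_limn_esup => n; apply: measurableT_comp => //.
  exact: measurable_EFin_sqn.
rewrite (_ : N2 mu h = \int[mu]_x limn_einf (fun n => (sqn (w n x))%:E))%E; last first.
  apply: ae_eq_integral => //; first exact: measurable_EFin_sqn.
  apply: filterS wh => x /cvgC_sqn c _; apply/esym; apply: (cvg_limn_einf_sup _).1.
  by apply/fine_cvgP; split => //=; exact: nearW.
apply: (le_trans (fatou mu measurableT _ _)).
- by move=> n; exact: measurable_EFin_sqn.
- by move=> n x _; rewrite lee_fin sqn_ge0.
rewrite limn_einf_lim; apply: lime_le; first exact: is_cvg_einfs.
apply: filterS le => n; apply: le_trans.
by apply: ereal_inf_lbound; exists n => //=.
Qed.

Lemma cvg_summable_increments (v : R^nat) (S : R) :
  (forall n, \sum_(0 <= k < n) `|v k.+1 - v k| <= S) -> cvgn v.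
Proof.
move=> bnd.
have : cvgn (series (telescope v)).
  apply: normed_cvg; apply: nondecreasing_is_cvgn.
    by apply: nondecreasing_series => n _ /=.
  by exists S => _ [n _ <-]; exact: bnd.
rewrite telescopeK => c.
rewrite (_ : v = (fun n => (v n - v 0%N) + v 0%N)); last first.
  by apply/funext => n; rewrite subrK.
by apply: is_cvgD => //; exact: is_cvg_cst.
Qed.

Lemma sum_half_le n : \sum_(0 <= k < n) 2^-1 ^+ k <= 2 :> R.
Proof.
have -> : \sum_(0 <= k < n) 2^-1 ^+ k = 2 - 2 * 2^-1 ^+ n :> R.
  elim: n => [|n IH]; first by rewrite big_nil expr0; ring.
  by rewrite big_nat_recr//= IH exprS; field.
by rewrite gerBl mulr_ge0// exprn_ge0.
Qed.

(* The weights [2 ^+ k] turn square summability of the increments into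
   summability: [a <= 2 ^- k + 2 ^+ k * a ^+ 2]. *)
Lemma fast_cauchy_cvg (v : (T -> R[i])^nat) :
  (forall n, measurable_fun_C (v n)) ->
  (forall k, (N2 mu (fun x => v k.+1 x - v k x)%R <= (4^-1 ^+ k)%:E)%E) ->
  exists2 f, measurable_fun_C f & {ae mu, forall x, cvgC (fun n => v n x) (f x)}.
Proof.
move=> mv le.
pose F k x : \bar R := ((2 ^+ k)%:E * (sqn (v k.+1 x - v k x))%:E)%E.
have mF k : measurable_fun setT (F k).
  apply: measurable_funeM; apply: measurable_EFin_sqn; exact: measurable_CB.
have F0 k x : (0 <= F k x)%E by rewrite /F -EFinM lee_fin mulr_ge0 ?sqn_ge0// exprn_ge0.
pose S x := (\sum_(0 <= k <oo) F k x)%E.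
have S0 x : (0 <= S x)%E by exact: nneseries_ge0.
have mS : measurable_fun setT S.
  rewrite /S (_ : (fun x => _) = (fun x => \sum_(0 <= k <oo | k \in xpredT) F k x)%E)//.
  exact: ge0_emeasurable_sum.
have IS : (\int[mu]_x S x <= 2%:E)%E.
  rewrite integral_nneseries//; apply: lime_le.
    by apply: is_cvg_nneseries => n _ _; exact: integral_ge0.
  apply: nearW => n.
  apply: (@le_trans _ _ (\sum_(0 <= k < n) (2^-1 ^+ k)%:E)%E).
    apply: lee_sum => k _; rewrite ge0_integralZl_EFin//; last 2 first.
    - by move=> x _; rewrite lee_fin sqn_ge0.
    - by apply: measurable_EFin_sqn; exact: measurable_CB.
    apply: (le_trans (lee_wpmul2l _ (le k))); first by rewrite lee_fin exprn_ge0.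
    by rewrite -EFinM lee_fin -exprMn; rewrite (_ : 2 * 4^-1 = 2^-1)//; field.
  by rewrite sumEFin lee_fin sum_half_le.
pose A := [set x | S x \is a fin_num].
have mA : measurable A.
  by rewrite /A -[X in measurable X]setTI; exact: emeasurable_fin_num.
have aeA : {ae mu, forall x, A x}.
  have iS : mu.-integrable setT S.
    apply/integrableP; split => //; under eq_integral do rewrite gee0_abs//.
    exact: le_lt_trans IS (ltry _).
  by apply: filterS (integrable_ae measurableT iS) => x /(_ I).
have cv x : A x -> exists l, cvgC (fun n => v n x) l.
  move=> Ax; have [s Ss] : exists s, S x = s%:E by exists (fine (S x)); rewrite fineK// ge0_fin_numE.
  have aux (re : R[i] -> R) : (forall z w, re (z - w) = re z - re w) ->
      (forall z, re z ^+ 2 <= sqn z) -> cvgn (fun n => re (v n x)).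
    move=> reB rele; apply: (@cvg_summable_increments _ (2 + s)) => n.
    have : (\sum_(0 <= k < n) F k x <= s%:E)%E by rewrite -Ss; exact: nneseries_lim_ge.
    rewrite sumEFin lee_fin => les.
    apply: (@le_trans _ _ (\sum_(0 <= k < n) (2^-1 ^+ k + 2 ^+ k * sqn (v k.+1 x - v k x)))).
      apply: ler_sum => k _; rewrite -reB; set z := _ - _.
      have k0 : (0 : R) < 2 ^+ k by rewrite exprn_gt0.
      have := rele z; rewrite -[_ ^+ 2]real_normK ?num_real//.
      move: (`|re z|) (normr_ge0 (re z)) => a a0 az.
      rewrite exprVn; apply: le_trans (_ : (2 ^+ k)^-1 + 2 ^+ k * a ^+ 2 <= _); last first.
        by rewrite lerD2l ler_wpM2l// ltW.
      rewrite -subr_ge0.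
      have -> : (2 ^+ k)^-1 + 2 ^+ k * a ^+ 2 - a =
        (2 ^+ k)^-1 * ((2 ^+ k * a - 2^-1) ^+ 2 + 3 / 4) by field; rewrite gt_eqF.
      by rewrite mulr_ge0 ?invr_ge0 ?(ltW k0)// addr_ge0 ?sqr_ge0// divr_ge0.
    by rewrite big_split /= lerD// sum_half_le.
  have c1 := aux (@complex.Re R); have c2 := aux (@complex.Im R).
  exists (limn (fun n => Re (v n x)) +i* limn (fun n => Im (v n x))).
  split; [apply: c1|apply: c2].
  - by move=> z w; rewrite ReD ReN.
  - by move=> z; rewrite /sqn lerDl sqr_ge0.
  - by move=> z w; rewrite ImD ImN.
  - by move=> z; rewrite /sqn lerDr sqr_ge0.
pose f x := if pselect (A x) is left h then projT1 (cid (cv x h)) else 0.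
have fA x : A x -> cvgC (fun n => v n x) (f x).
  by rewrite /f; case: pselect => // h _; exact: (projT2 (cid (cv x h))).
exists f; last by apply: filterS aeA => x; exact: fA.
(* Cutting off on [A] makes the convergence hold at every point, [f] being 0 outside [A]; so [f] is
   measurable as a pointwise limit. *)
pose g n x : R[i] := (\1_A x)%:C * v n x.
have gf x : cvgC (fun n => g n x) (f x).
  rewrite /g indicE; have [xA|xA] := pselect (A x).
    rewrite mem_set//; under eq_fun do rewrite mul1r; exact: fA.
  rewrite memNset//; under eq_fun do rewrite mul0r.
  by rewrite /f; case: pselect => // _; exact: cvgC_cst.
apply: (@measurable_C_cvg _ _ _ g).
- by move=> n; exact: measurable_C_indic.
- by move=> x; exact: (gf x).1.
- by move=> x; exact: (gf x).2.
Qed.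

Lemma riesz_fischer (u : (T -> R[i])^nat) : (forall n, L2c mu (u n)) ->
  (forall e : R, 0 < e -> exists N, forall n m, (N <= n)%N -> (N <= m)%N ->
     (N2 mu (fun x => u n x - u m x)%R <= e%:E)%E) ->
  exists2 f, L2c mu f & L2cvg mu u f.
Proof.
move=> hu cau.
have q0 k : 0 < 4^-1 ^+ k :> R by rewrite exprn_gt0.
pose phi k := projT1 (cid (cau _ (q0 k))).
have phiP k n m : (phi k <= n)%N -> (phi k <= m)%N ->
    (N2 mu (fun x => u n x - u m x)%R <= (4^-1 ^+ k)%:E)%E.
  by rewrite /phi; case: cid => /= N H; exact: H.
(* Partial sums of [phi] are nondecreasing in [k] and still dominate [phi], so consecutive terms of
   [v] differ by at most [4^-1 ^+ k]. *)
pose psi k := (\sum_(j < k.+1) phi j)%N.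
have psiS k : (psi k <= psi k.+1)%N by rewrite /psi [leqRHS]big_ord_recr leq_addr.
have phipsi k : (phi k <= psi k)%N by rewrite /psi big_ord_recr leq_addl.
have psi_mono : {homo psi : n m / (n <= m)%N} by apply: homo_leq => //; exact: leq_trans.
pose v k := u (psi k).
have mu_ n : measurable_fun_C (u n) by exact: (hu n).1.
have [|k|f mf vf] := @fast_cauchy_cvg v.
- by move=> n; exact: mu_.
- by apply: phiP => //; exact: leq_trans (psiS _).
(* Fatou's lemma is applied to [u n - v j] with [n] fixed and [j] growing, so the whole sequence
   converges and not only [v]. *)
have uf : L2cvg mu u f.
  move=> e e0.
  have [k ke] : exists k, 4^-1 ^+ k <= e :> R.
    have : geometric 1 (4^-1 : R) @ \oo --> 0.
      by apply: cvg_geometric; rewrite ger0_norm// invf_lt1// ltr1n.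
    move=> c; have : \forall n \near \oo, `|geometric 1 (4^-1 : R) n| <= e.
      exact: (cvgr0_norm_le _ c).
    by move=> [k _ /(_ _ (leqnn k))]; rewrite /geometric /= mul1r => h; exists k; rewrite (le_trans (ler_norm _)).
  exists (phi k) => // n /= kn.
  apply: (@N2_fatou (fun j x => u n x - v j x)).
  - by move=> j; apply: measurable_CB; exact: mu_.
  - exact: measurable_CB.
  - apply: filterS vf => x c; apply: cvgCD; first exact: cvgC_cst.
    exact: cvgCN.
  - exists k => // j /= kj; apply: le_trans (_ : ((4^-1 ^+ k)%:E <= _)%E); last by rewrite lee_fin.
    by apply: phiP => //; apply: (leq_trans (phipsi k)); exact: psi_mono.
by exists f => //; exact: L2cvg_L2c uf.
Qed.

End riesz_fischer.

(** * Linear changes of variables *)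

Section measurable_linear.
Context {R : realType}.

Lemma measurable_mulmx d m (A : 'M[R]_(m, d)) :
  measurable_fun setT (fun x : 'cV[R]_d => A *m x).
Proof.
apply: measurable_fun_cV => i; under eq_fun do rewrite mxE.
apply: measurable_sum => j; apply: measurable_funM; first exact: measurable_cst.
exact: measurable_coord.
Qed.

Lemma measurable_cV_addr d (b : 'cV[R]_d) :
  measurable_fun setT (fun x : 'cV[R]_d => x + b).
Proof.
apply: measurable_fun_cV => i; under eq_fun do rewrite mxE.
by apply: measurable_funD => //; exact: measurable_coord.
Qed.

Lemma measurable_dotmul disp (T : measurableType disp) d (f g : T -> 'cV[R]_d) :
  measurable_fun setT f -> measurable_fun setT g ->
  measurable_fun setT (fun t => dotmul (f t) (g t)).
Proof.
move=> mf mg; apply: measurable_sum => i.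
by apply: measurable_funM;
  [apply: (measurableT_comp (measurable_coord i) mf)
  |apply: (measurableT_comp (measurable_coord i) mg)].
Qed.

End measurable_linear.


Section change_of_variables.
Context {R : realType}.
Local Open Scope ereal_scope.

Lemma ge0_integral_measure_scale disp (T : measurableType disp) disp'
    (T' : measurableType disp') (mu : {measure set T -> \bar R})
    (nu : {measure set T' -> \bar R}) (phi : T -> T') (c : R) (F : T' -> \bar R) :
  measurable_fun setT phi -> (0 <= c)%R ->
  (forall A, measurable A -> c%:E * mu (phi @^-1` A) = nu A) ->
  measurable_fun setT F -> (forall x, 0 <= F x) ->
  \int[nu]_x F x = c%:E * \int[mu]_x F (phi x).
Proof.
move=> mphi c0 H mF F0.
pose m := measure_function_pushforward__canonical__measure_function_Measure mu mphi.
rewrite (eq_measure_integral (mscale (NngNum c0) m)); last first.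
  by move=> A mA _; rewrite -H.
by rewrite ge0_integral_mscale// ge0_integral_pushforward//.
Qed.

Lemma ge0_integral_affine1 (a b : R) (F : R -> \bar R) : a != 0%R ->
  measurable_fun setT (F : measurableTypeR R -> _) -> (forall x, 0 <= F x) ->
  \int[lebesgue_measure]_x F (a * x + b)%R = (`|a|^-1)%:E * \int[lebesgue_measure]_x F x.
Proof.
move=> a0 mF F0.
have mphi : measurable_fun [set: measurableTypeR R]
    ((fun x => a * x + b)%R : measurableTypeR R -> measurableTypeR R).
  by apply: measurable_funD => //; exact: measurable_funM.
rewrite (@ge0_integral_measure_scale _ (measurableTypeR R) _ (measurableTypeR R)
  lebesgue_measure lebesgue_measure _ `|a| F mphi)//.
  by rewrite muleA -EFinM mulVf ?normr_eq0// mul1e.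
have a1 : (0 <= `|a|)%R by [].
pose m := mscale (NngNum a1)
  (measure_function_pushforward__canonical__measure_function_Measure lebesgue_measure mphi).
(* Lebesgue measure is determined by its values on half-open intervals. *)
move=> A mA; apply/esym; apply: (@lebesgue_measure_unique _ m) => // _ [[x y] _ <-] /=.
rewrite /m /mscale/= /pushforward/= lebesgue_measure_itv/= lte_fin.
have [apos|aneg] := ltP 0%R a.
  rewrite (_ : _ @^-1` _ = `]((x - b) / a)%R, ((y - b) / a)%R]%classic); last first.
    apply/seteqP; split=> t /=; rewrite !in_itv /= ltr_pdivrMr// ler_pdivlMr//
      ltrBlDr lerBrDr mulrC//.
  rewrite lebesgue_measure_itv/= lte_fin ltr_pM2r ?invr_gt0// ltrD2r.
  case: ifP => _; last by rewrite mule0.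
  by rewrite -!EFinB -EFinM (gtr0_norm apos); congr EFin; field.
(* A negative slope exchanges the endpoints, so the preimage of []x, y]] is closed on the left and
   open on the right. *)
have {}aneg : (a < 0)%R by rewrite lt_neqAle a0.
rewrite (_ : _ @^-1` _ = `[((y - b) / a)%R, ((x - b) / a)%R[%classic); last first.
  apply/seteqP; split=> t /=; rewrite !in_itv /= ltr_ndivlMr// ler_ndivrMr//
    ltrBlDr lerBrDr mulrC andbC//.
rewrite lebesgue_measure_itv/= lte_fin ltr_nM2r ?invr_lt0// ltrD2r.
case: ifP => _; last by rewrite mule0.
by rewrite -!EFinB -EFinM (ltr0_norm aneg); congr EFin; field.
Qed.

(** Both orders of integration are recorded: a lower triangular map is treated by integrating over
    the tail first, an upper triangular one by integrating over the head first. *)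
Lemma ge0_integral_cV_cons d (F : 'cV[R]_d.+1 -> \bar R) :
  measurable_fun setT F -> (forall x, 0 <= F x) ->
  \int[leb d.+1]_x F x =
  \int[lebesgue_measure]_x \int[leb d]_v F (cV_cons (x, v)) /\
  \int[leb d.+1]_x F x =
  \int[leb d]_v \int[lebesgue_measure]_x F (cV_cons (x, v)).
Proof.
move=> mF F0.
have -> : \int[leb d.+1]_x F x =
    \int[(@lebesgue_measure R) \x leb d]_p F (cV_cons p).
  by rewrite /= /lebesgue_step ge0_integral_pushforward//; exact: measurable_cV_cons.
have mFc : measurable_fun setT (fun p => F (@cV_cons R d p)).
  by apply: (measurableT_comp mF); exact: measurable_cV_cons.
by split; [rewrite fubini_tonelli1|rewrite fubini_tonelli2].
Qed.

Lemma measurable_cV_slice1 d (F : 'cV[R]_d.+1 -> \bar R) x :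
  measurable_fun setT F -> measurable_fun setT (fun v => F (cV_cons (x, v))).
Proof.
move=> mF; apply: (measurableT_comp mF).
by apply: (measurableT_comp (@measurable_cV_cons _ _)); exact: pair1_measurable.
Qed.

Lemma measurable_cV_slice2 d (F : 'cV[R]_d.+1 -> \bar R) v :
  measurable_fun setT F ->
  measurable_fun setT (fun x : measurableTypeR R => F (cV_cons (x, v))).
Proof.
move=> mF; apply: (measurableT_comp mF).
by apply: (measurableT_comp (@measurable_cV_cons _ _)); exact: pair2_measurable.
Qed.

Lemma measurable_cV_int1 d (F : 'cV[R]_d.+1 -> \bar R) :
  measurable_fun setT F -> (forall x, 0 <= F x) ->
  measurable_fun setT (fun x : measurableTypeR R => \int[leb d]_v F (cV_cons (x, v))).
Proof.
move=> mF F0.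
apply: (@measurable_fun_fubini_tonelli_F _ _ _ _ _ (leb d) (fun p => F (@cV_cons R d p))) => //.
by apply: (measurableT_comp mF); exact: measurable_cV_cons.
Qed.

Lemma measurable_cV_int2 d (F : 'cV[R]_d.+1 -> \bar R) :
  measurable_fun setT F -> (forall x, 0 <= F x) ->
  measurable_fun setT (fun v => \int[lebesgue_measure]_x F (cV_cons (x, v))).
Proof.
move=> mF F0.
apply: (@measurable_fun_fubini_tonelli_G _ _ _ _ _ lebesgue_measure (fun p => F (@cV_cons R d p))) => //.
by apply: (measurableT_comp mF); exact: measurable_cV_cons.
Qed.

Lemma ge0_integral_shift d (b : 'cV[R]_d) (F : 'cV[R]_d -> \bar R) :
  measurable_fun setT F -> (forall x, 0 <= F x) ->
  \int[leb d]_x F (x + b)%R = \int[leb d]_x F x.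
Proof.
elim: d b F => [|d IH] b F mF F0.
  by apply: eq_integral => x _; congr F; rewrite !flatmx0.
have mFb : measurable_fun setT (fun x : 'cV[R]_d.+1 => F (x + b)%R).
  by apply: (measurableT_comp mF); exact: measurable_cV_addr.
have [-> _] := ge0_integral_cV_cons mFb (fun x => F0 _).
have [-> _] := ge0_integral_cV_cons mF F0.
pose b' : 'cV[R]_d := (\col_i b (lift ord0 i) ord0)%R.
have E (x : measurableTypeR R) v : (cV_cons (x, v) + b = cV_cons (1 * x + b ord0 ord0, v + b'))%R.
  apply/colP => i; rewrite !mxE; case: unliftP => [j ->|->] /=.
    by rewrite !mxE.
  by rewrite mul1r.
under eq_integral => x _ do under eq_integral => v _ do rewrite E.
transitivity (\int[lebesgue_measure]_x \int[leb d]_v F (cV_cons (1 * x + b ord0 ord0, v)%R)).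
  apply: eq_integral => x _.
  rewrite (IH b' (fun v => F (cV_cons (1 * x + b ord0 ord0, v)%R)))//.
  exact: measurable_cV_slice1.
rewrite (@ge0_integral_affine1 1 (b ord0 ord0) (fun x => \int[leb d]_v F (cV_cons (x, v))))//.
- by rewrite normr1 invr1 mul1e.
- exact: measurable_cV_int1.
- by move=> x; exact: integral_ge0.
Qed.

Definition scales_lebesgue d (A : 'M[R]_d) :=
  forall F : 'cV[R]_d -> \bar R, measurable_fun setT F -> (forall x, 0 <= F x) ->
  \int[leb d]_x F (A *m x)%R = (`|(\det A)%R|^-1)%:E * \int[leb d]_x F x.

Lemma cV_consE0 d (x : R) (v : 'cV[R]_d) : cV_cons (x, v) ord0 0%R = x.
Proof. by rewrite mxE unlift_none. Qed.

Lemma cV_consEl d (x : R) (v : 'cV[R]_d) i : cV_cons (x, v) (lift ord0 i) 0%R = v i 0%R.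
Proof. by rewrite mxE liftK. Qed.

(** For a fixed head [x] the tail undergoes [B] followed by a translation by [x *: c], which does
    not change the inner integral; the head is then merely scaled by [a]. *)
Lemma scales_lower d (A : 'M[R]_d) : is_trig_mx A -> \det A != 0%R -> scales_lebesgue A.
Proof.
elim: d A => [|d IH] A tA dA F mF F0.
  rewrite det_mx00 normr1 invr1 mul1e.
  by apply: eq_integral => x _; congr F; rewrite !flatmx0.
pose a := A ord0 ord0.
pose c : 'cV[R]_d := (\col_i A (lift ord0 i) ord0)%R.
pose B : 'M[R]_d := (\matrix_(i, j) A (lift ord0 i) (lift ord0 j))%R.
have tB : is_trig_mx B.
  by apply/is_trig_mxP => i j ij; rewrite mxE; apply: (is_trig_mxP tA).
have dAB : (\det A = a * \det B)%R.
  by rewrite (det_trig tA) (det_trig tB) big_ord_recl; congr (_ * _)%R; apply: eq_bigr => i _; rewrite mxE.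
have /andP[a0 dB] : (a != 0%R) && (\det B != 0%R) by rewrite -negb_or -mulf_eq0 -dAB.
have mFA : measurable_fun setT (fun x : 'cV[R]_d.+1 => F (A *m x)%R).
  by apply: (measurableT_comp mF); exact: measurable_mulmx.
have [-> _] := ge0_integral_cV_cons mFA (fun x => F0 _).
have [-> _] := ge0_integral_cV_cons mF F0.
have E (x : measurableTypeR R) v :
    (A *m cV_cons (x, v) = cV_cons ((a * x + 0)%R : measurableTypeR R, B *m v + x *: c))%R.
  apply/colP => i; rewrite mxE big_ord_recl cV_consE0.
  under eq_bigr do rewrite cV_consEl.
  case: (unliftP ord0 i) => [j ->|->].
    rewrite cV_consEl !mxE addrC mulrC; congr (_ + _)%R.
    by apply: eq_bigr => k _; rewrite mxE.
  rewrite cV_consE0; congr (_ + _)%R; rewrite big1// => k _.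
  by rewrite (is_trig_mxP tA) ?mul0r.
under eq_integral => x _ do under eq_integral => v _ do rewrite E.
transitivity (\int[lebesgue_measure]_x ((`|\det B|^-1)%:E *
    \int[leb d]_v F (cV_cons ((a * x + 0)%R : measurableTypeR R, v)))).
  apply: eq_integral => x _.
  rewrite (IH B tB dB (fun v => F (cV_cons ((a * x + 0)%R : measurableTypeR R, v + x *: c)%R)))//.
    congr (_ * _).
    rewrite (ge0_integral_shift _ (F := fun v => F (cV_cons ((a * x + 0)%R : measurableTypeR R, v))))//.
    exact: measurable_cV_slice1.
  apply: (measurableT_comp (measurable_cV_slice1 _ mF)).
  exact: measurable_cV_addr.
have mI := measurable_cV_int1 mF F0.
have I0 (x : measurableTypeR R) : 0 <= \int[leb d]_v F (cV_cons (x, v)) by exact: integral_ge0.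
rewrite ge0_integralZl//; last first.
  apply: (measurableT_comp mI).
  by apply: measurable_funD => //; exact: measurable_funM.
rewrite (@ge0_integral_affine1 a 0 (fun x => \int[leb d]_v F (cV_cons (x, v))))//.
by rewrite muleA -EFinM dAB normrM invfM mulrC.
Qed.

(** For a fixed tail [v] the head undergoes the affine map of slope [a] and offset [u v]; the tail
    is then transformed by [B] alone. *)
Lemma scales_upper d (A : 'M[R]_d) : is_trig_mx A^T -> \det A != 0%R -> scales_lebesgue A.
Proof.
elim: d A => [|d IH] A tA dA F mF F0.
  rewrite det_mx00 normr1 invr1 mul1e.
  by apply: eq_integral => x _; congr F; rewrite !flatmx0.
pose a := A ord0 ord0.
pose B : 'M[R]_d := (\matrix_(i, j) A (lift ord0 i) (lift ord0 j))%R.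
have tA' (i j : 'I_d.+1) : (j < i)%N -> A i j = 0%R.
  by move=> ij; have := is_trig_mxP tA j i ij; rewrite mxE.
have tB : is_trig_mx B^T.
  by apply/is_trig_mxP => i j ij; rewrite !mxE; apply: tA'.
have dAB : (\det A = a * \det B)%R.
  rewrite -det_tr -[in RHS]det_tr (det_trig tA) (det_trig tB) big_ord_recl mxE.
  by congr (_ * _)%R; apply: eq_bigr => i _; rewrite !mxE.
have /andP[a0 dB] : (a != 0%R) && (\det B != 0%R) by rewrite -negb_or -mulf_eq0 -dAB.
have mFA : measurable_fun setT (fun x : 'cV[R]_d.+1 => F (A *m x)%R).
  by apply: (measurableT_comp mF); exact: measurable_mulmx.
have [_ ->] := ge0_integral_cV_cons mFA (fun x => F0 _).
have [_ ->] := ge0_integral_cV_cons mF F0.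
pose u (v : 'cV[R]_d) : R := (\sum_j A ord0 (lift ord0 j) * v j 0)%R.
have E (x : measurableTypeR R) v :
    (A *m cV_cons (x, v) = cV_cons ((a * x + u v)%R : measurableTypeR R, B *m v))%R.
  apply/colP => i; rewrite mxE big_ord_recl cV_consE0.
  under eq_bigr do rewrite cV_consEl.
  case: (unliftP ord0 i) => [j ->|->].
    rewrite cV_consEl !mxE tA'// mul0r add0r.
    by apply: eq_bigr => k _; rewrite mxE.
  by rewrite cV_consE0.
under eq_integral => v _ do under eq_integral => x _ do rewrite E.
transitivity (\int[leb d]_v ((`|a|^-1)%:E *
    \int[lebesgue_measure]_x F (cV_cons (x : measurableTypeR R, B *m v)%R))).
  apply: eq_integral => v _.
  rewrite (@ge0_integral_affine1 a (u v) (fun x => F (cV_cons (x, B *m v)%R)))//.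
  exact: measurable_cV_slice2.
have mI := measurable_cV_int2 mF F0.
have I0 v : 0 <= \int[lebesgue_measure]_x F (cV_cons (x, v)) by exact: integral_ge0.
rewrite ge0_integralZl//; last first.
  by apply: (measurableT_comp mI); exact: measurable_mulmx.
rewrite (IH B tB dB (fun v => \int[lebesgue_measure]_x F (cV_cons (x, v))))//.
by rewrite muleA -EFinM dAB normrM invfM.
Qed.

Lemma scalesM d (A B : 'M[R]_d) : scales_lebesgue A -> scales_lebesgue B ->
  scales_lebesgue (A *m B).
Proof.
move=> sA sB F mF F0.
under eq_integral do rewrite -mulmxA.
rewrite (sB (fun x => F (A *m x)%R))//; last first.
  by apply: (measurableT_comp mF); exact: measurable_mulmx.
by rewrite sA// muleA -EFinM det_mulmx normrM invfM mulrC.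
Qed.

Lemma trig_transvection d (i j : 'I_d) (c : R) : (j < i)%N ->
  let A : 'M[R]_d := (1%:M + c *: delta_mx i j)%R in is_trig_mx A /\ \det A = 1%R.
Proof.
move=> ji A; have t : is_trig_mx A.
  apply/is_trig_mxP => k l kl; rewrite !mxE.
  rewrite (_ : (k == l) = false) ?add0r; last by apply/eqP => E; rewrite E ltnn in kl.
  case: eqP => [ki|_]; last by rewrite mulr0.
  case: eqP => [lj|_]; last by rewrite mulr0.
  by move: kl; rewrite ki lj ltnNge ltnW.
split=> //; rewrite (det_trig t) big1// => k _; rewrite !mxE eqxx.
case: eqP => [->|_]; last by rewrite mulr0 addr0.
by rewrite -val_eqE /= gtn_eqF// mulr0 addr0.
Qed.

Lemma scales_transvection d (i j : 'I_d) (c : R) : i != j ->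
  scales_lebesgue (1%:M + c *: delta_mx i j)%R.
Proof.
move=> ij; case: (ltngtP i j) => [lij|lji|/val_inj ijE]; last by rewrite ijE eqxx in ij.
  have [t dt] := trig_transvection c lij.
  have E : ((1%:M + c *: delta_mx i j)^T = 1%:M + c *: delta_mx j i :> 'M[R]_d)%R.
    by rewrite linearD linearZ /= trmx1 trmx_delta.
  by apply: scales_upper; [rewrite E|rewrite -det_tr E dt oner_neq0].
by have [t dt] := trig_transvection c lji; apply: scales_lower; rewrite ?dt ?oner_neq0.
Qed.

(* A transposition matrix is a product of three transvections and a reflection. *)
Lemma scales_tperm d (i j : 'I_d) : scales_lebesgue (perm_mx (tperm i j)).
Proof.
have [->|ij] := eqVneq i j.
  rewrite tperm1 perm_mx1 => F mF F0; rewrite det1 normr1 invr1 mul1e.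
  by under eq_integral do rewrite mul1mx.
have ji : (j == i) = false by rewrite eq_sym (negbTE ij).
pose S : 'M[R]_d := (1%:M - 2 *: delta_mx i i)%R.
have tS : is_trig_mx S.
  apply/is_trig_mxP => k l kl; rewrite !mxE.
  have kl' : (k == l) = false by apply/eqP => E; rewrite E ltnn in kl.
  rewrite kl' sub0r; case: eqP => [ki|_]; last by rewrite mulr0 oppr0.
  by rewrite -ki eq_sym kl' mulr0 oppr0.
have sS : scales_lebesgue S.
  apply: scales_lower => //; rewrite (det_trig tS); apply/prodf_neq0 => k _.
  rewrite !mxE eqxx; case: (k == i) => /=; last by rewrite mulr0 subr0 oner_eq0.
  by rewrite mulr1 (_ : 1 - 2 = -1 :> R)%R ?oppr_eq0 ?oner_eq0//; ring.
rewrite (_ : perm_mx _ = (1%:M + 1 *: delta_mx i j) *m (1%:M + (-1) *: delta_mx j i) *m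
   (1%:M + 1 *: delta_mx i j) *m S)%R.
  by apply: scalesM => //; apply: scalesM; [apply: scalesM|]; apply: scales_transvection; rewrite ?ji.
rewrite /S !scale1r scaleN1r.
rewrite !(mulmxDl, mulmxDr, mulNmx, mulmxN, mul1mx, mulmx1, mul_delta_mx_cond,
  scalemxAl, scalemxAr) -?scalemxAr -?scalemxAl !mul_delta_mx_cond.
rewrite !(eqxx, ji, negbTE ij, mulr1n, mulr0n, mul0mx, mul_delta_mx_cond,
  scaler0, oppr0, opprK, subr0, addr0, add0r).
apply/matrixP => k l; rewrite !mxE.
case: tpermP => [->|->|/eqP/negbTE ki /eqP/negbTE kj].
- rewrite !eqxx (negbTE ij) !(eq_sym i l) !(eq_sym j l) /=.
  by case: (l == i); case: (l == j); rewrite /= ?mulr0n ?mulr1n; ring.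
- rewrite !eqxx ji !(eq_sym i l) !(eq_sym j l) /=.
  by case: (l == i); case: (l == j); rewrite /= ?mulr0n ?mulr1n; ring.
- rewrite ki kj /=.
  by case: (k == l); rewrite /= ?mulr0n ?mulr1n; ring.
Qed.

Lemma scales_perm d (s : 'S_d) : scales_lebesgue (perm_mx s).
Proof.
case: d s => [|d] s.
  move=> F mF F0; rewrite det_mx00 normr1 invr1 mul1e.
  by apply: eq_integral => x _; congr F; rewrite !flatmx0.
have [ts -> _] := prod_tpermP s.
elim: ts => [|t ts IH].
  rewrite big_nil perm_mx1 => F mF F0; rewrite det1 normr1 invr1 mul1e.
  by under eq_integral do rewrite mul1mx.
by rewrite big_cons perm_mxM; apply: scalesM => //; exact: scales_tperm.
Qed.

(** The LUP decomposition, available in positive dimension, writes [A] as a permutation matrix times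
    a lower and an upper triangular factor, and [scalesM] combines them. *)
Lemma scales_unitmx d (A : 'M[R]_d) : A \in unitmx -> scales_lebesgue A.
Proof.
case: d A => [|d] A uA.
  move=> F mF F0; rewrite det_mx00 normr1 invr1 mul1e.
  by apply: eq_integral => x _; congr F; rewrite !flatmx0.
have := cormen_lup_correct A; have := cormen_lup_perm A.
have := cormen_lup_detL A; have := @cormen_lup_lower _ _ A; have := @cormen_lup_upper _ _ A.
case: (cormen_lup A) => -[P L] U /= tU tL dL /is_perm_mxP[s ->] PA.
have AE : A = (perm_mx s^-1%g *m L *m U)%R.
  rewrite -mulmxA -[(L *m U)%R]PA mulmxA -[LHS]mul1mx; congr (_ *m _)%R.
  by rewrite -perm_mxM mulVg perm_mx1.
have dU : \det U != 0%R.
  move: uA; rewrite unitmxE unitfE AE det_mulmx mulf_eq0 negb_or => /andP[_].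
  by [].
rewrite AE; apply: scalesM; first apply: scalesM.
- exact: scales_perm.
- apply: scales_lower; last by rewrite dL oner_eq0.
  by apply/is_trig_mxP => i j ij; rewrite tL ?(ltnW ij)//; case: eqP ij => // ->; rewrite ltnn.
- apply: scales_upper => //; apply/is_trig_mxP => i j ij.
  by rewrite mxE tU.
Qed.

End change_of_variables.

(** * Sums over countable sets, and integration over the torus *)

Section countable_sums.
Context {R : realType} {I : countType}.

(* The sharp inverse [pickle_inv] lists each index exactly once; the other
   positions contribute [0]. *)
Definition enum_term (V : nmodType) (f : I -> V) (n : nat) : V :=
  oapp f 0 (pickle_inv n).

Lemma enum_termD (V : nmodType) (f g : I -> V) n :
  enum_term (fun i => f i + g i) n = enum_term f n + enum_term g n.
Proof. by rewrite /enum_term; case: pickle_inv => //=; rewrite addr0. Qed.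

Lemma enum_term_map (V W : nmodType) (h : V -> W) (f : I -> V) n : h 0 = 0 ->
  enum_term (fun i => h (f i)) n = h (enum_term f n).
Proof. by move=> h0; rewrite /enum_term; case: pickle_inv. Qed.

Lemma enum_term_ge0 (g : I -> R) n : (forall i, 0 <= g i) -> 0 <= enum_term g n.
Proof. by move=> g0; rewrite /enum_term; case: pickle_inv => //=. Qed.

(** Turns an unordered sum into a series, to which monotone convergence and linearity apply. *)
Lemma esum_enum_term (a : I -> \bar R) : (forall i, 0 <= a i)%E ->
  esum setT a = (\sum_(0 <= n <oo) oapp a 0 (@pickle_inv I n))%E.
Proof.
move=> a0; rewrite nneseries_esumT; last by move=> n; case: pickle_inv.
transitivity (esum (range (@pickle I)) (fun n => oapp a 0%E (@pickle_inv I n))).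
  rewrite (@reindex_esum R I nat setT (range (@pickle I)) pickle); last first.
    by apply: inj_bij => x y _ _; exact: (pcan_inj pickleK_inv).
  by apply: eq_esum => i _; rewrite pickleK_inv.
rewrite esum_mkcond; apply: eq_esum => n _.
case: ifPn => // /negP nr; case E : (@pickle_inv I n) => [i|//].
exfalso; apply: nr; apply: mem_set; exists i => //.
by have := @pickle_invK I n; rewrite E.
Qed.

Lemma enum_term_fin (g : I -> R) n :
  oapp (fun i => (g i)%:E) 0%E (@pickle_inv I n) = (enum_term g n)%:E.
Proof. by rewrite /enum_term; case: pickle_inv. Qed.

Lemma nneg_esum_cvg (g : I -> R) : (forall i, 0 <= g i) ->
  (esum setT (EFin \o g) < +oo)%E ->
  (fun N => \sum_(0 <= n < N) enum_term g n) @ \oo --> fine (esum setT (EFin \o g)).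
Proof.
move=> g0 fin.
have e0 : (0 <= esum setT (EFin \o g))%E by apply: esum_ge0 => i _; rewrite lee_fin.
have : (fun N => (\sum_(0 <= n < N) oapp (EFin \o g) 0 (@pickle_inv I n))%E) @ \oo -->
    esum setT (EFin \o g).
  rewrite esum_enum_term; last by move=> i; rewrite lee_fin.
  by apply: is_cvg_nneseries => n _ _; case: pickle_inv => //= i; rewrite lee_fin.
rewrite -[X in _ --> X]fineK ?ge0_fin_numE// => /fine_cvg.
rewrite (_ : _ \o _ = (fun N => \sum_(0 <= n < N) enum_term g n))//.
apply/funext => N /=; under eq_bigr do rewrite enum_term_fin.
by rewrite sumEFin.
Qed.

Lemma sum_R_cvg (f : I -> R) : (esum setT (fun i => `|f i|%:E) < +oo)%E ->
  (fun N => \sum_(0 <= n < N) enum_term f n) @ \oo --> sum_R setT f.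
Proof.
move=> fin.
have finp : (esum setT (EFin \o (f^\+)%R) < +oo)%E.
  apply: le_lt_trans fin; apply: le_esum => i _ /=.
  by rewrite lee_fin /funrpos ge_max normr_ge0 ler_norm.
have finn : (esum setT (EFin \o (f^\-)%R) < +oo)%E.
  apply: le_lt_trans fin; apply: le_esum => i _ /=.
  by rewrite lee_fin /funrneg ge_max normr_ge0 -normrN ler_norm.
have p0 i : 0 <= (f^\+)%R i by exact: funrpos_ge0.
have n0 i : 0 <= (f^\-)%R i by exact: funrneg_ge0.
have cp := nneg_esum_cvg p0 finp; have cn := nneg_esum_cvg n0 finn.
rewrite /sum_R funerpos funerneg fineB ?ge0_fin_numE//; try by
  apply: esum_ge0 => i _; rewrite lee_fin.
rewrite (_ : (fun N => _) = (fun N => \sum_(0 <= n < N) enum_term (f^\+)%R n -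
    \sum_(0 <= n < N) enum_term (f^\-)%R n)); first exact: cvgB.
apply/funext => N; rewrite -sumrB; apply: eq_bigr => n _.
rewrite /enum_term; case: pickle_inv => [i|] /=; last by rewrite subr0.
by rewrite /funrpos /funrneg; case: (leP (f i) 0) => h; case: (leP (- f i) 0) => h2; lra.
Qed.

(** On summable families [sum_C] is the limit of the partial sums along the enumeration; its
    algebraic rules then follow from uniqueness of limits. *)
Lemma sum_C_cvg (f : I -> R[i]) : l1_C f ->
  cvgC (fun N => \sum_(0 <= n < N) enum_term f n) (sum_C setT f).
Proof.
rewrite /l1_C /summable => fin; have {}fin : (esum setT (fun i => (normc (f i))%:E) < +oo)%E.
  apply: le_lt_trans fin; apply: le_esum => i _.
  by rewrite /= lee_fin ler_norm.
have sumE (re : R[i] -> R) N : re 0 = 0 -> {morph re : x y / x + y} ->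
    re (\sum_(0 <= n < N) enum_term f n) = \sum_(0 <= n < N) enum_term (fun i => re (f i)) n.
  move=> re0 reD; rewrite (big_morph re reD re0); apply: eq_bigr => n _.
  by rewrite enum_term_map.
split.
  under eq_fun do rewrite (sumE _ _ _ (@ReD R))//.
  apply: sum_R_cvg; apply: le_lt_trans fin; apply: le_esum => i _.
  by rewrite lee_fin Re_normc.
under eq_fun do rewrite (sumE _ _ _ (@ImD R))//.
apply: sum_R_cvg; apply: le_lt_trans fin; apply: le_esum => i _.
by rewrite lee_fin Im_normc.
Qed.

Lemma normc_sum_le (J : Type) (r : seq J) (F : J -> R[i]) :
  normc (\sum_(j <- r) F j) <= \sum_(j <- r) normc (F j).
Proof.
elim: r => [|j r IH]; first by rewrite !big_nil Normc.normc0.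
by rewrite !big_cons (le_trans (le_normcD _ _))// lerD2l.
Qed.

Lemma enum_sum_le (g : I -> R) N : (forall i, 0 <= g i) ->
  ((\sum_(0 <= n < N) enum_term g n)%:E <= esum setT (EFin \o g))%E.
Proof.
move=> g0; rewrite esum_enum_term; last by move=> i; rewrite lee_fin.
rewrite -sumEFin; under eq_bigr do rewrite -enum_term_fin.
by apply: nneseries_lim_ge => n _ _; rewrite enum_term_fin lee_fin enum_term_ge0.
Qed.

Lemma normc_enum_sum_le (f : I -> R[i]) N :
  ((normc (\sum_(0 <= n < N) enum_term f n))%:E <=
   esum setT (fun i => (normc (f i))%:E))%E.
Proof.
apply: le_trans (enum_sum_le (g := fun i => normc (f i)) N _); last first.
  by move=> i; exact: normc_ge0.
rewrite lee_fin (le_trans (normc_sum_le _ _))//; apply: ler_sum => n _.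
by rewrite (enum_term_map (h := @Normc.normc R)) ?Normc.normc0.
Qed.

Lemma l1_CE (f : I -> R[i]) :
  l1_C f <-> (esum setT (fun i => (normc (f i))%:E) < +oo)%E.
Proof.
rewrite /l1_C /summable (_ : (esum _ _ < _)%E = (esum setT (fun i => (normc (f i))%:E) < +oo)%E)//.
by congr (_ < _)%E; apply: eq_esum => i _; rewrite /= ger0_norm ?normc_ge0.
Qed.

Lemma esumZl (c : R) (a : I -> \bar R) : 0 <= c -> (forall i, 0 <= a i)%E ->
  esum setT (fun i => c%:E * a i)%E = (c%:E * esum setT a)%E.
Proof.
move=> c0 a0; rewrite !esum_enum_term//; last by move=> i; rewrite mule_ge0.
rewrite -nneseriesZl//; last by move=> n _; case: pickle_inv => /=.
by apply: eq_eseriesr => n _; case: pickle_inv => //=; rewrite mule0.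
Qed.

Lemma sum_CZ (c : R[i]) (f : I -> R[i]) : l1_C f ->
  sum_C setT (fun i => c * f i) = c * sum_C setT f.
Proof.
move=> lf.
have lcf : l1_C (fun i => c * f i).
  move: lf => /l1_CE lf; apply/l1_CE.
  have -> : esum setT (fun i => (normc (c * f i))%:E) =
      esum setT (fun i => (normc c)%:E * (normc (f i))%:E)%E.
    by apply: eq_esum => i _; rewrite Normc.normcM EFinM.
  rewrite esumZl ?normc_ge0//; last by move=> i; rewrite lee_fin normc_ge0.
  by rewrite lte_mul_pinfty// ?lee_fin ?normc_ge0.
apply: (cvgC_unique (sum_C_cvg lcf)).
have := cvgCM (cvgC_cst c) (sum_C_cvg lf).
rewrite (_ : (fun N => _) = (fun N => \sum_(0 <= n < N) enum_term (fun i => c * f i) n))//.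
apply/funext => N; rewrite mulr_sumr; apply: eq_bigr => n _.
by rewrite (enum_term_map (h := fun z => c * z))// mulr0.
Qed.

Lemma sum_R_eq (J : choiceType) (D : set J) (f g : J -> R) :
  (forall i, D i -> f i = g i) -> sum_R D f = sum_R D g.
Proof.
move=> fg; rewrite /sum_R !funerpos !funerneg; congr (fine (_ - _)%E);
by apply: eq_esum => i Di /=; rewrite /funrpos /funrneg fg.
Qed.

Lemma sum_C_eq (J : choiceType) (D : set J) (f g : J -> R[i]) :
  (forall i, D i -> f i = g i) -> sum_C D f = sum_C D g.
Proof. by move=> fg; congr Complex; apply: sum_R_eq => i Di; rewrite fg. Qed.

Lemma reindex_sum_R (J K : choiceType) (P : set K) (Q : set J) (e : K -> J)
    (f : J -> R) : set_bij P Q e -> sum_R Q f = sum_R P (fun k => f (e k)).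
Proof.
move=> b; rewrite /sum_R !funerpos !funerneg.
by congr (fine (_ - _)%E); apply: (reindex_esum _ _ _ _ b).
Qed.

Lemma reindex_sum_C (J K : choiceType) (P : set K) (Q : set J) (e : K -> J)
    (f : J -> R[i]) : set_bij P Q e -> sum_C Q f = sum_C P (fun k => f (e k)).
Proof. by move=> b; congr Complex; rewrite (reindex_sum_R _ b). Qed.

Section measurable.
Context disp (T : measurableType disp).

Lemma measurable_esum (F : I -> T -> \bar R) : (forall i x, 0 <= F i x)%E ->
  (forall i, measurable_fun setT (F i)) ->
  measurable_fun setT (fun x => esum setT (fun i => F i x)).
Proof.
move=> F0 mF; under eq_fun do rewrite esum_enum_term//.
rewrite (_ : (fun x => _) = (fun x => \sum_(0 <= n <oo | n \in xpredT)
    oapp (fun i => F i x) 0 (@pickle_inv I n))%E)//.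
apply: (@ge0_emeasurable_sum _ _ _ setT (fun n x => oapp (F^~ x) 0%E (@pickle_inv I n)) xpredT).
  by move=> n x _ _; case: pickle_inv => [i|] /=.
by move=> n _; case: pickle_inv => [i|] /=; [exact: mF|exact: measurable_cst].
Qed.

Lemma measurable_sum_R (F : I -> T -> R) : (forall i, measurable_fun setT (F i)) ->
  measurable_fun setT (fun x => sum_R setT (fun i => F i x)).
Proof.
move=> mF; rewrite /sum_R.
apply: (measurableT_comp (fine_measurable measurableT)).
apply: emeasurable_funB.
  under eq_fun do rewrite funerpos.
  apply: (@measurable_esum (fun i x => (Num.max (F i x) 0)%:E)).
    by move=> i x; rewrite lee_fin le_max lexx orbT.
  move=> i; apply/measurable_EFinP; exact: measurable_maxr.
under eq_fun do rewrite funerneg.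
apply: (@measurable_esum (fun i x => (Num.max (- F i x) 0)%:E)).
  by move=> i x; rewrite lee_fin le_max lexx orbT.
move=> i; apply/measurable_EFinP; apply: measurable_maxr => //.
exact: measurable_funN.
Qed.

Lemma measurable_sum_C (F : I -> T -> R[i]) : (forall i, measurable_fun_C (F i)) ->
  measurable_fun_C (fun x => sum_C setT (fun i => F i x)).
Proof.
by move=> mF; split; apply: measurable_sum_R => i; [exact: (mF i).1|exact: (mF i).2].
Qed.

Lemma integral_esum (mu : {measure set T -> \bar R}) (F : I -> T -> \bar R) :
  (forall i x, 0 <= F i x)%E -> (forall i, measurable_fun setT (F i)) ->
  (\int[mu]_x esum setT (fun i => F i x) = esum setT (fun i => \int[mu]_x F i x))%E.
Proof.
move=> F0 mF; under eq_integral do rewrite esum_enum_term//.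
have G0 n x : (0 <= oapp (F^~ x) 0 (@pickle_inv I n))%E by case: pickle_inv => [i|] /=.
have mG n : measurable_fun setT (fun x => oapp (F^~ x) 0%E (@pickle_inv I n)).
  by case: pickle_inv => [i|] /=; [exact: mF|exact: measurable_cst].
rewrite integral_nneseries// esum_enum_term; last by move=> i; exact: integral_ge0.
apply: eq_eseriesr => n _; case: pickle_inv => //=.
by rewrite integral0.
Qed.

End measurable.

End countable_sums.

Section restricted_measure.
Context {R : realType} disp (T : measurableType disp).
Variables (mu : {measure set T -> \bar R}) (D : set T) (mD : measurable D).
Local Open Scope ereal_scope.

Lemma ge0_integral_mrestr (F : T -> \bar R) : measurable_fun setT F ->
  (forall x, 0 <= F x) ->
  \int[mrestr mu mD]_x F x = \int[mu]_x ((\1_D x)%:E * F x).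
Proof.
move=> mF F0.
rewrite (@ge0_negligible_integral _ _ _ (mrestr mu mD) setT (~` D))//; last 2 first.
- exact: measurableC.
- by rewrite /= /mrestr setICl measure0.
rewrite setTD setCK (@eq_measure_integral _ _ _ D mu (mrestr mu mD)); last first.
  by move=> A mA AD; rewrite /= /mrestr (setIidl AD).
rewrite integral_mkcond; apply: eq_integral => x _.
by rewrite epatch_indic muleC.
Qed.

End restricted_measure.

Lemma esum_single (R : realType) (I : choiceType) (a : I -> \bar R) (i0 : I) :
  (0 <= a i0)%E -> (forall i, i != i0 -> a i = 0%E) -> esum setT a = a i0.
Proof.
move=> a0 ai; rewrite -(esum_set1 a0) [RHS]esum_mkcond; apply: eq_esum => i _.
case: (eqVneq i i0) => [->|ne]; first by rewrite mem_set.
by rewrite memNset ?ai//= => E; rewrite E eqxx in ne.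
Qed.

(** * Tiling of R^d by the lattice translates of the unit cube *)

Section tiling.
Context {R : realType} {d : nat}.
Local Notation Rd := 'cV[R]_d.
Local Notation Zd := 'cV[int]_d.

Definition cube : {measure set Rd -> \bar R} :=
  mrestr (leb d) (@measurable_unit_cube R d).

Definition intpart (x : Rd) : Zd := \col_i Num.floor (x i 0).

Lemma unit_cube_intpart x : unit_cube (x - iota_Z (intpart x)).
Proof.
move=> i; rewrite !mxE; have /andP[a b] := floor_itv (x i 0).
by rewrite subr_ge0 a /= ltrBlDl; rewrite intrD in b.
Qed.

Lemma intpart_uniq x k : unit_cube (x - iota_Z k) -> k = intpart x.
Proof.
move=> H; apply/colP => i; rewrite mxE; have := H i; rewrite !mxE => /andP[a b].
apply/esym/floor_def; rewrite intrD -subr_ge0 a /=.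
by rewrite -ltrBlDl.
Qed.

Lemma ge0_integral_cube (F : Rd -> \bar R) : measurable_fun setT F ->
  (forall x, 0 <= F x)%E ->
  (\int[cube]_x F x = \int[leb d]_x ((\1_unit_cube x)%:E * F x))%E.
Proof. by move=> mF F0; exact: ge0_integral_mrestr. Qed.

Lemma measurable_shift (F : Rd -> \bar R) (b : Rd) : measurable_fun setT F ->
  measurable_fun setT (fun x : Rd => F (x + b)).
Proof. by move=> mF; apply: (measurableT_comp mF); exact: measurable_cV_addr. Qed.

Lemma ge0_integral_tiling (F : Rd -> \bar R) : measurable_fun setT F ->
  (forall x, 0 <= F x)%E ->
  (\int[leb d]_x F x = \int[cube]_x esum setT (fun k : Zd => F (x + iota_Z k)%R))%E.
Proof.
move=> mF F0.
rewrite (@integral_esum _ Zd _ _ cube (fun k x => F (x + iota_Z k)))//; last first.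
  by move=> k; exact: measurable_shift.
(* [G k] is [F] cut off to the cube translated by [k]; at each point [x] exactly the term of index
   [intpart x] survives. *)
pose G k (x : Rd) := ((\1_unit_cube (x - iota_Z k)%R)%:E * F x)%E.
have G0 k x : (0 <= G k x)%E by rewrite mule_ge0// lee_fin.
have mind : measurable_fun setT (fun x : Rd => (\1_unit_cube x)%:E : \bar R).
  by apply/measurable_EFinP; apply: measurable_indic; exact: measurable_unit_cube.
have mG k : measurable_fun setT (G k).
  by apply: emeasurable_funM => //; exact: (measurable_shift (- iota_Z k) mind).
transitivity (\int[leb d]_x esum setT (fun k : Zd => G k x))%E.
  apply: eq_integral => x _.
  rewrite (@esum_single _ _ _ (intpart x))//.
    rewrite /G indicE mem_set ?mul1e//; exact: unit_cube_intpart.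
  move=> k kx; rewrite /G indicE memNset ?mul0e// => /intpart_uniq E.
  by rewrite E eqxx in kx.
rewrite integral_esum//; apply: eq_esum => k _.
rewrite ge0_integral_cube//; last exact: measurable_shift.
rewrite -(@ge0_integral_shift _ _ (iota_Z k) (G k))//.
by apply: eq_integral => x _; rewrite /G addrK.
Qed.

(** [haar] is the image of [cube], so the two total masses are convertible. *)
Lemma cubeT : cube setT = 1%E.
Proof. exact: (@probability_setT _ _ _ (@haar R d)). Qed.

End tiling.

(** * The torus, its characters and sums over fibres *)

Section torus_integral.
Context {R : realType} {d : nat}.
Local Notation Rd := 'cV[R]_d.
Local Notation Zd := 'cV[int]_d.

(** The sigma-algebra of the torus is the final one for [hat_iota], so measurability can be tested
    on R^d. *)
Lemma measurable_torus disp (T : measurableType disp) (g : torus R d -> T) :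
  measurable_fun setT (g \o hat_iota) -> measurable_fun setT g.
Proof.
move=> mg _ Y mY; rewrite setTI.
suff : torus_measurable (g @^-1` Y) by [].
by rewrite /torus_measurable /image_set_system /=; apply: mg.
Qed.

Lemma measurable_torus_C (g : torus R d -> R[i]) :
  measurable_fun_C (fun x => g (hat_iota x)) -> measurable_fun_C g.
Proof. by move=> [a b]; split; apply: measurable_torus. Qed.

Lemma ge0_integral_haar (G : torus R d -> \bar R) : measurable_fun setT G ->
  (forall z, 0 <= G z)%E ->
  (\int[haar]_z G z = \int[cube]_x G (hat_iota x))%E.
Proof.
by move=> mG G0; rewrite /haar ge0_integral_pushforward//; exact: measurable_hat_iota.
Qed.

Lemma hat_iota_eqP (x y : Rd) :
  hat_iota x = hat_iota y <-> exists k : Zd, x = y + iota_Z k.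
Proof.
split=> [/eqquotP /asboolP[k xy]|[k ->]].
  by exists k; rewrite -xy addrC subrK.
by apply/eqquotP/asboolP; exists k; rewrite addrAC subrr add0r.
Qed.

Lemma hat_iotaK z : hat_iota (repr z) = z :> torus R d.
Proof. exact: reprK. Qed.

Lemma dotmulC (x y : Rd) : dotmul x y = dotmul y x.
Proof. by apply: eq_bigr => i _; rewrite mulrC. Qed.

Lemma dotmulDl (x y z : Rd) : dotmul (x + y) z = dotmul x z + dotmul y z.
Proof. by rewrite /dotmul -big_split; apply: eq_bigr => i _; rewrite mxE mulrDl. Qed.

Lemma dotmulDr (x y z : Rd) : dotmul x (y + z) = dotmul x y + dotmul x z.
Proof. by rewrite !(dotmulC x) dotmulDl. Qed.

Lemma dotmulZl (c : R) (x y : Rd) : dotmul (c *: x) y = c * dotmul x y.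
Proof. by rewrite /dotmul mulr_sumr; apply: eq_bigr => i _; rewrite mxE mulrA. Qed.

Lemma dotmulZr (c : R) (x y : Rd) : dotmul x (c *: y) = c * dotmul x y.
Proof. by rewrite dotmulC dotmulZl dotmulC. Qed.

Lemma dotmulNl (x y : Rd) : dotmul (- x) y = - dotmul x y.
Proof. by rewrite -scaleN1r dotmulZl mulN1r. Qed.

Lemma dotmul0l (x : Rd) : dotmul 0 x = 0.
Proof. by rewrite -(scale0r 0) dotmulZl mul0r. Qed.

Lemma dotmul_mulmx (A : 'M[R]_d) (x y : Rd) : dotmul (A *m x) y = dotmul x (A^T *m y).
Proof.
have E (u v : Rd) : dotmul u v = (u^T *m v) 0 0.
  by rewrite mxE; apply: eq_bigr => i _; rewrite mxE.
by rewrite !E trmx_mul mulmxA.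
Qed.

Lemma iota_ZD (k l : Zd) : iota_Z (k + l) = iota_Z k + iota_Z l :> Rd.
Proof. by rewrite /iota_Z map_mxD. Qed.

Lemma iota_ZN (k : Zd) : iota_Z (- k) = - iota_Z k :> Rd.
Proof. by rewrite /iota_Z map_mxN. Qed.

Lemma iota_Z0 : iota_Z (0 : Zd) = 0 :> Rd.
Proof. by rewrite /iota_Z map_mx0. Qed.

Lemma iota_Z_inj : injective (iota_Z : Zd -> Rd).
Proof.
move=> k l E; apply/colP => i; have := congr1 (fun x : Rd => x i 0) E.
by rewrite !mxE => /intr_inj.
Qed.

Lemma expi2pi_iota (k l : Zd) : expi2pi (dotmul (iota_Z k) (iota_Z l)) = 1 :> R[i].
Proof.
rewrite (_ : dotmul _ _ = (\sum_i k i 0 * l i 0)%:~R) ?expi2pi_int//.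
by rewrite rmorph_sum; apply: eq_bigr => i _; rewrite !mxE rmorphM.
Qed.

Lemma torus_charE (g : Zd) (x : Rd) :
  torus_char g (hat_iota x) = expi2pi (dotmul (iota_Z g) x) :> R[i].
Proof.
have /hat_iota_eqP[k E] : hat_iota (repr (hat_iota x)) = hat_iota x by exact: hat_iotaK.
by rewrite /torus_char E dotmulDr expi2piD expi2pi_iota mulr1.
Qed.

Lemma measurable_torus_char g : measurable_fun_C (torus_char g : torus R d -> R[i]).
Proof.
apply: measurable_torus_C; rewrite (_ : (fun x => _) =
    (fun x : Rd => expi2pi (dotmul (iota_Z g) x) : R[i])); last first.
  by apply/funext => x; rewrite torus_charE.
by apply: measurable_expi2pi; apply: measurable_dotmul.
Qed.

Section fibers.
Variables (B : 'M[R]_d) (uB : B \in unitmx).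

Definition fiber (z : torus R d) : set Rd := [set xi | hat_iota (B *m xi) = z].

Definition fiber_pt (x : Rd) (k : Zd) : Rd := invmx B *m (x + iota_Z k).

(** A fibre is a set of vectors, whose type is not countable; this parametrisation by Z^d gives
    access to the results on countable sums. *)
Lemma fiber_bij x : set_bij setT (fiber (hat_iota x)) (fiber_pt x).
Proof.
split.
- move=> k _; rewrite /fiber /= /fiber_pt mulKVmx//; apply/hat_iota_eqP.
  by exists k.
- move=> k l _ _ /(congr1 (mulmx B)); rewrite /fiber_pt !mulKVmx// => /addrI.
  exact: iota_Z_inj.
- move=> xi /hat_iota_eqP[k E]; exists k => //.
  by rewrite /fiber_pt -E mulKmx.
Qed.

Lemma measurable_fiber_pt k : measurable_fun setT (fiber_pt ^~ k).
Proof.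
apply: (measurableT_comp (measurable_mulmx (invmx B))).
exact: measurable_cV_addr.
Qed.

Lemma measurable_fiber_esum (F : Rd -> \bar R) : measurable_fun setT F ->
  (forall x, 0 <= F x)%E ->
  measurable_fun setT (fun z : torus R d => esum (fiber z) F).
Proof.
move=> mF F0; apply: measurable_torus; rewrite (_ : _ \o _ =
    (fun x => esum setT (fun k => F (fiber_pt x k)))).
  apply: (@measurable_esum _ Zd _ _ (fun k x => F (fiber_pt x k))) => // k.
  by apply: (measurableT_comp mF); exact: measurable_fiber_pt.
by apply/funext => x /=; apply: reindex_esum; exact: fiber_bij.
Qed.

(** Passing from the torus to the cube and from the cube to R^d by tiling leaves the integral of [F]
    composed with the inverse of [B], whence the determinant. *)
Lemma ge0_integral_fiber (F : Rd -> \bar R) : measurable_fun setT F ->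
  (forall x, 0 <= F x)%E ->
  (\int[haar]_z esum (fiber z) F = (`|\det B|)%:E * \int[leb d]_x F x)%E.
Proof.
move=> mF F0.
rewrite ge0_integral_haar; last 2 first.
- exact: measurable_fiber_esum.
- by move=> z; exact: esum_ge0.
transitivity (\int[cube]_x esum setT (fun k : Zd => (fun y => F (invmx B *m y)) (x + iota_Z k)%R))%E.
  apply: eq_integral => x _; apply: reindex_esum; exact: fiber_bij.
rewrite -(ge0_integral_tiling (F := fun y => F (invmx B *m y)))//; last first.
  by apply: (measurableT_comp mF); exact: measurable_mulmx.
by rewrite scales_unitmx ?unitmx_inv// det_inv normfV invrK.
Qed.

Definition fiber_sum (P : Rd -> R[i]) (z : torus R d) : R[i] := sum_C (fiber z) P.

Lemma fiber_sumE P x : fiber_sum P (hat_iota x) = sum_C setT (fun k => P (fiber_pt x k)).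
Proof. by apply: reindex_sum_C; exact: fiber_bij. Qed.

Lemma ae_fiber_summable P : integrable_C (leb d) P ->
  {ae haar, forall z : torus R d, (esum (fiber z) (fun xi => (normc (P xi))%:E) < +oo)%E}.
Proof.
move=> [mP iP].
have mn : measurable_fun setT (fun xi => (normc (P xi))%:E).
  exact: measurable_EFin_normc.
have n0 x : (0 <= (normc (P x))%:E)%E by rewrite lee_fin normc_ge0.
have i : (@haar R d).-integrable setT (fun z => esum (fiber z) (fun xi => (normc (P xi))%:E)).
  apply/integrableP; split; first exact: measurable_fiber_esum.
  under eq_integral do rewrite gee0_abs ?esum_ge0//.
  by rewrite ge0_integral_fiber// lte_mul_pinfty.
apply: filterS (integrable_ae measurableT i) => z /(_ I).
by rewrite ge0_fin_numE// esum_ge0.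
Qed.

Lemma fiber_sum_R (g : Rd -> R) : (leb d).-integrable setT (EFin \o g) ->
  (@haar R d).-integrable setT (fun z => (sum_R (fiber z) g)%:E) /\
  \int[haar]_z sum_R (fiber z) g = `|\det B| * \int[leb d]_x g x.
Proof.
move=> ig; have mg := measurable_int _ ig.
have part (h : Rd -> \bar R) : (leb d).-integrable setT h -> (forall x, 0 <= h x)%E ->
    (@haar R d).-integrable setT (fun z => esum (fiber z) h).
  move=> /integrableP[mh ih] h0; apply/integrableP; split; first exact: measurable_fiber_esum.
  under eq_integral do rewrite gee0_abs ?esum_ge0//.
  rewrite ge0_integral_fiber// lte_mul_pinfty//.
  by under eq_integral do rewrite -[h _]gee0_abs//.
have ip := part _ (integrable_funepos measurableT ig) (funepos_ge0 _).
have in_ := part _ (integrable_funeneg measurableT ig) (funeneg_ge0 _).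
have iB := integrableB measurableT ip in_.
(* Integrability makes the difference finite outside a null set, and there the [fine] inside [sum_R]
   loses nothing. *)
have ae : {ae haar, forall z : torus R d, setT z ->
    (esum (fiber z) (EFin \o g)^\+ - esum (fiber z) (EFin \o g)^\-)%E = (sum_R (fiber z) g)%:E}.
  apply: filterS (integrable_ae measurableT iB) => z /(_ I) f _.
  by rewrite /sum_R fineK.
have mS : measurable_fun setT (fun z : torus R d => (sum_R (fiber z) g)%:E).
  apply/measurable_EFinP; apply: (measurableT_comp (fine_measurable measurableT)).
  exact: measurable_int iB.
split.
  apply/integrableP; split => //; have /integrableP[mI] := iB; apply: le_lt_trans.
  rewrite le_eqVlt; apply/orP; left; apply/eqP; apply: ge0_ae_eq_integral => //.
  - exact: measurableT_comp.
  - exact: measurableT_comp.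
  - by apply: filterS ae => z E _; rewrite E.
rewrite /Rintegral -(ae_eq_integral _ _ measurableT (measurable_int _ iB) mS ae).
rewrite integralB// !ge0_integral_fiber//;
  try exact: measurable_funeneg; try exact: measurable_funepos.
rewrite [in RHS]integralE -muleBr//; last first.
  by rewrite fin_num_adde_defr// integrable_pos_fin_num.
rewrite fineM// -integralE; exact: integrable_fin_num.
Qed.

Lemma fiber_sum_integral P : integrable_C (leb d) P ->
  integrable_C haar (fiber_sum P) /\
  integral_C haar (fiber_sum P) = (`|\det B|)%:C * integral_C (leb d) P.
Proof.
move=> /integrable_CP[iR iI].
have [a b] := fiber_sum_R iR; have [a' b'] := fiber_sum_R iI.
split; first by apply/integrable_CP.
by apply: complexP; rewrite ReImE /= ?mul0r ?subr0 ?addr0.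
Qed.

End fibers.

End torus_integral.

(** * Totality of the characters and Parseval's identity on the cube *)

Section multipliers.
Context {R : realType} disp (T : measurableType disp) (J : Type).
Variables (mu : {measure set T -> \bar R}) (e : J -> T -> R[i]).
Hypothesis me : forall j, measurable_fun_C (e j).
Hypothesis e1 : forall j x, normc (e j x) <= 1.

(* [G] annihilates the functions [e j]; a multiplier is a bounded function
   multiplication by which preserves this property. *)
Definition annihilates (G : T -> R[i]) :=
  integrable_C mu G /\ forall j, integral_C mu (fun x => e j x * G x) = 0.

Definition multiplier (u : T -> R) :=
  [/\ measurable_fun setT u, exists M, forall x, `|u x| <= M &
      forall G, annihilates G -> annihilates (fun x => (u x)%:C * G x)].

Lemma integrable_e j G : integrable_C mu G -> integrable_C mu (fun x => e j x * G x).
Proof. by move=> i; apply: (@integrable_CMb _ _ _ _ _ _ 1). Qed.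

Lemma annihilates_eq G H : measurable_fun_C H -> annihilates G ->
  {ae mu, forall x, G x = H x} -> annihilates H.
Proof.
move=> mH [iG G0] GH; have iH := ae_integrable_C mH iG GH; split => // j.
rewrite -(G0 j); apply: ae_eq_integral_C.
- exact: (integrable_e j iH).1.
- exact: (integrable_e j iG).1.
- by apply: filterS GH => x ->.
Qed.

Lemma annihilatesD G H : annihilates G -> annihilates H ->
  annihilates (fun x => G x + H x).
Proof.
move=> [iG G0] [iH H0]; split; first exact: integrable_CD.
move=> j; under eq_fun do rewrite mulrDr.
by rewrite integral_CD ?G0 ?H0 ?addr0//; exact: integrable_e.
Qed.

Lemma annihilatesZ c G : annihilates G -> annihilates (fun x => c * G x).
Proof.
move=> [iG G0]; split; first exact: integrable_CZ.
move=> j; under eq_fun do rewrite mulrCA.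
by rewrite integral_CZ ?G0 ?mulr0//; exact: integrable_e.
Qed.

Lemma multiplier_cst (r : R) : multiplier (fun=> r).
Proof.
split=> //; first by exists `|r|.
by move=> G; exact: annihilatesZ.
Qed.

Lemma multiplierD u v : multiplier u -> multiplier v -> multiplier (fun x => u x + v x).
Proof.
move=> [mu_ [M uM] hu] [mv [N vN] hv]; split; first exact: measurable_funD.
  by exists (M + N) => x; rewrite (le_trans (ler_normD _ _))// lerD.
move=> G aG; under eq_fun do rewrite rmorphD/= mulrDl.
by apply: annihilatesD; [exact: hu|exact: hv].
Qed.

Lemma multiplierM u v : multiplier u -> multiplier v -> multiplier (fun x => u x * v x).
Proof.
move=> [mu_ [M uM] hu] [mv [N vN] hv]; split; first exact: measurable_funM.
  by exists (M * N) => x; rewrite normrM ler_pM.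
move=> G aG; under eq_fun do rewrite rmorphM/= -mulrA.
by apply: hu; exact: hv.
Qed.

Lemma multiplierZ (r : R) u : multiplier u -> multiplier (fun x => r * u x).
Proof. by move=> h; apply: multiplierM => //; exact: multiplier_cst. Qed.

Lemma multiplierX u n : multiplier u -> multiplier (fun x => u x ^+ n).
Proof.
move=> h; elim: n => [|n IH]; first by under eq_fun do rewrite expr0; exact: multiplier_cst.
by under eq_fun do rewrite exprS; exact: multiplierM.
Qed.

(** Bounded pointwise limits pass through the integrals by dominated convergence, with [M] times the
    modulus of [G] as majorant. *)
Lemma multiplier_cvg (u : (T -> R)^nat) v (M : R) : (forall n, multiplier (u n)) ->
  (forall n x, `|u n x| <= M) -> (forall x, (fun n => u n x) @ \oo --> v x) ->
  multiplier v.
Proof.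
move=> hu uM uv.
have mv : measurable_fun setT v.
  by apply: (measurable_fun_cvg (h := u)) => // n; have [] := hu n.
have vM x : `|v x| <= M.
  have c : (fun n => `|u n x|) @ \oo --> `|v x| by exact: cvg_norm.
  rewrite -(cvg_lim _ c)//.
  by apply: limr_le; [exact: cvgP c|exact: nearW].
split => //; first by exists M.
move=> G aG; have iv : integrable_C mu (fun x => (v x)%:C * G x).
  apply: (@integrable_CMb _ _ _ _ _ _ M); [exact: aG.1|exact: measurable_Creal|].
  by move=> x; rewrite normcE sqnC sqrtr_sqr.
split => // j.
have gM := integrable_C_normc aG.1.
have [|x|n x||_] := @dominated_C _ _ _ mu (fun n x => e j x * ((u n x)%:C * G x))
   (fun x => e j x * ((v x)%:C * G x)) (fun x => M * normc (G x)).
- move=> n; apply: measurable_CM => //; apply: measurable_CM; last exact: aG.1.1.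
  by apply: measurable_Creal; have [] := hu n.
- apply: cvgCM; first exact: cvgC_cst.
  apply: cvgCM; last exact: cvgC_cst.
  by split => /=; [exact: uv|exact: cvg_cst].
- rewrite !Normc.normcM -[leRHS]mul1r ler_pM ?normc_ge0 ?mulr_ge0 ?normc_ge0//.
  by rewrite ler_wpM2r ?normc_ge0// normcE sqnC sqrtr_sqr.
- exact: (integrableZl measurableT M gM).
have E n : integral_C mu (fun x => e j x * ((u n x)%:C * G x)) = 0.
  by have [_ _ /(_ _ aG)[_ ->]] := hu n.
under eq_fun do rewrite E.
by move=> /(cvgC_unique (cvgC_cst 0)).
Qed.

(* This iteration increases to [Num.sqrt t] and is polynomial in [t], so that
   [`|u|], the square root of [u ^+ 2], is a limit of polynomials in [u]. *)
Fixpoint sqrt_iter (t : R) n : R :=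
  if n is n'.+1 then sqrt_iter t n' + 2^-1 * (t - sqrt_iter t n' ^+ 2) else 0.

Lemma sqrt_iter_bounds t n : 0 <= t <= 1 ->
  0 <= sqrt_iter t n <= Num.sqrt t /\
  Num.sqrt t - sqrt_iter t n <= Num.sqrt t * (1 - Num.sqrt t / 2) ^+ n.
Proof.
move=> /andP[t0 t1]; set s := Num.sqrt t.
have s0 : 0 <= s by exact: sqrtr_ge0.
have s1 : s <= 1 by rewrite -sqrtr1 ler_sqrt.
have ts : t = s ^+ 2 by rewrite sqr_sqrtr.
elim: n => [|n [/andP[p0 ps] pe]] /=; first by rewrite lexx s0 expr0 subr0 mulr1.
move: (sqrt_iter t n) p0 ps pe => p p0 ps pe.
(* One iteration multiplies the error by [1 - (s + p) / 2], which lies between 0 and [1 - s / 2]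
   because [0 <= p <= s <= 1]. *)
have E : s - (p + 2^-1 * (t - p ^+ 2)) = (s - p) * (1 - (s + p) / 2) by rewrite ts; field.
split.
  apply/andP; split.
    rewrite addr_ge0// mulr_ge0// subr_ge0 ts ler_pXn2r//.
  by rewrite -subr_ge0 E mulr_ge0 ?subr_ge0//; lra.
rewrite E exprSr mulrA; apply: ler_pM => //.
- by rewrite subr_ge0.
- by rewrite subr_ge0; lra.
- by rewrite lerD2l lerN2 ler_wpM2r// lerDl.
Qed.

Lemma cvg_sqrt_iter t : 0 <= t <= 1 -> (fun n => sqrt_iter t n) @ \oo --> Num.sqrt t.
Proof.
move=> t01; set s := Num.sqrt t.
have s0 : 0 <= s by exact: sqrtr_ge0.
have s1 : s <= 1 by rewrite -sqrtr1 ler_sqrt//; case/andP: t01.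
(* For [s = 0] the geometric ratio would be one, but then the bounds force every iterate to be 0. *)
have [sz|sn0] := eqVneq s 0.
  rewrite (_ : (fun n => _) = fun=> s); first exact: cvg_cst.
  apply/funext => n; have [/andP[a b] _] := sqrt_iter_bounds n t01.
  by apply/eqP; rewrite eq_le b /= -/s sz.
have sp : 0 < s by rewrite lt_def sn0.
have g0 : (fun n => s * (1 - s / 2) ^+ n) @ \oo --> 0.
  by apply: cvg_geometric; rewrite ger0_norm; lra.
apply: (@squeeze_cvgr _ _ _ _ (fun n => s - s * (1 - s / 2) ^+ n) (fun=> s)).
- apply: nearW => n; have [/andP[_ b] c] := sqrt_iter_bounds n t01.
  by rewrite b andbT lerBlDr -lerBlDl.
- by rewrite -[X in _ --> X]subr0; apply: cvgB => //; exact: cvg_cst.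
- exact: cvg_cst.
Qed.

Lemma multiplier_sqrt u : multiplier u -> (forall x, 0 <= u x <= 1) ->
  multiplier (fun x => Num.sqrt (u x)).
Proof.
move=> hu u01; apply: (@multiplier_cvg (fun n x => sqrt_iter (u x) n) _ 1).
- elim=> [|n IH] /=; first exact: multiplier_cst.
  apply: multiplierD => //; apply: multiplierZ; apply: multiplierD => //.
  by under eq_fun do rewrite -mulN1r; apply: multiplierZ; exact: multiplierX.
- move=> n x; have [/andP[a b] _] := sqrt_iter_bounds n (u01 x).
  rewrite ger0_norm// (le_trans b)// -sqrtr1 ler_sqrt//.
  by have /andP[] := u01 x.
- by move=> x; exact: cvg_sqrt_iter.
Qed.

Lemma multiplier_bound u : multiplier u -> exists2 N : R, 0 < N & forall x, `|u x| <= N.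
Proof.
move=> [_ [M uM] _]; exists (`|M| + 1); first by rewrite ltr_wpDl.
by move=> x; rewrite (le_trans (uM x))// (le_trans (ler_norm M))// lerDl.
Qed.

Lemma multiplier_norm u : multiplier u -> multiplier (fun x => `|u x|).
Proof.
move=> hu; have [N N0 uM] := multiplier_bound hu.
have uN x : `|N^-1 * u x| <= 1.
  by rewrite normrM gtr0_norm ?invr_gt0// mulrC ler_pdivrMr// mul1r.
(* Dividing by the bound [N] brings the square into [0, 1], the range in which the iteration
   converges. *)
rewrite (_ : (fun x => _) = (fun x => N * Num.sqrt ((N^-1 * u x) ^+ 2))); last first.
  apply/funext => x; rewrite sqrtr_sqr normrM gtr0_norm ?invr_gt0//.
  by rewrite mulrA divff ?mul1r// gt_eqF.
apply: multiplierZ; apply: multiplier_sqrt.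
  by apply: multiplierX; exact: multiplierZ.
by move=> x; rewrite sqr_ge0 -real_normK ?num_real// exprn_ile1.
Qed.

Lemma multiplier_pos u : multiplier u -> multiplier (\1_[set x | 0 < u x]).
Proof.
move=> hu; have [N N0 uM] := multiplier_bound hu.
(* The positive part of [u], scaled into [0, 1]; the functions [1 - (1 - w) ^+ n] converge to the
   indicator of the points where [w] is positive. *)
pose w x := (2 * N)^-1 * (`|u x| + u x).
have w01 x : 0 <= w x <= 1.
  have h : `|u x| <= N := uM x.
  have h2 := ler_norm (u x); have h3 := ler_norm (- u x); rewrite normrN in h3.
  rewrite /w mulr_ge0 ?invr_ge0 ?mulr_ge0 ?(ltW N0)//=; last by lra.
  rewrite mulrC ler_pdivrMr ?mulr_gt0//; lra.
have hw : multiplier w by apply: multiplierZ; apply: multiplierD => //; exact: multiplier_norm.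
apply: (@multiplier_cvg (fun n x => 1 - (1 - w x) ^+ n) _ 1).
- move=> n; apply: multiplierD; first exact: multiplier_cst.
  under eq_fun do rewrite -mulN1r; apply: multiplierZ; apply: multiplierX.
  apply: multiplierD; first exact: multiplier_cst.
  by under eq_fun do rewrite -mulN1r; exact: multiplierZ.
- move=> n x; have /andP[a b] := w01 x.
  have c : 0 <= 1 - w x by rewrite subr_ge0.
  have c1 : 1 - w x <= 1 by rewrite gerBl.
  have e0 : 0 <= (1 - w x) ^+ n by rewrite exprn_ge0.
  have le1 : (1 - w x) ^+ n <= 1 by rewrite exprn_ile1.
  by rewrite ger0_norm ?subr_ge0// gerBl.
- move=> x; rewrite indicE; have [ux|ux] := ltP 0 (u x).
    rewrite mem_set//= -[X in _ --> X]subr0; apply: cvgB; first exact: cvg_cst.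
    have wp : 0 < w x by rewrite /w gtr0_norm// mulr_gt0 ?invr_gt0 ?mulr_gt0 ?addr_gt0.
    have := @cvg_geometric R 1 (1 - w x).
    rewrite /geometric /=; under eq_fun do rewrite mul1r.
    by apply; have /andP[a b] := w01 x; rewrite ger0_norm; lra.
  rewrite memNset/=; last by move=> /lt_le_trans/(_ ux); rewrite ltxx.
  rewrite (_ : (fun n => _) = fun=> 0); first exact: cvg_cst.
  apply/funext => n; rewrite /w ler0_norm// addNr mulr0 subr0 expr1n.
  by rewrite subrr.
Qed.

Definition multiplier_set (A : set T) := measurable A /\ multiplier (\1_A).

Lemma multiplier_setC A : multiplier_set A -> multiplier_set (~` A).
Proof.
move=> [mA hA]; split; first exact: measurableC.
rewrite (_ : \1_(~` A) = (fun x => 1 + (-1) * \1_A x) :> (T -> R)).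
  by apply: multiplierD; [exact: multiplier_cst|exact: multiplierZ].
apply/funext => x; rewrite !indicE in_setC.
by case: (x \in A); rewrite /= ?mulr1 ?subrr ?mulr0 ?addr0.
Qed.

Lemma multiplier_setI A B : multiplier_set A -> multiplier_set B -> multiplier_set (A `&` B).
Proof.
move=> [mA hA] [mB hB]; split; first exact: measurableI.
by rewrite indicI; exact: multiplierM.
Qed.

(** The indicator of a countable intersection is the bounded pointwise limit of finite products of
    indicators. *)
Lemma multiplier_bigcap (A : (set T)^nat) : (forall n, multiplier_set (A n)) ->
  multiplier_set (\bigcap_n A n).
Proof.
move=> hA; split; first by apply: bigcapT_measurable => n; exact: (hA n).1.
have E n x : \prod_(i < n) (\1_(A i) x : R) = \1_(\bigcap_(i < n) A i) x.
  elim: n => [|n IH]; first by rewrite big_ord0 bigcap_mkord big_ord0 indicT.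
  have H : \bigcap_(i < n.+1) A i = (\bigcap_(i < n) A i) `&` A n.
    by rewrite !bigcap_mkord big_ord_recr.
  by rewrite big_ord_recr /= IH H indicI.
apply: (@multiplier_cvg (fun n x => \prod_(i < n) (\1_(A i) x : R)) _ 1).
- elim=> [|n IH]; first by under eq_fun do rewrite big_ord0; exact: multiplier_cst.
  under eq_fun do rewrite big_ord_recr /=.
  by apply: multiplierM => //; exact: (hA n).2.
- by move=> n x; rewrite E indicE normr_nat; case: (_ \in _).
- move=> x; have [xA|xA] := pselect ((\bigcap_n A n) x).
    rewrite (_ : (fun n => _) = fun=> 1).
      by rewrite indicE mem_set//; exact: cvg_cst.
    apply/funext => n; rewrite E indicE mem_set// => i _; exact: xA.
  rewrite indicE memNset//=.
  have /existsNP[k /not_implyP[_ kA]] := xA.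
  apply: (@cvg_near_cst _ _ _ _ _); exists k.+1 => // n /= kn.
  rewrite E indicE memNset// => /(_ k); apply: contra_not kA; exact.
Qed.

Lemma multiplier_sets_sigma_algebra : sigma_algebra setT multiplier_set.
Proof.
split.
- split => //; rewrite indic0; exact: multiplier_cst.
- by move=> A hA; rewrite setTD; exact: multiplier_setC.
- move=> A hA; rewrite -[\bigcup_k A k]setCK setC_bigcup.
  by apply: multiplier_setC; apply: multiplier_bigcap => n; exact: multiplier_setC.
Qed.

(** Since the constant 1 is among the [e j], multiplying [G] by an indicator shows that [G] has zero
    integral over every measurable set. *)
Lemma annihilates_ae0 (G : T -> R[i]) (j0 : J) : (forall x, e j0 x = 1) ->
  (forall A, measurable A -> multiplier_set A) -> annihilates G ->
  {ae mu, forall x, G x = 0}.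
Proof.
move=> ej0 hA aG.
have [/integrable_CP[iR iI] _] := aG.
have Z A : measurable A -> integral_C mu (fun x => (\1_A x)%:C * G x) = 0.
  move=> /hA[_ [_ _ /(_ _ aG)[_ /(_ j0) <-]]].
  by congr integral_C; apply/funext => x; rewrite ej0 mul1r.
have aux (g : T -> R) : mu.-integrable setT (EFin \o g) ->
    (forall A, measurable A -> \int[mu]_x (\1_A x * g x) = 0) ->
    {ae mu, forall x, g x = 0}.
  move=> ig g0.
  have : ae_eq mu setT (EFin \o g) (cst 0%E).
    apply: integral_ae_eq => // A _ mA; rewrite integral0.
    rewrite -[LHS]fineK; last first.
      by apply: integrable_fin_num => //; exact: integrableS ig.
    rewrite integral_mkcond; congr EFin; rewrite -[RHS](g0 A mA); congr fine.
    by apply: eq_integral => x _; rewrite epatch_indic /= muleC EFinM.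
  by apply: filterS => x /(_ I)[].
have := aux _ iR; have := aux _ iI => hI hR.
apply: filterS2 (hR _) (hI _) => [x a b|A mA|A mA]; first exact: complexP.
- have := congr1 (@complex.Re R) (Z A mA); rewrite /= => <-.
  by apply: eq_Rintegral => x _; rewrite ReM/= mul0r subr0.
- have := congr1 (@complex.Im R) (Z A mA); rewrite /= => <-.
  by apply: eq_Rintegral => x _; rewrite ImM/= mul0r addr0.
Qed.

End multipliers.

(** * Characters on the cube: totality and orthogonality *)

Section cube_characters.
Context {R : realType} {d : nat}.
Local Notation Rd := 'cV[R]_d.
Local Notation Zd := 'cV[int]_d.

Definition chi (k : Zd) (x : Rd) : R[i] := expi2pi (dotmul (iota_Z k) x).

Lemma measurable_chi k : measurable_fun_C (chi k).
Proof. by apply: measurable_expi2pi; apply: measurable_dotmul. Qed.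

Lemma normc_chi k x : normc (chi k x) = 1.
Proof. exact: normc_expi2pi. Qed.

Lemma sqn_chi k x : sqn (chi k x) = 1.
Proof. exact: sqn_expi2pi. Qed.

Lemma chiD k l x : chi (k + l) x = chi k x * chi l x.
Proof. by rewrite /chi iota_ZD dotmulDl expi2piD. Qed.

Lemma chiN k x : chi (- k) x = (chi k x)^*.
Proof. by rewrite /chi iota_ZN dotmulNl expi2piN. Qed.

Lemma chi0 x : chi 0 x = 1.
Proof. by rewrite /chi iota_Z0 dotmul0l expi2pi0. Qed.

Lemma chi_shift k x l : chi k (x + iota_Z l) = chi k x.
Proof. by rewrite /chi dotmulDr expi2piD expi2pi_iota mulr1. Qed.

Lemma torus_char_chi k x : torus_char k (hat_iota x) = chi k x.
Proof. exact: torus_charE. Qed.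

Local Notation mult := (multiplier (@cube R d) chi).
Local Notation mset := (multiplier_set (@cube R d) chi).

Let chi1 k x : normc (chi k x) <= 1.
Proof. by rewrite normc_chi. Qed.

Definition unit_Z (i : 'I_d) : Zd := delta_mx i 0.

Lemma dotmul_unit_Z i (x : Rd) : dotmul (iota_Z (unit_Z i)) x = x i 0.
Proof.
rewrite /dotmul (bigD1 i)//= !mxE !eqxx mul1r big1 ?addr0// => j ji.
by rewrite !mxE (negbTE ji) mul0r.
Qed.

(** Multiplication by [u] turns a character into a combination of two characters, and all of them
    annihilate [G]. *)
Lemma multiplier_chi (u : Rd -> R) (k : Zd) (a b : R[i]) : measurable_fun setT u ->
  (forall x, `|u x| <= 1) -> (forall x, (u x)%:C = a * chi k x + b * chi (- k) x) ->
  mult u.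
Proof.
move=> mu_ u1 E; split => //; first by exists 1.
move=> G [iG G0]; split.
  apply: (@integrable_CMb _ _ _ _ _ _ 1) => //.
  by move=> x; rewrite normcE sqnC sqrtr_sqr.
move=> l.
rewrite (_ : (fun x => _) = (fun x => a * (chi (l + k) x * G x) + b * (chi (l - k) x * G x))).
  have i j : integrable_C cube (fun x => chi j x * G x).
    by apply: (integrable_e measurable_chi chi1).
  rewrite integral_CD ?integral_CZ//; try exact: integrable_CZ.
  by rewrite !G0 !mulr0 addr0.
by apply/funext => x; rewrite E !chiD; ring.
Qed.

Lemma multiplier_cos i : mult (fun x : Rd => cos (2 * pi * x i 0)).
Proof.
apply: (@multiplier_chi _ (unit_Z i) (2^-1)%:C (2^-1)%:C).
- apply: (measurableT_comp (continuous_measurable_fun (@continuous_cos R))).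
  by apply: measurable_funM => //; exact: measurable_coord.
- by move=> x; exact: cos_max.
- by move=> x; rewrite chiN /chi dotmul_unit_Z; apply: complexP; rewrite !ReImE /=; field.
Qed.

Lemma multiplier_sin i : mult (fun x : Rd => sin (2 * pi * x i 0)).
(* The coefficients are those of Euler's formula: 1/(2i) = -i/2 and its conjugate. *)
Proof.
apply: (@multiplier_chi _ (unit_Z i) (0 -i* 2^-1) (0 +i* 2^-1)).
- apply: (measurableT_comp (continuous_measurable_fun (@continuous_sin R))).
  by apply: measurable_funM => //; exact: measurable_coord.
- by move=> x; exact: sin_max.
- by move=> x; rewrite chiN /chi dotmul_unit_Z; apply: complexP; rewrite !ReImE /=; field.
Qed.

Lemma ae_cube (P : Rd -> Prop) : (forall x, unit_cube x -> P x) -> {ae @cube R d, forall x, P x}.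
Proof.
move=> H; exists (~` (@unit_cube R d)); split.
- by apply: measurableC; exact: (@measurable_unit_cube R d).
- by rewrite /cube /= /mrestr setICl measure0.
- by move=> x /= nP Qx; apply: nP; exact: H.
Qed.

(** The complement of the unit cube is null for [cube], so only the trace of a set matters; in this
    way periodic functions reach sets that are not periodic. *)
Lemma multiplier_set_cube A B : mset A -> measurable B ->
  (forall x, unit_cube x -> A x <-> B x) -> mset B.
Proof.
move=> [mA [_ _ hA]] mB AB; split => //; split => //.
  by exists 1 => x; rewrite indicE normr_nat; case: (_ \in _).
move=> G aG; apply: (annihilates_eq measurable_chi chi1 _ (hA _ aG)).
  by apply: measurable_C_indic => //; exact: aG.1.1.
apply: ae_cube => x Qx; congr (_ * _); rewrite !indicE.
have [Ax|Ax] := pselect (A x); first by rewrite !mem_set//; apply/AB.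
by rewrite !memNset// => /(AB _ Qx).
Qed.

Lemma mset_pos u : mult u -> mset [set x | 0 < u x].
Proof.
move=> hu; split; last exact: multiplier_pos measurable_chi chi1 _ hu.
have [mu_ _ _] := hu; rewrite -[X in measurable X]setTI.
have := mu_ measurableT _ (measurable_itv `]0, +oo[).
by congr (measurable (_ `&` _)); apply/seteqP; split => x /=; rewrite in_itv /= andbT.
Qed.

(* On [0, 1), the sign of sin (2 pi x) tells the two halves of the interval
   apart, and cos (2 pi x) is monotone on each of them. *)
Lemma mset_slab i (b : R) : mset [set x | b < x i 0].
Proof.
have mB : measurable [set x : Rd | b < x i 0].
  rewrite -[X in measurable X]setTI.
  have := @measurable_coord R d i measurableT _ (measurable_itv `]b, +oo[).
  by congr (measurable (_ `&` _)); apply/seteqP; split => x /=; rewrite in_itv /= andbT.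
have hcst r : mult (fun=> r) := multiplier_cst (@cube R d) measurable_chi chi1 r.
have hN u : mult u -> mult (fun x => - u x).
  by move=> hu; under eq_fun do rewrite -mulN1r; exact: multiplierZ measurable_chi chi1 _ _ hu.
have hD u v := @multiplierD _ _ _ _ _ _ measurable_chi chi1 u v.
have hcos := multiplier_cos i; have hsin := multiplier_sin i.
have hC := @multiplier_setC _ _ _ _ _ _ measurable_chi chi1.
have hI := @multiplier_setI _ _ _ _ (@cube R d) chi.
have pi0 := @pi_gt0 R.
have [b0|b0] := ltP b 0.
  apply: (@multiplier_set_cube setT) => //.
    by split => //; rewrite indicT; exact: hcst.
  by move=> x /(_ i)/andP[x0 _]; split => // _ /=; exact: lt_le_trans x0.
have [b1|b1] := leP 1 b.
  apply: (@multiplier_set_cube set0) => //.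
    by split => //; rewrite indic0; exact: hcst.
  by move=> x /(_ i)/andP[_ x1]; split => //= bx; have := lt_trans x1 (le_lt_trans b1 bx); rewrite ltxx.
pose C := [set x : Rd | 0 < cos (2 * pi * x i 0) - cos (2 * pi * b)].
pose C' := [set x : Rd | 0 < cos (2 * pi * b) - cos (2 * pi * x i 0)].
pose S := [set x : Rd | 0 < - sin (2 * pi * x i 0)].
have mC : mset C by apply: mset_pos; apply: hD => //; exact: hcst.
have mC' : mset C' by apply: mset_pos; apply: hD; [exact: hcst|exact: hN].
have mS : mset S by apply: mset_pos; exact: hN.
have cosrefl (y : R) : cos (2 * pi * y) = cos (2 * pi * (1 - y)).
  have -> : 2 * pi * (1 - y) = - (2 * pi * y) + pi *+ 2 by rewrite mulr2n; ring.
  by rewrite cosD2pi cosN.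
have sin_low (y : R) : 0 <= y <= 2^-1 -> 0 <= sin (2 * pi * y).
  move=> /andP[y0 y1]; apply: sin_ge0_pi; rewrite !mulr_ge0 ?(ltW pi0)//=.
  by nra.
have sin_high (y : R) : 2^-1 < y < 1 -> sin (2 * pi * y) < 0.
  move=> /andP[y0 y1]; rewrite -[_ * y](subrK pi) sinDpi oppr_lt0.
  by apply: sin_gt0_pi; apply/andP; split; nra.
have cosm (y z : R) : 0 <= y <= 2^-1 -> 0 <= z <= 2^-1 ->
    (cos (2 * pi * y) < cos (2 * pi * z)) = (z < y).
  move=> /andP[y0 y1] /andP[z0 z1]; rewrite ltr_cos ?ltr_pM2l ?mulr_gt0//.
    by rewrite in_itv /=; apply/andP; split; nra.
  by rewrite in_itv /=; apply/andP; split; nra.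
(* Within the cube the slab is the union of [S] and [C'] when [b] lies in the first half, and the
   intersection of [S] and [C] otherwise. The union is written with complements and an intersection,
   the operations already established. *)
have [bh|bh] := ltP b 2^-1.
  apply: (@multiplier_set_cube (~` (~` S `&` ~` C'))) => //.
    by apply: (hC); apply: hI; exact: hC.
  move=> x /(_ i)/andP[x0 x1]; rewrite setCI !setCK /S /C' /=.
  have [xh|xh] := leP (x i 0) 2^-1.
    have s := sin_low (x i 0); rewrite x0 xh in s.
    rewrite subr_gt0 cosm ?x0 ?xh ?b0 ?(ltW bh)//.
    split; last by right.
    by case=> //; rewrite oppr_gt0 ltNge s.
  split=> [_|_]; first exact: lt_trans xh.
  by left; rewrite oppr_gt0 sin_high// xh.
apply: (@multiplier_set_cube (S `&` C)) => //; first exact: hI.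
move=> x /(_ i)/andP[x0 x1]; rewrite /S /C /=.
have [xh|xh] := leP (x i 0) 2^-1.
  have s := sin_low (x i 0); rewrite x0 xh in s.
  split; first by case; rewrite oppr_gt0 ltNge s.
  by move=> bx; have := le_lt_trans bh bx; rewrite ltNge xh.
rewrite oppr_gt0 sin_high ?xh// subr_gt0 (cosrefl b) (cosrefl (x i 0)).
rewrite cosm; [|by apply/andP; split; lra|by apply/andP; split; lra].
by rewrite ltrD2l ltrN2; split => [[]|].
Qed.

(** Minimality is used twice: the coordinates generate the sigma-algebra of R^d, and open rays that
    of the line. The preimages of rays are the slabs. *)
Lemma mset_measurable A : measurable A -> mset A.
Proof.
have sa := multiplier_sets_sigma_algebra (@cube R d) measurable_chi chi1.
move=> mA; have : g_sigma_preimage (fun (i : 'I_d) (x : Rd) => x i 0 : measurableTypeR R) A by [].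
apply: smallest_sub => //.
rewrite -bigcup_seq; apply: bigcup_sub => i _ _ [Y mY <-]; rewrite setTI.
move: mY; rewrite RGenOInfty.measurableE.
have [s0 sC sU] := sa.
apply: (@smallest_sub _ _ _ [set Y | mset ((fun x : Rd => x i 0) @^-1` Y)]).
  split => /=.
  - by rewrite preimage_set0.
  - by move=> Z hZ; rewrite setTD preimage_setC -setTD; exact: sC.
  - by move=> F hF; rewrite preimage_bigcup; exact: sU.
move=> _ [b ->] /=; rewrite preimage_itvoy.
exact: mset_slab.
Qed.

Lemma cube_uniqueness (G : Rd -> R[i]) : integrable_C cube G ->
  (forall k, integral_C cube (fun x => chi k x * G x) = 0) ->
  {ae cube, forall x, G x = 0}.
Proof.
move=> iG G0; apply: (@annihilates_ae0 _ _ _ _ (@cube R d) chi G 0) => //.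
- by move=> x; rewrite chi0.
- by move=> A; exact: mset_measurable.
Qed.

(** The translated cube is again a fundamental domain: every point has exactly one lattice translate
    in it, so tiling gives back the integral over the cube. *)
Lemma ge0_integral_cube_shift (h : Rd -> \bar R) (t : Rd) : measurable_fun setT h ->
  (forall x, 0 <= h x)%E -> (forall x k, h (x + iota_Z k) = h x) ->
  (\int[cube]_x h (x + t)%R = \int[cube]_x h x)%E.
Proof.
move=> mh h0 hk.
have mind : measurable_fun setT (fun x : Rd => (\1_unit_cube x)%:E : \bar R).
  by apply/measurable_EFinP; apply: measurable_indic; exact: measurable_unit_cube.
pose F x := ((\1_unit_cube (x - t)%R)%:E * h x)%E.
have mF : measurable_fun setT F.
  by apply: emeasurable_funM => //; exact: (measurable_shift (- t) mind).
have F0 x : (0 <= F x)%E by rewrite mule_ge0// lee_fin.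
rewrite ge0_integral_cube//; last exact: measurable_shift.
transitivity (\int[leb d]_x F (x + t)%R)%E.
  by apply: eq_integral => x _; rewrite /F addrK.
rewrite ge0_integral_shift// ge0_integral_tiling//.
apply: eq_integral => x _.
have E k : unit_cube (x + iota_Z k - t) <-> k = - intpart (x - t).
  rewrite (_ : x + iota_Z k - t = (x - t) - iota_Z (- k)); last first.
    by rewrite iota_ZN opprK addrAC.
  split=> [/intpart_uniq <-|->]; first by rewrite opprK.
  by rewrite opprK; exact: unit_cube_intpart.
rewrite (@esum_single _ _ _ (- intpart (x - t)))//.
  by rewrite /F hk indicE mem_set ?mul1e//; apply/E.
by move=> k kx; rewrite /F indicE memNset ?mul0e// => /E kE; rewrite kE eqxx in kx.
Qed.

Lemma integrable_cube_cst (M : R) : cube.-integrable [set: Rd] (EFin \o (fun=> M)).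
Proof.
apply/integrableP; split; first by apply/measurable_EFinP.
by rewrite integral_cst// cubeT mule1 ltry.
Qed.

Lemma integrable_cube_bounded (f : Rd -> R[i]) (M : R) : measurable_fun_C f ->
  (forall x, normc (f x) <= M) -> integrable_C cube f.
Proof.
move=> mf fM; apply: (@integrable_C_le _ _ _ _ _ (fun=> M)) => //.
exact: integrable_cube_cst.
Qed.

(* Some translation changes the sign of [chi k] when [k != 0]. *)
Lemma integral_chi (k : Zd) : integral_C cube (chi k) = (k == 0)%:R.
Proof.
have [->|k0] := eqVneq k 0.
  rewrite (_ : chi 0 = fun=> 1%:C); last by apply/funext => x; rewrite chi0.
  rewrite integral_C_real Rintegral_cst// cubeT /= mulr1.
  by [].
have [i ki] : exists i, k i 0 != 0.
  apply/existsP; rewrite -negb_forall; apply: contra_neqN k0 => /forallP H.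
  by apply/colP => i; rewrite mxE; apply/eqP; exact: H.
(* Chosen so that its scalar product with [k] is one half, at which [expi2pi] is -1. *)
pose t : Rd := (2 * (k i 0)%:~R)^-1 *: iota_Z (unit_Z i).
have kt : dotmul (iota_Z k) t = 2^-1.
  by rewrite /t dotmulZr dotmulC dotmul_unit_Z mxE invfM -mulrA mulVf ?mulr1// intr_eq0.
have chit x : chi k (x + t) = - chi k x.
  by rewrite /chi dotmulDr kt expi2piD expi2pi_half mulrN1.
have ichi : integrable_C cube (chi k).
  by apply: (@integrable_cube_bounded _ 1) => //; exact: measurable_chi.
have aux (re : R[i] -> R) : (forall z, `|re z| <= normc z) ->
    (forall z, re (- z) = - re z) -> measurable_fun setT (fun x => re (chi k x)) ->
    cube.-integrable setT (EFin \o (fun x => re (chi k x))) ->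
    \int[cube]_x re (chi k x) = 0.
  move=> le reN m i_.
  (* Adding 1 makes the function nonnegative; translation by [t] changes the sign of the other term,
     which must then have zero integral. *)
  have := @ge0_integral_cube_shift (fun x => (1 + re (chi k x))%:E) t.
  have i1 := @integrable_cube_cst 1.
  move=> /(_ _ _ _)/(congr1 fine).
  under [in X in X -> _]eq_integral do rewrite chit reN.
  rewrite -![fine _]/(Rintegral _ _ _) RintegralB// RintegralD//.
  move=> H; have : \int[@cube R d]_x (1 : R) - \int[cube]_x re (chi k x) =
     \int[@cube R d]_x (1 : R) + \int[cube]_x re (chi k x).
    apply: H.
    - by apply/measurable_EFinP; exact: measurable_funD.
    - move=> x; rewrite lee_fin; have := le_trans (le (chi k x)) (chi1 k x).
      by rewrite ler_norml => /andP[h _]; lra.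
    - by move=> x l; rewrite chi_shift.
  by lra.
have [iR iI] := (integrable_CP _ _).1 ichi; have [mR mI] := measurable_chi k.
apply: complexP.
  exact: (aux (@complex.Re R) (@Re_normc R) (@ReN R) mR iR).
exact: (aux (@complex.Im R) (@Im_normc R) (@ImN R) mI iI).
Qed.

End cube_characters.

(** * Parseval's identity for a total orthogonal sequence *)

Section parseval.
Context {R : realType} disp (T : measurableType disp).
Variables (mu : {measure set T -> \bar R}) (e : nat -> T -> R[i]).
Hypothesis he : forall n, L2c mu (e n).
Hypothesis e_orth : forall m n, m != n -> ip mu (e m) (e n) = 0.
(** Zero members are allowed because the enumeration of the characters is padded with zeros. *)
Hypothesis e_norm : forall n, ip mu (e n) (e n) = 1 \/ forall x, e n x = 0.
Hypothesis e_total : forall r, L2c mu r -> (forall n, ip mu (e n) r = 0) ->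
  {ae mu, forall x, r x = 0}.

Variables (f : T -> R[i]) (hf : L2c mu f).

Let c n := ip mu (e n) f.

(** The residual of the orthogonal projection of [f] onto the span of the first [n] vectors. *)
Fixpoint remainder n : T -> R[i] :=
  if n is n'.+1 then fun x => remainder n' x - c n' * e n' x else f.

Let hr n : L2c mu (remainder n).
Proof. by elim: n => [|n IH] //=; apply: L2cB => //; exact: L2cZ. Qed.

Let c_norm n : c n * ip mu (e n) (e n) = c n.
Proof.
have [->|e0] := e_norm n; first by rewrite mulr1.
have -> : c n = 0; last by rewrite mul0r.
rewrite /c /ip (_ : (fun x => _) = fun=> 0) ?integral_C0//.
by apply/funext => x; rewrite e0 rmorph0 mul0r.
Qed.

Let ip_remainder k n : ip mu (e k) (remainder n) = if (k < n)%N then 0 else c k.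
Proof.
elim: n => [|n IH] //=.
rewrite ipBr//; last exact: L2cZ.
rewrite ipZr// IH [in RHS]ltnS [in RHS]leq_eqVlt; have [->|kn] := eqVneq k n.
  by rewrite ltnn c_norm subrr.
by rewrite e_orth// mulr0 subr0.
Qed.

Let n2_remainder N : n2 mu (remainder N) = n2 mu f - \sum_(0 <= n < N) sqn (c n).
Proof.
elim: N => [|N IH]; first by rewrite big_nil subr0.
rewrite big_nat_recr//= n2B//; last exact: L2cZ.
rewrite n2Z// ipZr// (ipC (he N) (hr N)) ip_remainder ltnn.
have -> : sqn (c N) * n2 mu (e N) = sqn (c N).
  apply: complexI; rewrite rmorphM/= -ipff -mulJ_sqn -mulrA; congr (_ * _).
  exact: c_norm.
rewrite (_ : Re _ = sqn (c N)); last by rewrite !ReImE /sqn; ring.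
by rewrite IH; ring.
Qed.

(** The difference [f - remainder n] is a combination of the first [n] vectors, all orthogonal to
    the later residuals. *)
Let remainder_orth n m : (n <= m)%N ->
  ip mu (remainder m) (fun x => f x - remainder n x) = 0.
Proof.
elim: n => [_|n IH nm].
  rewrite (_ : (fun x => _) = fun x => 0 * f x); first by rewrite ipZr// mul0r.
  by apply/funext => x; rewrite subrr mul0r.
rewrite (_ : (fun x => _) = (fun x => (f x - remainder n x) + c n * e n x)); last first.
  by apply/funext => x /=; ring.
rewrite ipDr//; [|exact: L2cB|exact: L2cZ].
rewrite IH ?(ltnW nm)// ipZr// (ipC (he n) (hr m)) ip_remainder nm.
by rewrite rmorph0 mulr0 addr0.
Qed.

Let n2_remainderB n m : (n <= m)%N ->
  n2 mu (fun x => remainder n x - remainder m x) = n2 mu (remainder n) - n2 mu (remainder m).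
Proof.
move=> nm; have hd : L2c mu (fun x => remainder n x - remainder m x) by exact: L2cB.
have := n2D (hr m) hd.
rewrite (_ : (fun x => _ + _) = remainder n); last first.
  by apply/funext => x; rewrite addrC subrK.
rewrite (_ : ip mu (remainder m) _ = 0).
  by move=> ->; rewrite /= mulr0 addr0 addrAC subrr add0r.
rewrite (_ : (fun x => _) =
  (fun x => (f x - remainder m x) - (f x - remainder n x))); last first.
  by apply/funext => x; ring.
by rewrite ipBr ?remainder_orth ?subrr//; exact: L2cB.
Qed.

(** The squared norms of the residuals decrease, so by Pythagoras the residuals form a Cauchy
    sequence. Their limit is orthogonal to every [e n], hence zero by totality, and the identity
    [n2_remainder] passes to the limit. *)
Lemma parseval_seq : (fun N => \sum_(0 <= n < N) sqn (c n)) @ \oo --> n2 mu f.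
Proof.
pose a n := n2 mu (remainder n).
have a_dec : {homo a : n m / (n <= m)%N >-> m <= n}.
  by move=> n m nm; rewrite -subr_ge0 -n2_remainderB// n2_ge0.
have ca : cvgn a.
  apply: nonincreasing_is_cvgn => //; exists 0 => _ [n _ <-]; exact: n2_ge0.
have [|eps e0|r hr_ cr] := @riesz_fischer _ _ _ mu remainder.
- exact: hr.
- have e20 : 0 < eps / 2 by rewrite divr_gt0.
  have [N _ HN] : \forall n \near \oo, `|limn a - a n| <= eps / 2.
    have /cvgrPdist_le/(_ _ e20) : a @ \oo --> limn a by exact: ca.
    exact.
  exists N => n m Nn Nm.
  rewrite N2_fin; last exact: L2cB.
  have := HN n Nn; have := HN m Nm; rewrite !ler_norml => /andP[? ?] /andP[? ?].
  rewrite lee_fin.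
  have aE k : n2 mu (remainder k) = a k by [].
  case/orP: (leq_total n m) => nm; first by rewrite n2_remainderB// !aE; lra.
  by rewrite /n2 N2BC -/(n2 _ _) n2_remainderB// !aE; lra.
have r0 n : ip mu (e n) r = 0.
  have cn := ip_cvgr hr hr_ (he n) cr.
  apply: (cvgC_unique cn).
  by split; apply: cvg_near_cst; exists n.+1 => // m nm;
    rewrite /mkset ip_remainder (nm : (n < m)%N).
have nr : n2 mu r = 0.
  rewrite /n2 (ae_eq_N2 hr_.1 (measurable_Ccst _ 0) (e_total hr_ r0)).
  by rewrite N20.
have := n2_cvg hr hr_ cr; rewrite nr => c0.
rewrite (_ : (fun N => _) = (fun N => n2 mu f - n2 mu (remainder N))); last first.
  by apply/funext => N; rewrite n2_remainder; ring.
by rewrite -[X in _ --> X]subr0; apply: cvgB => //; exact: cvg_cst.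
Qed.

End parseval.

Section cube_parseval.
Context {R : realType} {d : nat}.
Local Notation Rd := 'cV[R]_d.
Local Notation Zd := 'cV[int]_d.

Lemma L2c_cube_integrable (f : Rd -> R[i]) : L2c cube f -> integrable_C cube f.
Proof.
move=> hf; have h1 : L2c cube (fun _ : Rd => 1 : R[i]).
  split; first exact: measurable_Ccst.
  rewrite /N2 (_ : (fun x => _) = cst (sqn (1 : R[i]))%:E)//.
  by rewrite integral_cst// cubeT mule1 ltry.
have := L2c_mulJ h1 hf; rewrite (_ : (fun x => _) = f)//.
by apply/funext => x; rewrite rmorph1 mul1r.
Qed.

Lemma L2c_chi (k : Zd) : L2c cube (@chi R d k).
Proof.
split; first exact: measurable_chi.
rewrite /N2 (_ : (fun x => _) = cst 1%E); first by rewrite integral_cst// cubeT mule1 ltry.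
by apply/funext => x; rewrite sqn_chi.
Qed.

Lemma ip_chi (k l : Zd) : ip cube (chi k) (chi l) = (k == l)%:R :> R[i].
Proof.
rewrite /ip (_ : (fun x => _) = chi (l - k)); last first.
  by apply/funext => x; rewrite chiD chiN mulrC.
by rewrite integral_chi subr_eq0 eq_sym.
Qed.

Lemma cube_parseval (f : Rd -> R[i]) : L2c cube f ->
  esum setT (fun k : Zd => (sqn (integral_C cube (fun x => chi k x * f x)))%:E) =
  N2 cube f.
Proof.
move=> hf.
pose e n (x : Rd) : R[i] := enum_term (chi^~ x) n.
have eE n : (exists k, @pickle_inv Zd n = Some k /\ e n = chi k) \/
    (@pickle_inv Zd n = None /\ e n = fun=> 0).
  rewrite /e /enum_term; case: pickle_inv => [k|] /=; [left|right] => //.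
  by exists k.
have he n : L2c cube (e n).
  by have [[k [_ ->]]|[_ ->]] := eE n; [exact: L2c_chi|exact: L2c0].
have ip0 (g : Rd -> R[i]) : ip cube (fun=> 0) g = 0.
  rewrite /ip (_ : (fun x => _) = fun=> 0) ?integral_C0//.
  by apply/funext => x; rewrite rmorph0 mul0r.
have pick_inj m n k : @pickle_inv Zd m = Some k -> @pickle_inv Zd n = Some k -> m = n.
  move=> Em En; have := @pickle_invK Zd m; have := @pickle_invK Zd n.
  by rewrite Em En /= => <- <-.
have orth m n : m != n -> ip cube (e m) (e n) = 0.
  move=> mn; have [[k [km ->]]|[_ ->]] := eE m; last exact: ip0.
  have [[l [ln ->]]|[_ ->]] := eE n.
    rewrite ip_chi; case: eqP => // kl; rewrite kl in km.
    by rewrite (pick_inj _ _ _ km ln) eqxx in mn.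
  rewrite (_ : (fun=> 0) = fun x => 0 * chi k x).
    by rewrite ipZr ?mul0r//; exact: L2c_chi.
  by apply/funext => x; rewrite mul0r.
have norm n : ip cube (e n) (e n) = 1 \/ forall x, e n x = 0.
  have [[k [_ ->]]|[_ ->]] := eE n; [left|by right].
  by rewrite ip_chi eqxx.
have ipE (g : Rd -> R[i]) k : ip cube (chi k) g = integral_C cube (fun x => chi (- k) x * g x).
  by rewrite /ip; congr integral_C; apply/funext => x; rewrite chiN.
have total r : L2c cube r -> (forall n, ip cube (e n) r = 0) -> {ae cube, forall x, r x = 0}.
  move=> hr r0; apply: cube_uniqueness; first exact: L2c_cube_integrable.
  move=> k; have := r0 (pickle (- k)); rewrite /e /enum_term pickleK_inv /=.
  by rewrite ipE opprK.
have P := parseval_seq he orth norm total hf.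
rewrite N2_fin//.
have -> : esum setT (fun k : Zd => (sqn (integral_C cube (fun x => chi k x * f x)))%:E) =
    esum setT (fun k : Zd => (sqn (ip cube (chi k) f))%:E).
  (* [ip] conjugates its first argument, so the two families of coefficients correspond under
     negation of the index. *)
  rewrite (@reindex_esum R Zd Zd setT setT -%R).
    by apply: eq_esum => k _; rewrite ipE.
  split; [by []|by move=> x y _ _; exact: oppr_inj|].
  by move=> k _; exists (- k); rewrite ?opprK.
rewrite esum_enum_term; last by move=> k; rewrite lee_fin sqn_ge0.
apply/cvg_lim => //.
have : (fun N => (\sum_(0 <= n < N) sqn (ip cube (e n) f))%:E) @ \oo --> (n2 cube f)%:E.
  by apply/fine_cvgP; split; [exact: nearW|exact: P].
rewrite (_ : (fun N => (\sum_(0 <= n < N) sqn (ip cube (e n) f))%:E) =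
  (fun N => \sum_(0 <= n < N) oapp (fun k : Zd => (sqn (ip cube (chi k) f))%:E) 0 (pickle_inv n))%E)//.
apply/funext => N; rewrite -sumEFin; apply: eq_bigr => n _.
have [[k [-> ->]]|[-> ->]] := eE n => //=.
by rewrite ip0 sqn0.
Qed.

End cube_parseval.

(** * The Fourier transform on L^2(R^d) *)

Section parametric_integral.
Context {R : realType} d1 d2 (T1 : measurableType d1) (T2 : measurableType d2).
Variable m2 : {sigma_finite_measure set T2 -> \bar R}.

(** Tonelli's theorem makes the integrals of the positive and negative parts measurable in the
    parameter, and [fine] of their difference is the integral at every point, defaults included. *)
Lemma measurable_param_Rintegral (G : T1 * T2 -> R) : measurable_fun setT G ->
  measurable_fun setT (fun x => \int[m2]_y G (x, y)).
Proof.
move=> mG; rewrite /Rintegral.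
apply: (measurableT_comp (fine_measurable measurableT)).
have part (H : T1 * T2 -> \bar R) : measurable_fun setT H -> (forall z, 0 <= H z)%E ->
    measurable_fun setT (fun x => \int[m2]_y H (x, y))%E.
  by move=> mH H0; exact: (@measurable_fun_fubini_tonelli_F _ _ _ _ _ m2 H).
rewrite (_ : (fun x => _) = (fun x => \int[m2]_y (EFin \o G)^\+ (x, y) -
    \int[m2]_y (EFin \o G)^\- (x, y))%E).
  apply: emeasurable_funB; apply: part => //.
    by apply: measurable_funepos; exact/measurable_EFinP.
  by apply: measurable_funeneg; exact/measurable_EFinP.
apply/funext => x; rewrite integralE.
congr (_ - _)%E; apply: eq_integral => y _.
  by rewrite !funeposE.
by rewrite !funenegE.
Qed.

Lemma measurable_param_integral_C (G : T1 -> T2 -> R[i]) :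
  measurable_fun_C (fun z : T1 * T2 => G z.1 z.2) ->
  measurable_fun_C (fun x => integral_C m2 (G x)).
Proof.
move=> [mR mI]; split.
- exact: (measurable_param_Rintegral mR).
- exact: (measurable_param_Rintegral mI).
Qed.

End parametric_integral.

Section complex_change_of_variables.
Context {R : realType} disp (T : measurableType disp) disp' (T' : measurableType disp').
Variables (mu : {measure set T -> \bar R}) (nu : {measure set T' -> \bar R}).
Variables (phi : T -> T') (c : R).
Hypotheses (mphi : measurable_fun setT phi) (c0 : 0 < c).
(** One identity for nonnegative functions, to be instantiated by dilations, translations, the
    reflection and the projection of the cube onto the torus. *)
Hypothesis H : forall F : T' -> \bar R, measurable_fun setT F -> (forall x, 0 <= F x)%E ->
  (\int[nu]_x F x = c%:E * \int[mu]_x F (phi x))%E.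

Lemma N2_change (h : T' -> R[i]) : measurable_fun_C h ->
  N2 nu h = (c%:E * N2 mu (h \o phi))%E.
Proof.
move=> mh; rewrite /N2 (H (measurable_EFin_sqn mh))// => x.
by rewrite lee_fin sqn_ge0.
Qed.

Lemma change_fin (x : \bar R) : (0 <= x)%E -> (c%:E * x < +oo)%E -> (x < +oo)%E.
Proof.
case: x => [r _ _|_|//]; first exact: ltry.
by rewrite gt0_muley ?lte_fin.
Qed.

Lemma integrable_C_change (h : T' -> R[i]) : integrable_C nu h ->
  integrable_C mu (h \o phi).
Proof.
move=> [mh ih]; split; first exact: measurable_C_comp.
apply: change_fin; first by apply: integral_ge0 => x _; rewrite lee_fin normc_ge0.
rewrite -(H (F := fun x => (normc (h x))%:E))//.
  exact: measurable_EFin_normc.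
by move=> x; rewrite lee_fin normc_ge0.
Qed.

Lemma integrable_C_change_inv (h : T' -> R[i]) : measurable_fun_C h ->
  integrable_C mu (h \o phi) -> integrable_C nu h.
Proof.
move=> mh [_ ih]; split => //; rewrite H.
- by rewrite lte_mul_pinfty// lee_fin ltW.
- exact: measurable_EFin_normc.
- by move=> x; rewrite lee_fin normc_ge0.
Qed.

Lemma Rintegral_change (g : T' -> R) : nu.-integrable setT (EFin \o g) ->
  mu.-integrable setT (EFin \o (g \o phi)) ->
  \int[nu]_x g x = c * \int[mu]_x g (phi x).
Proof.
move=> ig igp; have mg := measurable_int _ ig.
rewrite /Rintegral integralE !H//; [|exact: measurable_funeneg|exact: measurable_funepos].
have E : (\int[mu]_x (EFin \o g)^\+ (phi x) - \int[mu]_x (EFin \o g)^\- (phi x) =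
    \int[mu]_x (EFin \o (g \o phi)) x)%E.
  by rewrite [RHS]integralE; congr (_ - _)%E; apply: eq_integral => x _;
    rewrite ?funeposE ?funenegE.
rewrite -muleBr//; last first.
  rewrite (_ : (\int[mu]_x (EFin \o g)^\+ (phi x) = \int[mu]_x (EFin \o (g \o phi))^\+ x)%E); last first.
    by apply: eq_integral => x _; rewrite !funeposE.
  by rewrite fin_num_adde_defr// integrable_pos_fin_num.
by rewrite E fineM// integrable_fin_num.
Qed.

Lemma integral_C_change (h : T' -> R[i]) : integrable_C nu h ->
  integral_C nu h = c%:C * integral_C mu (h \o phi).
Proof.
move=> ih; have ihp := integrable_C_change ih.
have [a b] := (integrable_CP _ _).1 ih; have [a' b'] := (integrable_CP _ _).1 ihp.
apply: complexP; rewrite !ReImE /= ?mul0r ?subr0 ?addr0.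
  exact: (Rintegral_change a a').
exact: (Rintegral_change b b').
Qed.

End complex_change_of_variables.

Section cube_leb.
Context {R : realType} {d : nat}.
Local Notation Rd := 'cV[R]_d.

Lemma ge0_integral_cube_supported (F : Rd -> \bar R) : measurable_fun setT F ->
  (forall x, 0 <= F x)%E -> (forall x, ~ unit_cube x -> F x = 0%E) ->
  (\int[cube]_x F x = \int[leb d]_x F x)%E.
Proof.
move=> mF F0 Fs; rewrite ge0_integral_cube//; apply: eq_integral => x _.
have [Qx|nQx] := pselect (unit_cube x); first by rewrite indicE mem_set// mul1e.
by rewrite Fs// mule0.
Qed.

Lemma N2_cube_supported (f : Rd -> R[i]) : measurable_fun_C f ->
  (forall x, ~ unit_cube x -> f x = 0) -> N2 cube f = N2 (leb d) f.
Proof.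
move=> mf fs; apply: ge0_integral_cube_supported.
- exact: measurable_EFin_sqn.
- by move=> x; rewrite lee_fin sqn_ge0.
- by move=> x /fs ->; rewrite sqn0.
Qed.

Lemma integrable_cube_supported (f : Rd -> R[i]) :
  (forall x, ~ unit_cube x -> f x = 0) ->
  integrable_C cube f <-> integrable_C (leb d) f.
Proof.
move=> fs; rewrite /integrable_C; split=> -[mf i]; split => //;
(have E : (\int[cube]_x (normc (f x))%:E = \int[leb d]_x (normc (f x))%:E)%E;
  [apply: ge0_integral_cube_supported;
    [exact: measurable_EFin_normc
    |by move=> x; rewrite lee_fin normc_ge0
    |by move=> x /fs ->; rewrite Normc.normc0]
  |]); by rewrite ?E// -E.
Qed.

Lemma integral_C_cube_supported (f : Rd -> R[i]) : measurable_fun_C f ->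
  (forall x, ~ unit_cube x -> f x = 0) -> integral_C cube f = integral_C (leb d) f.
Proof.
move=> [mR mI] fs.
have aux (g : Rd -> R) : measurable_fun setT g -> (forall x, ~ unit_cube x -> g x = 0) ->
    \int[cube]_x g x = \int[leb d]_x g x.
  move=> mg gs; rewrite /Rintegral integralE [in RHS]integralE; congr (fine (_ - _)%E).
    apply: ge0_integral_cube_supported => //.
      by apply: measurable_funepos; exact/measurable_EFinP.
    by move=> x /gs gx; rewrite funeposE /= gx maxxx.
  apply: ge0_integral_cube_supported => //.
    by apply: measurable_funeneg; exact/measurable_EFinP.
  by move=> x /gs gx; rewrite funenegE /= gx oppr0 maxxx.
apply: complexP; rewrite /=; apply: aux => // x /fs ->//.
Qed.

End cube_leb.

(** * Plancherel's identity for functions of bounded support *)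

Section plancherel_compact.
Context {R : realType} {d : nat}.
Local Notation Rd := 'cV[R]_d.
Local Notation Zd := 'cV[int]_d.
Local Notation mu := (leb d : {measure set Rd -> \bar R}).

Definition expd (xi x : Rd) : R[i] := expi2pi (dotmul x xi).

Lemma measurable_expd xi : measurable_fun_C (expd xi).
Proof. by apply: measurable_expi2pi; apply: measurable_dotmul. Qed.

Lemma normc_expd xi x : normc (expd xi x) = 1.
Proof. exact: normc_expi2pi. Qed.

Lemma sqn_expd xi x : sqn (expd xi x) = 1.
Proof. exact: sqn_expi2pi. Qed.

Lemma expdDr xi x y : expd xi (x + y) = expd xi x * expd xi y.
Proof. by rewrite /expd dotmulDl expi2piD. Qed.

Lemma expdDl xi eta x : expd (xi + eta) x = expd xi x * expd eta x.
Proof. by rewrite /expd dotmulDr expi2piD. Qed.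

Lemma integrable_expd (f : Rd -> R[i]) xi : integrable_C mu f ->
  integrable_C mu (fun x => f x * expd xi x).
Proof.
move=> i; under eq_fun do rewrite mulrC.
by apply: (@integrable_CMb _ _ _ _ _ _ 1) => //;
  [exact: measurable_expd|move=> x; rewrite normc_expd].
Qed.

Lemma fourier_L1E (f : Rd -> R[i]) xi :
  fourier_L1 f xi = integral_C mu (fun x => f x * expd xi x).
Proof. by []. Qed.

Lemma fourier_L1B (f g : Rd -> R[i]) xi : integrable_C mu f -> integrable_C mu g ->
  fourier_L1 (fun x => f x - g x) xi = fourier_L1 f xi - fourier_L1 g xi.
Proof.
move=> hf hg; rewrite !fourier_L1E -integral_CB; try exact: integrable_expd.
by congr integral_C; apply/funext => x; rewrite mulrBl.
Qed.

Lemma measurable_fourier_L1 (f : Rd -> R[i]) : measurable_fun_C f ->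
  measurable_fun_C (fourier_L1 f).
Proof.
move=> mf; apply: (@measurable_param_integral_C R _ _ Rd Rd (leb d)
  (fun xi x => f x * expd xi x)).
apply: measurable_CM; first exact: (measurable_C_comp mf).
by apply: measurable_expi2pi; apply: measurable_dotmul.
Qed.

(* The values of [fourier_L1 f] on [t + Z^d] are the Fourier coefficients of
   [f * expd t], whose norm does not depend on [t]. *)
Lemma plancherel_unit_cube (f : Rd -> R[i]) : L2c mu f ->
  (forall x, ~ unit_cube x -> f x = 0) -> N2 mu (fourier_L1 f) = N2 mu f.
Proof.
move=> hf fs.
have mF : measurable_fun_C (fourier_L1 f) by apply: measurable_fourier_L1; exact: hf.1.
rewrite /N2 ge0_integral_tiling; last 2 first.
- exact: measurable_EFin_sqn.
- by move=> x; rewrite lee_fin sqn_ge0.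
transitivity (\int[@cube R d]_x cst (N2 mu f) x)%E; last first.
  by rewrite integral_cst// cubeT mule1.
apply: eq_integral => t _ /=.
have mft : measurable_fun_C (fun x => f x * expd t x).
  by apply: measurable_CM; [exact: hf.1|exact: measurable_expd].
have fts x : ~ unit_cube x -> f x * expd t x = 0 by move=> /fs ->; rewrite mul0r.
have Nft : N2 mu (fun x => f x * expd t x) = N2 mu f.
  by apply: eq_integral => x _; rewrite sqnM sqn_expd mulr1.
have hft : L2c cube (fun x => f x * expd t x).
  by split => //; rewrite N2_cube_supported// Nft; exact: hf.2.
rewrite -Nft -N2_cube_supported// -cube_parseval//.
apply: eq_esum => k _; congr (EFin (sqn _)).
rewrite integral_C_cube_supported.
- rewrite fourier_L1E; congr integral_C; apply/funext => x.
  by rewrite expdDl mulrA mulrC /expd dotmulC.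
- by apply: measurable_CM => //; exact: measurable_chi.
- by move=> x /fts ->; rewrite mulr0.
Qed.

Lemma ge0_integral_scale (s : R) (b : Rd) (F : Rd -> \bar R) : 0 < s ->
  measurable_fun setT F -> (forall x, 0 <= F x)%E ->
  (\int[mu]_x F x = (s ^+ d)%:E * \int[mu]_x F (s *: x + b)%R)%E.
Proof.
move=> s0 mF F0; have us : (s%:M : 'M[R]_d) \in unitmx.
  by rewrite unitmxE det_scalar unitfE expf_neq0// gt_eqF.
have := scales_unitmx us (F := fun x => F (x + b)) (measurable_shift b mF) (fun x => F0 _).
under eq_integral do rewrite mul_scalar_mx.
rewrite ge0_integral_shift// => ->.
rewrite det_scalar gtr0_norm ?exprn_gt0// muleA -EFinM divff ?mul1e//.
by rewrite expf_neq0// gt_eqF.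
Qed.

(** Half-open, so that a dilation followed by a translation carries the unit cube exactly onto
    it. *)
Definition box (n : nat) : set Rd := [set x | forall i, - n%:R <= x i 0 < n%:R].

Lemma measurable_box n : measurable (box n).
Proof.
rewrite (_ : box n = \bigcap_(i in [set: 'I_d])
    ((fun x : Rd => x i 0 : measurableTypeR R) @^-1` `[- n%:R, n%:R[%classic)).
  apply: fin_bigcap_measurable => // i _.
  by rewrite -[X in measurable X]setTI; apply: measurable_coord.
apply/seteqP; split=> x /= H i; first by move=> _ /=; rewrite in_itv /=; exact: H.
by have := H i I; rewrite /= in_itv.
Qed.

(** The map [phi] carries the unit cube to the box, and [n.+1] keeps the scale [s] positive. The
    squared norm of [f] is [s ^+ d] times that of [g]. Up to a phase, the transform of [f] at [xi]
    is [s ^+ d] times that of [g] at [s *: xi], and the dilation costs one factor [s ^+ d] of the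
    square; so both sides scale alike. *)
Lemma plancherel_box (n : nat) (f : Rd -> R[i]) : L2c mu f ->
  (forall x, ~ box n.+1 x -> f x = 0) ->
  integrable_C mu f /\ N2 mu (fourier_L1 f) = N2 mu f.
Proof.
move=> hf fs.
pose s : R := n.+1%:R + n.+1%:R; pose b : Rd := \col_i (- n.+1%:R).
have n0 : 0 < n.+1%:R :> R by rewrite ltr0n.
have s0 : 0 < s by rewrite addr_gt0.
pose phi (x : Rd) := s *: x + b.
have mphi : measurable_fun setT phi.
  rewrite (_ : phi = (fun x => (s%:M *m x) + b)).
    apply: (measurableT_comp (measurable_cV_addr b)); exact: measurable_mulmx.
  by apply/funext => x; rewrite mul_scalar_mx.
have sd0 : 0 < s ^+ d by rewrite exprn_gt0.
have H := fun F => @ge0_integral_scale s b F s0.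
pose g := f \o phi.
have mg : measurable_fun_C g by apply: measurable_C_comp mphi; exact: hf.1.
have gs x : ~ unit_cube x -> g x = 0.
  move=> nQ; apply: fs => B; apply: nQ => i; have := B i; rewrite /phi !mxE /s.
  by move=> /andP[h1 h2]; apply/andP; split; nra.
have NE : N2 mu f = ((s ^+ d)%:E * N2 mu g)%E := N2_change H hf.1.
have hg : L2c mu g.
  split => //; apply: (change_fin sd0); first exact: N2_ge0.
  by rewrite -NE; exact: hf.2.
have ig : integrable_C mu g.
  apply/integrable_cube_supported => //; apply: L2c_cube_integrable.
  by split => //; rewrite N2_cube_supported//; exact: hg.2.
have i_f : integrable_C mu f by apply: (integrable_C_change_inv sd0 H) ig; exact: hf.1.
split => //.
have E xi : fourier_L1 f xi = (s ^+ d)%:C * (expd xi b * fourier_L1 g (s *: xi)).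
  rewrite !fourier_L1E (integral_C_change mphi sd0 H); last exact: integrable_expd.
  congr (_ * _); rewrite -integral_CZ; last exact: integrable_expd.
  congr integral_C; apply/funext => x /=.
  by rewrite /phi expdDr /g /phi /= mulrA mulrC /expd dotmulZl dotmulZr.
have mF : measurable_fun_C (fourier_L1 g) by exact: measurable_fourier_L1.
rewrite NE -(plancherel_unit_cube hg gs).
rewrite (N2_change (fun F => @ge0_integral_scale s 0 F s0) mF).
transitivity (((s ^+ d) ^+ 2)%:E * N2 mu (fun xi => fourier_L1 g (s *: xi)))%E; last first.
  rewrite muleA -EFinM -expr2.
  have E0 : N2 mu (fun xi => fourier_L1 g (s *: xi)) =
      N2 mu (fourier_L1 g \o (fun x => s *: x + 0)).
    by congr N2; apply/funext => x; rewrite /comp (addr0 (s *: x)).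
  by rewrite E0.
rewrite /N2 -ge0_integralZl//.
- by apply: eq_integral => x _; rewrite E !sqnM sqn_expd mul1r sqnC EFinM.
- apply: measurable_EFin_sqn; apply: (measurable_C_comp mF).
  rewrite (_ : *:%R s = (fun x : Rd => s%:M *m x)); first exact: measurable_mulmx.
  by apply/funext => x; rewrite mul_scalar_mx.
- by move=> x _; rewrite lee_fin sqn_ge0.
- by rewrite lee_fin sqr_ge0.
Qed.

End plancherel_compact.

Section L2_convergence.
Context {R : realType} disp (T : measurableType disp).
Variable mu : {measure set T -> \bar R}.
Implicit Types f g h : T -> R[i].

Lemma L2cvg_cauchy (u : (T -> R[i])^nat) f : (forall n, measurable_fun_C (u n)) ->
  measurable_fun_C f -> L2cvg mu u f ->
  forall e : R, 0 < e -> exists N, forall n m, (N <= n)%N -> (N <= m)%N ->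
     (N2 mu (fun x => u n x - u m x)%R <= e%:E)%E.
Proof.
move=> mu_ mf uf e e0; have e4 : 0 < e / 4 by rewrite divr_gt0.
have [N _ HN] := uf _ e4; exists N => n m Nn Nm.
rewrite (_ : (fun x => _) = (fun x => (u n x - f x) + (f x - u m x))); last first.
  by apply/funext => x; rewrite subrKA.
apply: le_trans (N2_addle mu _ _) _; try exact: measurable_CB.
rewrite [X in (_ + _ * X)%E]N2BC.
apply: le_trans (_ : (2%:E * (e / 4)%:E + 2%:E * (e / 4)%:E <= _)%E).
  by apply: leeD; apply: lee_wpmul2l => //; exact: HN.
by rewrite -!EFinM -EFinD lee_fin; lra.
Qed.

Lemma ae_L2cvg (u : (T -> R[i])^nat) f g : (forall n, measurable_fun_C (u n)) ->
  measurable_fun_C f -> measurable_fun_C g -> {ae mu, forall x, f x = g x} ->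
  L2cvg mu u f -> L2cvg mu u g.
Proof.
move=> mu_ mf mg fg uf e e0; apply: filterS (uf _ e0) => n.
rewrite (@ae_eq_N2 _ _ _ mu (fun x => u n x - f x) (fun x => u n x - g x))//.
- exact: measurable_CB.
- exact: measurable_CB.
- by apply: filterS fg => x ->.
Qed.

End L2_convergence.

Section truncation.
Context {R : realType} {d : nat}.
Local Notation Rd := 'cV[R]_d.
Local Notation mu := (leb d : {measure set Rd -> \bar R}).

Definition trunc n (f : Rd -> R[i]) (x : Rd) : R[i] := (\1_(box n.+1) x)%:C * f x.

Lemma box_le m n (x : Rd) : (m <= n)%N -> box m x -> box n x.
Proof.
move=> mn B i; have /andP[a b] := B i; have mnR : m%:R <= n%:R :> R by rewrite ler_nat.
by rewrite (le_trans _ a) ?lerN2//= (lt_le_trans b).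
Qed.

Lemma in_box (x : Rd) : exists n, box n x.
Proof.
pose S := \sum_i `|x i 0|; have S0 : 0 <= S by exact: sumr_ge0.
exists (Num.bound S) => i.
have xS : `|x i 0| < (Num.bound S)%:R.
  by apply: le_lt_trans (archi_boundP S0); rewrite /S (bigD1 i)//= lerDl sumr_ge0.
by have := xS; rewrite ltr_norml => /andP[/ltW -> ->].
Qed.

Lemma trunc_near f (x : Rd) : exists N, forall n, (N <= n)%N -> trunc n f x = f x.
Proof.
have [N B] := in_box x; exists N => n Nn.
by rewrite /trunc indicE mem_set ?mul1r//; apply: box_le B; exact: leqW.
Qed.

Lemma trunc_out n f (x : Rd) : ~ box n.+1 x -> trunc n f x = 0.
Proof. by move=> B; rewrite /trunc indicE memNset// mul0r. Qed.

Lemma L2c_trunc n f : L2c mu f -> L2c mu (trunc n f).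
Proof. by apply: L2c_indic; exact: measurable_box. Qed.

Lemma normc_trunc n f (x : Rd) : normc (trunc n f x) <= normc (f x).
Proof.
rewrite Normc.normcM normcE sqnC sqrtr_sqr -[leRHS]mul1r ler_wpM2r ?normc_ge0//.
by rewrite indicE normr_nat; case: (_ \in _).
Qed.

Lemma cvgC_trunc f (x : Rd) : cvgC (fun n => trunc n f x) (f x).
Proof.
have [N HN] := trunc_near f x.
by split; apply: cvg_near_cst; exists N => // n /= Nn; rewrite HN.
Qed.

Lemma L2cvg_trunc f : L2c mu f -> L2cvg mu (fun n => trunc n f) f.
Proof.
move=> hf e e0.
have hd n : L2c mu (fun x => trunc n f x - f x) by apply: L2cB => //; exact: L2c_trunc.
have [|x|n x||_] := @dominated_C _ _ _ mu (fun n x => (sqn (trunc n f x - f x))%:C)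
   (fun=> 0) (fun x => sqn (f x)).
- by move=> n; apply: measurable_Creal; apply: measurable_sqn; exact: (hd n).1.
- have [N HN] := trunc_near f x.
  by split; apply: cvg_near_cst; exists N => // n /= Nn; rewrite HN// subrr ?sqn0.
- rewrite normcE sqnC sqrtr_sqr ger0_norm ?sqn_ge0//.
  have -> : trunc n f x - f x = (\1_(box n.+1) x - 1)%:C * f x.
    by rewrite /trunc rmorphB/= mulrBl mul1r.
  rewrite sqnM sqnC -[leRHS]mul1r ler_wpM2r ?sqn_ge0// indicE.
  by case: (_ \in _); rewrite /= ?subrr ?sub0r ?sqrrN ?expr0n ?expr1n ?ler01.
- exact: L2c_integrable.
rewrite integral_C0 => -[c _].
have : \forall n \near \oo, `|n2 mu (fun x => trunc n f x - f x)| <= e.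
  by apply: (cvgr0_norm_le _ c).
apply: filterS => n; rewrite ger0_norm ?n2_ge0// => le.
by rewrite N2_fin.
Qed.

End truncation.

(** * The extension to L^2: existence, uniqueness, unitarity *)

Section fourier_transform.
Context {R : realType} {d : nat}.
Local Notation Rd := 'cV[R]_d.
Local Notation mu := (leb d : {measure set Rd -> \bar R}).

Lemma is_fourierP (f h : Rd -> R[i]) : is_fourier f h <->
  [/\ L2c mu f, L2c mu h & exists u : (Rd -> R[i])^nat,
    [/\ forall n, integrable_C mu (u n) /\ L2c mu (u n), L2cvg mu u f &
        L2cvg mu (fun n => fourier_L1 (u n)) h]].
Proof.
split=> -[/L_C2P hf /L_C2P hh [u [hu /cvg_L2_CP c1 /cvg_L2_CP c2]]].
  split => //; exists u; split => // n; have [a b] := hu n.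
  by split; [exact/L_C1P|exact/L_C2P].
split => //; exists u; split => // n; have [a b] := hu n.
by split; [exact/L_C1P|exact/L_C2P].
Qed.

Lemma integrable_trunc n (f : Rd -> R[i]) : L2c mu f -> integrable_C mu (trunc n f).
Proof. by move=> hf; have [] := plancherel_box (L2c_trunc n hf) (@trunc_out _ _ n f). Qed.

Lemma N2_fourier_trunc n (f : Rd -> R[i]) : L2c mu f ->
  N2 mu (fourier_L1 (trunc n f)) = N2 mu (trunc n f).
Proof. by move=> hf; have [] := plancherel_box (L2c_trunc n hf) (@trunc_out _ _ n f). Qed.

Lemma N2_fourier_truncB n m (f : Rd -> R[i]) : L2c mu f ->
  N2 mu (fun xi => fourier_L1 (trunc n f) xi - fourier_L1 (trunc m f) xi) =
  N2 mu (fun x => trunc n f x - trunc m f x).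
Proof.
move=> hf; have hd : L2c mu (fun x => trunc n f x - trunc m f x).
  by apply: L2cB; exact: L2c_trunc.
have [|_ <-] := @plancherel_box _ _ (maxn n m) _ hd.
  move=> x nB; rewrite !trunc_out ?subrr// => B; apply: nB; apply: box_le B.
    by rewrite ltnS leq_maxr.
  by rewrite ltnS leq_maxl.
congr N2; apply/funext => xi; rewrite fourier_L1B//; exact: integrable_trunc.
Qed.

Lemma L2c_fourier_trunc n (f : Rd -> R[i]) : L2c mu f -> L2c mu (fourier_L1 (trunc n f)).
Proof.
move=> hf; have ht := L2c_trunc n hf; split; first by apply: measurable_fourier_L1; exact: ht.1.
by rewrite N2_fourier_trunc//; exact: ht.2.
Qed.

Lemma fourier_trunc_cauchy (f : Rd -> R[i]) : L2c mu f ->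
  forall e : R, 0 < e -> exists N, forall n m, (N <= n)%N -> (N <= m)%N ->
     (N2 mu (fun xi => fourier_L1 (trunc n f) xi - fourier_L1 (trunc m f) xi)%R <= e%:E)%E.
Proof.
move=> hf e e0.
have mt n : measurable_fun_C (trunc n f) by exact: (L2c_trunc n hf).1.
have [N HN] := L2cvg_cauchy mt hf.1 (L2cvg_trunc hf) e0.
by exists N => n m Nn Nm; rewrite N2_fourier_truncB//; exact: HN.
Qed.

Lemma is_fourier_exists (f : Rd -> R[i]) : L2c mu f -> exists h, is_fourier f h.
Proof.
move=> hf.
have [h hh ch] := riesz_fischer (fun n => L2c_fourier_trunc n hf) (fourier_trunc_cauchy hf).
exists h; apply/is_fourierP; split => //; exists (fun n => trunc n f); split => //.
  by move=> n; split; [exact: integrable_trunc|exact: L2c_trunc].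
exact: L2cvg_trunc.
Qed.

(** The approximants in [is_fourier] need not have bounded support. Truncation gives transforms that
    are Cauchy in L^2 and, since [u] is integrable, converge pointwise to [fourier_L1 u]; Fatou's
    lemma identifies the two limits. *)
Lemma plancherel_L1L2 (u : Rd -> R[i]) : integrable_C mu u -> L2c mu u ->
  L2c mu (fourier_L1 u) /\ n2 mu (fourier_L1 u) = n2 mu u.
Proof.
move=> iu hu.
have hv n := L2c_fourier_trunc n hu.
have mU : measurable_fun_C (fourier_L1 u) by apply: measurable_fourier_L1; exact: hu.1.
have pw xi : cvgC (fun n => fourier_L1 (trunc n u) xi) (fourier_L1 u xi).
  have [||||_ c] := @dominated_C _ _ _ mu (fun n x => trunc n u x * expd xi x)
    (fun x => u x * expd xi x) (fun x => normc (u x)).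
  - by move=> n; apply: measurable_CM; [exact: (L2c_trunc n hu).1|exact: measurable_expd].
  - by move=> x; apply: cvgCM; [exact: cvgC_trunc|exact: cvgC_cst].
  - by move=> n x; rewrite Normc.normcM normc_expd mulr1 normc_trunc.
  - exact: integrable_C_normc.
  exact: c.
have cU : L2cvg mu (fun n => fourier_L1 (trunc n u)) (fourier_L1 u).
  move=> e e0; have [N HN] := fourier_trunc_cauchy hu e0.
  exists N => // n /= Nn.
  apply: (@N2_fatou _ _ _ mu
    (fun m xi => fourier_L1 (trunc n u) xi - fourier_L1 (trunc m u) xi)).
  - by move=> m; apply: measurable_CB; [exact: (hv n).1|exact: (hv m).1].
  - by apply: measurable_CB => //; exact: (hv n).1.
  - apply: aeW => xi; apply: cvgCD; first exact: cvgC_cst.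
    exact: cvgCN.
  - by exists N => // m /= Nm; exact: HN.
have hU := L2cvg_L2c hv mU cU.
split => //; have c1 := n2_cvg hv hU cU.
have c2 := n2_cvg (fun n => L2c_trunc n hu) hu (L2cvg_trunc hu).
have E : (fun n => n2 mu (fourier_L1 (trunc n u))) = (fun n => n2 mu (trunc n u)).
  by apply/funext => n; rewrite /n2 N2_fourier_trunc.
by rewrite E in c1; rewrite -(cvg_lim _ c1)// -(cvg_lim _ c2).
Qed.

Lemma is_fourier_L2 (f h : Rd -> R[i]) : is_fourier f h -> L2c mu f /\ L2c mu h.
Proof. by move=> /is_fourierP[]. Qed.

Lemma plancherel (f h : Rd -> R[i]) : is_fourier f h -> n2 mu h = n2 mu f.
Proof.
move=> /is_fourierP[hf hh [u [hu uf uh]]].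
have c1 := n2_cvg (fun n => (hu n).2) hf uf.
have c2 := n2_cvg (fun n => (plancherel_L1L2 (hu n).1 (hu n).2).1) hh uh.
have E : (fun n => n2 mu (fourier_L1 (u n))) = (fun n => n2 mu (u n)).
  by apply/funext => n; rewrite (plancherel_L1L2 (hu n).1 (hu n).2).2.
by rewrite E in c2; rewrite -(cvg_lim _ c1)// -(cvg_lim _ c2).
Qed.

Lemma fourier_L1D (f g : Rd -> R[i]) xi : integrable_C mu f -> integrable_C mu g ->
  fourier_L1 (fun x => f x + g x) xi = fourier_L1 f xi + fourier_L1 g xi.
Proof.
move=> hf hg; rewrite !fourier_L1E -integral_CD; try exact: integrable_expd.
by congr integral_C; apply/funext => x; rewrite mulrDl.
Qed.

Lemma fourier_L1Z c (f : Rd -> R[i]) xi : integrable_C mu f ->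
  fourier_L1 (fun x => c * f x) xi = c * fourier_L1 f xi.
Proof.
move=> hf; rewrite !fourier_L1E -integral_CZ; last exact: integrable_expd.
by congr integral_C; apply/funext => x; rewrite mulrA.
Qed.

Lemma is_fourierD (f g h k : Rd -> R[i]) : is_fourier f h -> is_fourier g k ->
  is_fourier (fun x => f x + g x) (fun x => h x + k x).
Proof.
move=> /is_fourierP[hf hh [u [hu uf uh]]] /is_fourierP[hg hk [v [hv vg vk]]].
apply/is_fourierP; split; [exact: L2cD|exact: L2cD|].
exists (fun n x => u n x + v n x); split.
- move=> n; have [a b] := hu n; have [a' b'] := hv n.
  by split; [exact: integrable_CD|exact: L2cD].
- by apply: L2cvgD => // [n|n||]; [exact: (hu n).2.1|exact: (hv n).2.1|exact: hf.1|exact: hg.1].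
- rewrite (_ : (fun n => _) = (fun n xi => fourier_L1 (u n) xi + fourier_L1 (v n) xi)).
    apply: L2cvgD => // [n|n||]; [| |exact: hh.1|exact: hk.1].
      by apply: measurable_fourier_L1; exact: (hu n).2.1.
    by apply: measurable_fourier_L1; exact: (hv n).2.1.
  by apply/funext => n; apply/funext => xi; rewrite fourier_L1D//; [exact: (hu n).1|exact: (hv n).1].
Qed.

Lemma is_fourierZ c (f h : Rd -> R[i]) : is_fourier f h ->
  is_fourier (fun x => c * f x) (fun x => c * h x).
Proof.
move=> /is_fourierP[hf hh [u [hu uf uh]]].
apply/is_fourierP; split; [exact: L2cZ|exact: L2cZ|].
exists (fun n x => c * u n x); split.
- by move=> n; have [a b] := hu n; split; [exact: integrable_CZ|exact: L2cZ].
- apply: (@L2cvgMb _ _ _ _ _ _ _ (sqn c)) => //; last exact: hf.1.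
  by move=> n; exact: (hu n).2.1.
- rewrite (_ : (fun n => _) = (fun n xi => c * fourier_L1 (u n) xi)).
    apply: (@L2cvgMb _ _ _ _ _ _ _ (sqn c)) => //; last exact: hh.1.
    by move=> n; apply: measurable_fourier_L1; exact: (hu n).2.1.
  by apply/funext => n; apply/funext => xi; rewrite fourier_L1Z//; exact: (hu n).1.
Qed.

Lemma is_fourier_ae (f g h k : Rd -> R[i]) : is_fourier f h ->
  measurable_fun_C g -> measurable_fun_C k ->
  {ae mu, forall x, f x = g x} -> {ae mu, forall x, h x = k x} -> is_fourier g k.
Proof.
move=> /is_fourierP[hf hh [u [hu uf uh]]] mg mk fg hk.
apply/is_fourierP; split; [exact: ae_L2c fg|exact: ae_L2c hk|].
exists u; split => //.
  by apply: ae_L2cvg fg uf => // [n|]; [exact: (hu n).2.1|exact: hf.1].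
apply: ae_L2cvg hk uh => // [n|]; last exact: hh.1.
by apply: measurable_fourier_L1; exact: (hu n).2.1.
Qed.

(** By linearity the difference of two transforms of [f] is a transform of 0, so Plancherel's
    identity makes its norm vanish. *)
Lemma is_fourier_unique (f h k : Rd -> R[i]) : is_fourier f h -> is_fourier f k ->
  {ae mu, forall x, h x = k x}.
Proof.
move=> Fh Fk; have := plancherel (is_fourierD Fh (is_fourierZ (-1) Fk)).
have [hf hh] := is_fourier_L2 Fh; have [_ hk] := is_fourier_L2 Fk.
rewrite (_ : (fun x => f x + -1 * f x) = fun=> 0); last first.
  by apply/funext => x; rewrite mulN1r subrr.
rewrite [RHS]/n2 N20 => n0.
have hD : L2c mu (fun x => h x + -1 * k x) by apply: L2cD => //; exact: L2cZ.
have := N2_fin hD; rewrite n0 => /(N2_eq0 hD.1).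
by apply: filterS => x; rewrite mulN1r => /eqP; rewrite subr_eq0 => /eqP.
Qed.

(** Polarisation: the norm of a sum gives the real parts, and the imaginary parts follow after
    multiplying the second function by -i. *)
Lemma parseval (f g h k : Rd -> R[i]) : is_fourier f h -> is_fourier g k ->
  ip mu f g = ip mu h k.
Proof.
have aux (f' g' h' k' : Rd -> R[i]) : is_fourier f' h' -> is_fourier g' k' ->
    Re (ip mu f' g') = Re (ip mu h' k').
  move=> F1 F2; have := plancherel (is_fourierD F1 F2).
  have [a b] := is_fourier_L2 F1; have [c e] := is_fourier_L2 F2.
  by rewrite !n2D// (plancherel F1) (plancherel F2); lra.
move=> F1 F2; apply: complexP; first exact: aux.
have := aux _ _ _ _ F1 (is_fourierZ (0 -i* 1) F2).
have [a b] := is_fourier_L2 F1; have [c e] := is_fourier_L2 F2.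
by rewrite !ipZr// !ReM /=; lra.
Qed.

End fourier_transform.

Section complex_fubini.
Context {R : realType} d1 d2 (T1 : measurableType d1) (T2 : measurableType d2).
Variables (m1 : {sigma_finite_measure set T1 -> \bar R}).
Variables (m2 : {sigma_finite_measure set T2 -> \bar R}).

(** Integrability of every section makes the inner real integrals agree everywhere with the extended
    ones, so that Fubini's theorem passes through [fine]. *)
Lemma fubini_C (G : T1 -> T2 -> R[i]) :
  measurable_fun_C (fun z : T1 * T2 => G z.1 z.2) ->
  (\int[m1]_x \int[m2]_y (normc (G x y))%:E < +oo)%E ->
  (forall x, integrable_C m2 (G x)) -> (forall y, integrable_C m1 (G ^~ y)) ->
  integral_C m1 (fun x => integral_C m2 (G x)) =
  integral_C m2 (fun y => integral_C m1 (G ^~ y)).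
Proof.
move=> mG fin i2 i1.
have aux (re : R[i] -> R) : (forall z, `|re z| <= normc z) ->
    measurable_fun setT (fun z : T1 * T2 => re (G z.1 z.2)) ->
    (forall x, m2.-integrable setT (EFin \o (fun y => re (G x y)))) ->
    (forall y, m1.-integrable setT (EFin \o (fun x => re (G x y)))) ->
    \int[m1]_x \int[m2]_y re (G x y) = \int[m2]_y \int[m1]_x re (G x y).
  move=> le mre j2 j1.
  have mE : measurable_fun setT (fun z : T1 * T2 => (re (G z.1 z.2))%:E).
    exact/measurable_EFinP.
  have ire : (m1 \x m2)%E.-integrable setT (fun z : T1 * T2 => (re (G z.1 z.2))%:E).
    apply/integrable12ltyP => //; apply: le_lt_trans fin.
    have mn : measurable_fun setT (fun z : T1 * T2 => (normc (G z.1 z.2))%:E).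
      exact: measurable_EFin_normc.
    apply: ge0_le_integral => //.
    - by move=> x _; exact: integral_ge0.
    - apply: (@measurable_fun_fubini_tonelli_F _ _ _ _ _ m2
        (fun z => `|(re (G z.1 z.2))%:E|%E)) => //.
      exact: measurableT_comp.
    - apply: (@measurable_fun_fubini_tonelli_F _ _ _ _ _ m2
        (fun z => (normc (G z.1 z.2))%:E)) => //.
      by move=> z; rewrite lee_fin normc_ge0.
    - move=> x _; apply: ge0_le_integral => //.
      + by apply: measurableT_comp => //; exact: measurable_int (j2 x).
      + by apply/measurable_EFinP; apply: measurable_normc; exact: (i2 x).1.
      + by move=> y _; rewrite /= lee_fin.
  have := Fubini ire; rewrite /= => F; rewrite /Rintegral; congr fine.
  transitivity (\int[m1]_x \int[m2]_y (re (G x y))%:E)%E.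
    apply: eq_integral => x _; rewrite fineK//.
    by apply: (integrable_fin_num _ (j2 x)).
  rewrite F; apply: eq_integral => y _.
  by rewrite fineK//; apply: (integrable_fin_num _ (j1 y)).
apply: complexP => /=.
  apply: (aux (@complex.Re R) (@Re_normc R) mG.1) => [x|y].
    by have [] := (integrable_CP _ _).1 (i2 x).
  by have [] := (integrable_CP _ _).1 (i1 y).
apply: (aux (@complex.Im R) (@Im_normc R) mG.2) => [x|y].
  by have [] := (integrable_CP _ _).1 (i2 x).
by have [] := (integrable_CP _ _).1 (i1 y).
Qed.

End complex_fubini.

(** * Symmetries of the transform, multiplication formula, surjectivity *)

Section fourier_symmetries.
Context {R : realType} {d : nat}.
Local Notation Rd := 'cV[R]_d.
Local Notation mu := (leb d : {measure set Rd -> \bar R}).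

(** The factor one gives this the shape expected by the change-of-variables results. *)
Lemma change_shift (b : Rd) (F : Rd -> \bar R) : measurable_fun setT F ->
  (forall x, 0 <= F x)%E -> (\int[mu]_x F x = 1%:E * \int[mu]_x F (x + b)%R)%E.
Proof. by move=> mF F0; rewrite ge0_integral_shift// mul1e. Qed.

Lemma change_opp (F : Rd -> \bar R) : measurable_fun setT F ->
  (forall x, 0 <= F x)%E -> (\int[mu]_x F x = 1%:E * \int[mu]_x F (- x)%R)%E.
Proof.
move=> mF F0; have u1 : ((-1)%:M : 'M[R]_d) \in unitmx.
  by rewrite unitmxE det_scalar unitfE expf_neq0// oppr_eq0 oner_eq0.
have := scales_unitmx u1 mF F0.
under eq_integral do rewrite mul_scalar_mx scaleN1r.
by rewrite det_scalar normrX normrN1 expr1n invr1 !mul1e.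
Qed.

Lemma measurable_opp_cV : measurable_fun setT (fun x : Rd => - x).
Proof.
rewrite (_ : (fun x => _) = (fun x : Rd => (-1)%:M *m x)); first exact: measurable_mulmx.
by apply/funext => x; rewrite mul_scalar_mx scaleN1r.
Qed.

Section change1.
Variables (phi : Rd -> Rd) (mphi : measurable_fun setT phi).
Hypothesis H : forall F : Rd -> \bar R, measurable_fun setT F -> (forall x, 0 <= F x)%E ->
  (\int[mu]_x F x = 1%:E * \int[mu]_x F (phi x))%E.

Lemma L2c_change1 f : L2c mu f -> L2c mu (f \o phi).
Proof.
move=> [mf i]; split; first exact: measurable_C_comp.
by rewrite -[N2 _ _]mul1e -(N2_change H).
Qed.

Lemma L2cvg_change1 u f : (forall n, measurable_fun_C (u n)) -> measurable_fun_C f ->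
  L2cvg mu u f -> L2cvg mu (fun n => u n \o phi) (f \o phi).
Proof.
move=> mu_ mf uf e e0; apply: filterS (uf _ e0) => n.
by rewrite (N2_change H) ?mul1e//; exact: measurable_CB.
Qed.

End change1.

Lemma fourier_L1_shift (b : Rd) (f : Rd -> R[i]) xi : integrable_C mu f ->
  fourier_L1 (fun x => f (x - b)) xi = expd xi b * fourier_L1 f xi.
Proof.
move=> hf; rewrite !fourier_L1E -integral_CZ; last exact: integrable_expd.
have mb := @measurable_cV_addr R d b.
have iS : integrable_C mu (fun x => f (x - b)).
  exact: (integrable_C_change (measurable_cV_addr (- b)) ltr01 (change_shift (- b))).
rewrite (integral_C_change mb ltr01 (change_shift b)); last exact: integrable_expd.
rewrite mul1r; congr integral_C; apply/funext => x /=.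
by rewrite addrK expdDr; ring.
Qed.

Lemma is_fourier_shift (b : Rd) (f h : Rd -> R[i]) : is_fourier f h ->
  is_fourier (fun x => f (x - b)) (fun xi => expd xi b * h xi).
Proof.
move=> /is_fourierP[hf hh [u [hu uf uh]]].
have mb := @measurable_cV_addr R d (- b); have Hb := change_shift (- b).
have me : measurable_fun_C (fun xi : Rd => expd xi b).
  by apply: measurable_expi2pi; exact: measurable_dotmul.
have e1 (xi : Rd) : sqn (expd xi b) <= 1 by rewrite sqn_expd.
apply/is_fourierP; split.
- exact: (L2c_change1 mb Hb hf).
- exact: (L2cMb hh me e1).
exists (fun n x => u n (x - b)); split.
- move=> n; have [i l] := hu n; split; last exact: (L2c_change1 mb Hb l).
  exact: (integrable_C_change mb ltr01 Hb i).
- by apply: (L2cvg_change1 Hb _ _ uf) => [n|]; [exact: (hu n).2.1|exact: hf.1].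
- rewrite (_ : (fun n => _) = (fun n xi => expd xi b * fourier_L1 (u n) xi)).
    apply: (L2cvgMb _ _ me e1 uh); last exact: hh.1.
    by move=> n; apply: measurable_fourier_L1; exact: (hu n).2.1.
  by apply/funext => n; apply/funext => xi; rewrite fourier_L1_shift//; exact: (hu n).1.
Qed.

Lemma fourier_L1_opp_conj (f : Rd -> R[i]) xi : integrable_C mu f ->
  fourier_L1 (fun x => (f (- x))^*) xi = (fourier_L1 f xi)^*.
Proof.
move=> hf; rewrite !fourier_L1E -integral_CJ; last exact: integrable_expd.
have mo := measurable_opp_cV.
have iS : integrable_C mu (fun x => (f (- x))^*).
  by apply: integrable_CJ; exact: (integrable_C_change mo ltr01 change_opp).
rewrite (integral_C_change mo ltr01 change_opp); last exact: integrable_expd.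
rewrite mul1r; congr integral_C; apply/funext => x /=.
by rewrite opprK rmorphM/= /expd dotmulNl expi2piN.
Qed.

Lemma L2cvgJ (u : (Rd -> R[i])^nat) f : L2cvg mu u f ->
  L2cvg mu (fun n x => (u n x)^*) (fun x => (f x)^*).
Proof.
move=> uf e e0; apply: filterS (uf _ e0) => n.
rewrite (_ : N2 mu (fun x => (u n x)^* - (f x)^*) = N2 mu (fun x => u n x - f x))//.
by apply: eq_integral => x _; rewrite -rmorphB/= sqnJ.
Qed.

Lemma is_fourier_opp_conj (f h : Rd -> R[i]) : is_fourier f h ->
  is_fourier (fun x => (f (- x))^*) (fun xi => (h xi)^*).
Proof.
move=> /is_fourierP[hf hh [u [hu uf uh]]].
have mo := measurable_opp_cV; have Ho := change_opp.
apply/is_fourierP; split.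
- by apply: L2cJ; exact: (L2c_change1 mo Ho hf).
- exact: L2cJ.
exists (fun n x => (u n (- x))^*); split.
- move=> n; have [i l] := hu n; split.
    by apply: integrable_CJ; exact: (integrable_C_change mo ltr01 Ho i).
  by apply: L2cJ; exact: (L2c_change1 mo Ho l).
- apply: L2cvgJ; apply: (L2cvg_change1 Ho _ _ uf) => [n|]; last exact: hf.1.
  exact: (hu n).2.1.
- rewrite (_ : (fun n => _) = (fun n xi => (fourier_L1 (u n) xi)^*)).
    exact: L2cvgJ.
  by apply/funext => n; apply/funext => xi; rewrite fourier_L1_opp_conj//; exact: (hu n).1.
Qed.

(** The pairing without conjugation, for which the transform is symmetric because its kernel is. *)
Definition bil (f g : Rd -> R[i]) := integral_C mu (fun x => f x * g x).

Lemma bilE f g : bil f g = ip mu (fun x => (f x)^*) g.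
Proof. by rewrite /bil /ip; congr integral_C; apply/funext => x; congr (_ * _); exact/esym/conjcK. Qed.

Lemma bilC f g : bil f g = bil g f.
Proof. by rewrite /bil; congr integral_C; apply/funext => x; rewrite mulrC. Qed.

Lemma bil_cvg u f g : (forall n, L2c mu (u n)) -> L2c mu f -> L2c mu g ->
  L2cvg mu u f -> cvgC (fun n => bil g (u n)) (bil g f).
Proof.
move=> hu hf hg uf; rewrite bilE; under eq_fun do rewrite bilE.
by apply: ip_cvgr => //; exact: L2cJ.
Qed.

Lemma multiplication_formula_L1 (u v : Rd -> R[i]) : integrable_C mu u -> integrable_C mu v ->
  bil (fourier_L1 u) v = bil u (fourier_L1 v).
Proof.
move=> iu iv.
have mexp : measurable_fun_C (fun z : Rd * Rd => expd z.1 z.2 : R[i]).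
  by apply: measurable_expi2pi; apply: measurable_dotmul.
have E1 xi : fourier_L1 u xi * v xi = integral_C mu (fun x => v xi * (u x * expd xi x)).
  by rewrite fourier_L1E mulrC -integral_CZ//; exact: integrable_expd.
have E2 x : u x * fourier_L1 v x = integral_C mu (fun xi => v xi * (u x * expd xi x)).
  rewrite fourier_L1E -integral_CZ; last exact: integrable_expd.
  by congr integral_C; apply/funext => xi; rewrite /expd dotmulC mulrCA.
rewrite /bil; under eq_fun do rewrite E1.
under [in RHS]eq_fun do rewrite E2.
apply: (fubini_C (m1 := leb d) (m2 := leb d) (G := fun xi x => v xi * (u x * expd xi x))).
- apply: measurable_CM; first exact: (measurable_C_comp iv.1).
  by apply: measurable_CM => //; exact: (measurable_C_comp iu.1).
- have nE xi x : normc (v xi * (u x * expd xi x)) =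
      normc (v xi) * normc (u x).
    by rewrite !Normc.normcM normc_expd mulr1.
  have mn (w : Rd -> R[i]) : measurable_fun_C w ->
      measurable_fun setT (fun x => (normc (w x))%:E).
    by move=> mw; apply/measurable_EFinP; exact: measurable_normc.
  have -> : (\int[leb d]_x \int[leb d]_y (normc (v x * (u y * expd x y)))%:E =
     \int[leb d]_x ((normc (v x))%:E * \int[leb d]_y (normc (u y))%:E))%E.
    apply: eq_integral => xi _; rewrite -ge0_integralZl//.
    + by apply: eq_integral => x _; rewrite nE EFinM.
    + by apply: mn; exact: iu.1.
    + by move=> x _; rewrite lee_fin normc_ge0.
    + by rewrite lee_fin normc_ge0.
  rewrite ge0_integralZr//.
  + have n0 : (0 <= \int[leb d]_x (normc (v x))%:E)%E.
      by apply: integral_ge0 => x _; rewrite lee_fin normc_ge0.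
    apply: lte_mul_pinfty => //; last exact: iu.2.
    by rewrite ge0_fin_numE//; exact: iv.2.
  + by apply: mn; exact: iv.1.
  + by move=> x _; rewrite lee_fin normc_ge0.
  + by apply: integral_ge0 => x _; rewrite lee_fin normc_ge0.
- by move=> xi; apply: integrable_CZ; exact: integrable_expd.
- move=> x; rewrite (_ : (fun y => _) = (fun xi => u x * (v xi * expd x xi))).
    by apply: integrable_CZ; exact: integrable_expd.
  by apply/funext => xi; rewrite /expd dotmulC mulrCA.
Qed.

Lemma multiplication_formula (u v U V : Rd -> R[i]) : is_fourier u U -> is_fourier v V ->
  bil U v = bil u V.
Proof.
move=> /is_fourierP[hu hU [un [hun cu cU]]] /is_fourierP[hv hV [vn [hvn cv cV]]].
have hUn n : L2c mu (fourier_L1 (un n)) by have [] := plancherel_L1L2 (hun n).1 (hun n).2.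
have hVn n : L2c mu (fourier_L1 (vn n)) by have [] := plancherel_L1L2 (hvn n).1 (hvn n).2.
(* The limit is taken in one argument at a time: first in [v], with the integrable approximant of
   [u] fixed. *)
have S n : bil (fourier_L1 (un n)) v = bil (un n) V.
  have c1 := bil_cvg (fun m => (hvn m).2) hv (hUn n) cv.
  have c2 := bil_cvg hVn hV (hun n).2 cV.
  apply: (cvgC_unique c1); have E : (fun m => bil (fourier_L1 (un n)) (vn m)) =
      (fun m => bil (un n) (fourier_L1 (vn m))).
    by apply/funext => m; apply: multiplication_formula_L1; [exact: (hun n).1|exact: (hvn m).1].
  by rewrite E.
have c1 := bil_cvg hUn hU hv cU.
have c2 := bil_cvg (fun n => (hun n).2) hu hV cu.
rewrite bilC [RHS]bilC; apply: (cvgC_unique c1).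
have E : (fun n => bil v (fourier_L1 (un n))) = (fun n => bil V (un n)).
  by apply/funext => n; rewrite bilC S bilC.
by rewrite E.
Qed.

(* Let [f] be the transform of [p (- x)] and [h] the transform of [f].  The
   multiplication formula gives [ip p h = n2 p = n2 h], hence [h = p] a.e. *)
Lemma is_fourier_surj (p : Rd -> R[i]) : L2c mu p -> exists f, is_fourier f p.
Proof.
move=> hp; have mo := measurable_opp_cV; have Ho := change_opp.
pose q (x : Rd) := p (- x).
have hq : L2c mu q := L2c_change1 mo Ho hp.
have [f Ff] := is_fourier_exists hq.
have [_ hf] := is_fourier_L2 Ff.
have [h Fh] := is_fourier_exists hf.
have [_ hh] := is_fourier_L2 Fh.
have Fc : is_fourier (fun x => (p x)^*) (fun x => (f x)^*).
  have := is_fourier_opp_conj Ff; rewrite /q.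
  by under eq_fun do rewrite opprK.
have nf : n2 mu f = n2 mu p.
  rewrite (plancherel Ff) /n2 (N2_change Ho hp.1) mul1e//.
have iph : ip mu p h = (n2 mu p)%:C.
  have -> : ip mu p h = bil (fun x => (p x)^*) h by [].
  by rewrite -(multiplication_formula Fc Fh) -nf -ipff.
have : n2 mu (fun x => p x - h x) = 0.
  by rewrite n2B// iph (plancherel Fh) nf /=; ring.
have hd : L2c mu (fun x => p x - h x) by exact: L2cB.
move=> n0; have := N2_fin hd; rewrite n0 => /(N2_eq0 hd.1) ph.
exists f; apply: (is_fourier_ae Fh hf.1 hp.1); first exact: aeW.
by apply: filterS ph => x /eqP; rewrite subr_eq0 => /eqP.
Qed.

Lemma fourierP (f : Rd -> R[i]) : L2 f -> is_fourier f (fourier f).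
Proof. by move=> /L_C2P/is_fourier_exists[h Fh]; exact: (@xgetPex _ (fun=> 0) [set h | is_fourier f h] (ex_intro _ h Fh)). Qed.

Lemma inv_fourierP (p : Rd -> R[i]) : L2 p -> is_fourier (inv_fourier p) p.
Proof. by move=> /L_C2P/is_fourier_surj[f Ff]; exact: (@xgetPex _ (fun=> 0) [set f | is_fourier f p] (ex_intro _ f Ff)). Qed.

End fourier_symmetries.

(** * Embeddings of Z^d *)

Section embedding_matrix.
Context {R : realType} {d : nat}.
Local Notation Rd := 'cV[R]_d.
Local Notation Zd := 'cV[int]_d.
Variable theta : {additive Zd -> Rd}.

Lemma additive_mx : {A : 'M[R]_d | forall g : Zd, theta g = A *m iota_Z g}.
Proof.
exists (\matrix_(i, j) theta (delta_mx j 0) i 0) => g.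
have {1}-> : g = \sum_j delta_mx j 0 *~ g j 0.
  rewrite {1}(matrix_sum_delta g); apply: eq_bigr => j _.
  by rewrite big_ord1 -scaler_int intz.
rewrite raddf_sum; apply/colP => i; rewrite !mxE summxE; apply: eq_bigr => j _.
by rewrite raddfMz !mxE -scaler_int !mxE mulrC.
Qed.

(** The inverse of [theta] is continuous at 0 with values in a discrete space, hence constant on the
    part of the image lying in a small ball. *)
Lemma embedding_discrete : is_embedding theta ->
  exists2 e : R, 0 < e & forall c : Zd, (forall i, `|theta c i 0| < e) -> c = 0.
Proof.
move=> [inj _ [inv invK /subspace_continuousP cinv]].
have r0 : range theta 0 by exists 0; rewrite ?raddf0.
have := cinv _ r0 _ (@discrete_set1 (discrete_topology Zd) (inv 0)).
rewrite /fmap /within /= => /nbhs_ballP[e /= e0 eb]; exists e => // c ce.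
have : inv (theta c) = inv 0.
  apply: eb => /=; last by exists c.
  by split=> // i j; rewrite ord1 mxE /ball/= sub0r normrN; exact: ce.
by rewrite invK -{1}(raddf0 theta) invK.
Qed.

(** A grid of mesh 1/M, with M above the inverse of [e], cuts the cube into finitely many cells;
    taking one more point than there are cells puts two of them in a common cell. *)
Lemma pigeonhole_cube (y : nat -> Rd) (e : R) : 0 < e ->
  (forall n i, 0 <= y n i 0 < 1) ->
  exists n m, n <> m /\ forall i, `|y n i 0 - y m i 0| < e.
Proof.
move=> e0 y01; apply: contrapT => no.
pose M := (Num.truncn (e^-1)).+1.
have eM : e^-1 < M%:R := truncnS_gt _.
have M0 : 0 < M%:R :> R by rewrite ltr0n.
have bM n i : (Num.truncn (y n i 0 * M%:R)%R < M)%N.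
  have /andP[y0 y1] := y01 n i.
  by rewrite truncn_lt_nat ?mulr_ge0// gtr_pMl.
pose phi n : {ffun 'I_d -> 'I_M} := [ffun i => Ordinal (bM n i)].
have phi_inj : injective (fun n : 'I_#|{ffun 'I_d -> 'I_M}|.+1 => phi n).
  move=> n m nm; apply/eqP/negPn/negP => /eqP nEm; apply: no.
  exists n, m; split=> [/val_inj//|i].
  have /(congr1 val) := congr1 (fun f : {ffun 'I_d -> 'I_M} => f i) nm.
  rewrite !ffunE /= => E.
  have := truncn_itv (mulr_ge0 (andP (y01 n i)).1 (ltW M0)).
  have := truncn_itv (mulr_ge0 (andP (y01 m i)).1 (ltW M0)).
  rewrite -E => /andP[m1 m2] /andP[n1 n2].
  rewrite -[e]invrK -(ltr_pM2r M0) -[X in _ * X]gtr0_norm// -normrM mulrBl.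
  apply: (@lt_trans _ _ 1); last by rewrite ltr_pdivlMl ?mulr1// invr_gt0.
  move: m1 m2 n1 n2; rewrite -natr1; set a := _%:R => m1 m2 n1 n2.
  by rewrite ltr_norml; apply/andP; split; lra.
by have := leq_card _ phi_inj; rewrite card_ord ltnn.
Qed.

(* If [A z = 0] with [z i = 1], the integer parts [c n] of [n z] are distinct,
   but [A (c n - c m)] is small whenever the fractional parts of [n z] and [m z]
   are close; this contradicts the discreteness of the image. *)
Lemma embedding_inj_mx (A : 'M[R]_d) : is_embedding theta ->
  (forall g : Zd, theta g = A *m iota_Z g) -> forall x : Rd, A *m x = 0 -> x = 0.
Proof.
move=> /embedding_discrete[e e0 de] thA x Ax.
apply: contrapT => x0.
have {x0}[i xi0] : exists i, x i 0 != 0.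
  apply: contrapT => H; apply: x0; apply/colP => i; rewrite mxE; apply/eqP.
  by apply: contrapT => /negP xi; apply: H; exists i.
have [z zi Az] : exists2 z : Rd, z i 0 = 1 & A *m z = 0.
  by exists ((x i 0)^-1 *: x); rewrite ?mxE ?mulVf// -scalemxAr Ax scaler0.
pose c n : Zd := \col_j Num.floor (n%:R * z j 0).
pose y n : Rd := n%:R *: z - iota_Z (c n).
have y01 n j : 0 <= y n j 0 < 1.
  rewrite !mxE subr_ge0 ltrBlDr addrC -[X in _ + X]/(1%:~R) -intrD.
  exact: floor_itv.
(* [K] exceeds every absolute row sum of [A], so coordinates closer than [e / K] have images closer
   than [e]; the 1 keeps [K] positive. *)
pose K := 1 + \sum_k \sum_j `|A k j|.
have K0 : 0 < K.
  by rewrite ltr_pwDl// sumr_ge0// => k _; rewrite sumr_ge0.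
have [n [m [nm ynm]]] := pigeonhole_cube (divr_gt0 e0 K0) y01.
have thy : theta (c n - c m) = A *m (y m - y n).
  by rewrite raddfB !thA !mulmxBr -!scalemxAr Az !scaler0 !sub0r opprK addrC.
have /eqP : c n - c m = 0.
  apply: de => k; rewrite thy mxE; apply: le_lt_trans (ler_norm_sum _ _ _) _.
  have : \sum_j `|A k j| * (e / K) < e.
    rewrite -mulr_suml mulrCA gtr_pMr// ltr_pdivrMr// mul1r /K.
    rewrite [in ltRHS](bigD1 k)//= addrCA ltrDl ltr_pwDl// sumr_ge0// => l _.
    by rewrite sumr_ge0.
  apply: le_lt_trans; apply: ler_sum => j _; rewrite normrM ler_wpM2l//.
  by rewrite !mxE distrC; have := ltW (ynm j); rewrite !mxE.
(* At the coordinate [i], where [z] equals 1, the integer part [c n] is [n] itself, so [n] and [m]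
   would coincide. *)
rewrite subr_eq0 => /eqP/colP/(_ i); rewrite !mxE zi !mulr1.
have fl k : Num.floor (k%:R : R) = k%:Z.
  by apply: floor_def; rewrite lexx /= intrD ltrDl ltr01.
by rewrite !fl => -[].
Qed.

Lemma emb_mxP : is_embedding theta ->
  emb_mx theta \in unitmx /\ forall g : Zd, theta g = emb_mx theta *m iota_Z g.
Proof.
move=> he; have [A thA] := additive_mx.
have uA : A \in unitmx.
  rewrite -unitmx_tr -row_free_unit; apply: inj_row_free => v vA.
  apply: trmx_inj; rewrite trmx0; apply: (embedding_inj_mx he thA).
  by rewrite -[A]trmxK -trmx_mul vA trmx0.
exact: (@xgetPex _ 0 [set A : 'M[R]_d | A \in unitmx /\
  forall g : Zd, theta g = A *m iota_Z g] (ex_intro _ A (conj uA thA))).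
Qed.

End embedding_matrix.

(** * Fourier series, brackets and actions *)

Section absolute_summability.
Context {R : realType} {I : countType}.

Lemma l1_C_le (f g : I -> R[i]) : (forall i, normc (f i) <= normc (g i)) ->
  l1_C g -> l1_C f.
Proof.
move=> fg /l1_CE lg; apply/l1_CE; apply: le_lt_trans lg.
by apply: le_esum => i _; rewrite lee_fin.
Qed.

Definition l1_norm (a : I -> R[i]) : R := fine (esum setT (fun i => (normc (a i))%:E)).

Lemma l1_norm_ge0 a : 0 <= l1_norm a.
Proof. by apply: fine_ge0; apply: esum_ge0 => i _; rewrite lee_fin normc_ge0. Qed.

Lemma l1_normE (a : I -> R[i]) : l1_C a ->
  esum setT (fun i => (normc (a i))%:E) = (l1_norm a)%:E.
Proof.
move=> /l1_CE la; rewrite fineK// ge0_fin_numE//.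
by apply: esum_ge0 => i _; rewrite lee_fin normc_ge0.
Qed.

Lemma normc_partial_le (a : I -> R[i]) N : l1_C a ->
  normc (\sum_(0 <= n < N) enum_term a n) <= l1_norm a.
Proof. by move=> la; rewrite -lee_fin -l1_normE//; exact: normc_enum_sum_le. Qed.

Lemma sqn_sum_C_le (a : I -> R[i]) (M : R) : l1_C a ->
  (forall N, sqn (\sum_(0 <= n < N) enum_term a n) <= M) -> sqn (sum_C setT a) <= M.
Proof.
move=> la aM; apply: (cvgr_to_le (cvgC_sqn (sum_C_cvg la))).
exact: nearW.
Qed.

Lemma sum_CB (f g : I -> R[i]) : l1_C f -> l1_C g ->
  sum_C setT (fun i => f i - g i) = sum_C setT f - sum_C setT g.
Proof.
move=> lf lg.
have lfg : l1_C (fun i => f i - g i).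
  apply/l1_CE; apply: (@le_lt_trans _ _ (esum setT (fun i => (normc (f i))%:E) +
      esum setT (fun i => (normc (g i))%:E))%E); last first.
    by rewrite !l1_normE// ltry.
  rewrite -esumD; try by move=> i _; rewrite lee_fin normc_ge0.
  apply: le_esum => i _; rewrite -EFinD lee_fin.
  by rewrite (le_trans (le_normcD _ _))// normcN.
apply: (cvgC_unique (sum_C_cvg lfg)).
have := cvgCD (sum_C_cvg lf) (cvgCN (sum_C_cvg lg)).
congr (cvgC _ _); apply/funext => N; rewrite -sumrN -big_split/=.
apply: eq_bigr => n _; rewrite enum_termD; congr (_ + _).
by rewrite (enum_term_map (h := -%R))// oppr0.
Qed.

Lemma sum_C_single (f : I -> R[i]) i0 : (forall i, i != i0 -> f i = 0) ->
  sum_C setT f = f i0.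
Proof.
move=> fi; have sR (g : I -> R) : (forall i, i != i0 -> g i = 0) -> sum_R setT g = g i0.
  move=> gi; rewrite /sum_R !funerpos !funerneg !(esum_single (i0 := i0)) /=.
  - by rewrite -[in RHS](funrposBneg g).
  - by rewrite lee_fin funrneg_ge0.
  - by move=> i /gi E; rewrite /funrneg E oppr0 maxxx.
  - by rewrite lee_fin funrpos_ge0.
  - by move=> i /gi E; rewrite /funrpos E maxxx.
by rewrite /sum_C !sR ?ReImE// => [|i /fi ->|i /fi ->]//; case: (f i0).
Qed.

(** The Cauchy-Schwarz inequality for the weights [normc (a j)]. *)
Lemma sqn_weighted_sum_le (J : Type) (r : seq J) (a w : J -> R[i]) :
  sqn (\sum_(j <- r) a j * w j) <=
  (\sum_(j <- r) normc (a j)) * (\sum_(j <- r) normc (a j) * sqn (w j)).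
Proof.
elim: r => [|j r IH]; first by rewrite !big_nil mul0r -sqr_normc Normc.normc0 expr0n.
rewrite !big_cons; set S := \sum_(_ <- _) _ * _ in IH *.
set A := \sum_(_ <- _) _ in IH *; set V := \sum_(_ <- _) _ in IH *.
have A0 : 0 <= A by apply: sumr_ge0 => i _; exact: normc_ge0.
have V0 : 0 <= V by apply: sumr_ge0 => i _; rewrite mulr_ge0 ?normc_ge0 ?sqn_ge0.
move: IH; rewrite -!sqr_normc => IH.
have := le_normcD (a j * w j) S; rewrite Normc.normcM.
have := normc_ge0 (a j * w j + S); set s := normc S in IH *.
have := normc_ge0 S; rewrite -/s; have := normc_ge0 (a j); have := normc_ge0 (w j).
set x := normc (_ + _); set al := normc (a j); set om := normc (w j).
move=> om0 al0 s0 x0 xle.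
(* The cross term of the expanded square; the bound follows from [s ^+ 2 <= A * V] and the
   arithmetic-geometric inequality for [V] and [A * om ^+ 2]. *)
have key : 2 * s * om <= V + A * om ^+ 2.
  rewrite -ler_sqr ?nnegrE; [|by rewrite !mulr_ge0|by rewrite addr_ge0// mulr_ge0// sqr_ge0].
  have : s ^+ 2 * om ^+ 2 <= A * V * om ^+ 2 by rewrite ler_wpM2r// sqr_ge0.
  have := sqr_ge0 (V - A * om ^+ 2); nra.
have : x ^+ 2 <= (al * om + s) ^+ 2 by rewrite ler_sqr ?nnegrE// (le_trans x0).
have : al * (2 * s * om) <= al * (V + A * om ^+ 2) by rewrite ler_wpM2l.
nra.
Qed.

End absolute_summability.

Section finite_sum_integral.
Context {R : realType} disp (T : measurableType disp).
Variable mu : {measure set T -> \bar R}.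

Lemma integral_C_sum (u : nat -> T -> R[i]) N : (forall n, integrable_C mu (u n)) ->
  integrable_C mu (fun x => \sum_(0 <= n < N) u n x) /\
  integral_C mu (fun x => \sum_(0 <= n < N) u n x) =
  \sum_(0 <= n < N) integral_C mu (u n).
Proof.
move=> hu; have [z1 z2] : integrable_C mu (fun=> 0) /\ integral_C mu (fun=> 0) = 0.
  split; last exact: integral_C0.
  have := integrable_CZ 0 (hu 0%N); congr integrable_C.
  by apply/funext => x; rewrite mul0r.
elim: N => [|N [IH1 IH2]].
  rewrite big_nil (_ : (fun x => _) = (fun=> 0))//.
  by apply/funext => x; rewrite big_nil.
have E : (fun x => \sum_(0 <= n < N.+1) u n x) = (fun x => \sum_(0 <= n < N) u n x + u N x).
  by apply/funext => x; rewrite big_nat_recr.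
rewrite E big_nat_recr//= -IH2; split; first exact: integrable_CD.
exact: integral_CD.
Qed.

End finite_sum_integral.

Section torus_fourier_series.
Context {R : realType} {d : nat}.
Local Notation Rd := 'cV[R]_d.
Local Notation Zd := 'cV[int]_d.
Implicit Types (a b : Zd -> R[i]).

Lemma l1_char a (z : torus R d) : l1_C a -> l1_C (fun k => a k * torus_char k z).
Proof.
by apply: l1_C_le => k; rewrite Normc.normcM /torus_char normc_expi2pi mulr1.
Qed.

Lemma sqn_fourier_Z_le a z : l1_C a -> sqn (fourier_Z a z) <= l1_norm a ^+ 2.
Proof.
move=> la; have lz := l1_char z la.
apply: sqn_sum_C_le => // N; rewrite -sqr_normc ler_sqr ?nnegrE ?normc_ge0 ?l1_norm_ge0//.
rewrite (le_trans (normc_partial_le N lz))// /l1_norm.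
rewrite (_ : (fun i => (normc (a i * _))%:E) = (fun i => (normc (a i))%:E))//.
by apply/funext => k; rewrite Normc.normcM /torus_char normc_expi2pi mulr1.
Qed.

Lemma measurable_fourier_Z a : measurable_fun_C (fourier_Z a : torus R d -> R[i]).
Proof.
apply: (@measurable_sum_C _ Zd _ _ (fun k z => a k * torus_char k z)) => k.
by apply: measurable_CM; [exact: measurable_Ccst|exact: measurable_torus_char].
Qed.

Lemma haar_change (F : torus R d -> \bar R) : measurable_fun setT F ->
  (forall z, 0 <= F z)%E -> (\int[haar]_z F z = 1%:E * \int[cube]_x F (hat_iota x))%E.
Proof. by move=> mF F0; rewrite mul1e ge0_integral_haar. Qed.

Lemma integrable_haar_bounded (f : torus R d -> R[i]) (M : R) : measurable_fun_C f ->
  (forall z, normc (f z) <= M) -> integrable_C haar f.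
Proof.
move=> mf fM; apply: (integrable_C_change_inv ltr01 haar_change mf).
apply: (@integrable_cube_bounded _ _ _ M) => [|x]; last exact: fM.
by apply: (measurable_C_comp mf); exact: measurable_hat_iota.
Qed.

Lemma fourier_T_cube (f : torus R d -> R[i]) c : integrable_C haar f ->
  integrable_C cube (fun x => chi (- c) x * f (hat_iota x)) /\
  fourier_T f c = integral_C cube (fun x => chi (- c) x * f (hat_iota x)).
Proof.
move=> hf; have i : integrable_C haar (fun z => f z * torus_char (- c) z).
  have := integrable_CMb (M := 1) hf (measurable_torus_char (- c)) _.
  under [X in _ -> integrable_C _ X]eq_fun do rewrite mulrC.
  by apply => z; rewrite /torus_char normc_expi2pi.
have E : (fun z => f z * torus_char (- c) z) \o (@hat_iota R d) =
    (fun x => chi (- c) x * f (hat_iota x)).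
  by apply/funext => x /=; rewrite torus_char_chi mulrC.
split.
  by have := integrable_C_change (@measurable_hat_iota R d) ltr01 haar_change i; rewrite E.
by rewrite /fourier_T (integral_C_change (@measurable_hat_iota R d) ltr01 haar_change i) mul1r E.
Qed.

(** A null set of the cube need not come from the torus, so its mass is compared with that of the
    set where [P] fails, measurable by assumption. *)
Lemma ae_haar (P : torus R d -> Prop) : measurable [set z | P z] ->
  {ae @cube R d, forall x, P (hat_iota x)} -> {ae @haar R d, forall z, P z}.
Proof.
move=> mP [N [mN N0 sN]]; apply/negligibleP; first exact: measurableC.
apply: (subset_measure0 _ mN sN N0).
by rewrite -[X in measurable X]setTI; exact: (@measurable_hat_iota R d measurableT _ (measurableC mP)).
Qed.

Lemma fourier_T_unique (f g : torus R d -> R[i]) : integrable_C haar f -> integrable_C haar g ->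
  (forall c, fourier_T f c = fourier_T g c) -> {ae @haar R d, forall z, f z = g z}.
Proof.
move=> hf hg fg; have mfg := measurable_CB hf.1 hg.1.
have m : measurable [set z | f z = g z].
  rewrite (_ : mkset _ = (fun z => sqn (f z - g z)) @^-1` [set 0]).
    by rewrite -[X in measurable X]setTI; exact: (measurable_sqn mfg).
  apply/seteqP; split=> z /=; first by move=> ->; rewrite subrr -sqr_normc Normc.normc0 expr0n.
  rewrite -sqr_normc => /eqP; rewrite sqrf_eq0 => /eqP/Normc.eq0_normc.
  by move/eqP; rewrite subr_eq0 => /eqP.
apply: ae_haar m _.
have ic := integrable_C_change (@measurable_hat_iota R d) ltr01 haar_change (integrable_CB hf hg).
have/(cube_uniqueness ic) : forall k,
    integral_C cube (fun x => chi k x * (f (hat_iota x) - g (hat_iota x))) = 0.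
  move=> k; have [fi fE] := fourier_T_cube (- k) hf.
  have [gi gE] := fourier_T_cube (- k) hg.
  move: fi gi (fg (- k)); rewrite fE gE opprK => fi gi E.
  under eq_fun do rewrite mulrBr.
  by rewrite integral_CB// E subrr.
by apply: filterS => x /= /eqP; rewrite subr_eq0 => /eqP.
Qed.

(** The series is integrated term by term, dominated by the constant [l1_norm a] on a space of mass
    one, and orthogonality leaves the term of index [c]. *)
Lemma fourier_TK a c : l1_C a -> fourier_T (fourier_Z a) c = a c.
Proof.
move=> la.
have nS z : normc (fourier_Z a z) <= l1_norm a.
  by rewrite -ler_sqr ?nnegrE ?normc_ge0 ?l1_norm_ge0// sqr_normc sqn_fourier_Z_le.
have iS := integrable_haar_bounded (measurable_fourier_Z a) nS.
rewrite (fourier_T_cube c iS).2.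
pose t (k : Zd) (x : Rd) := chi (- c) x * (a k * chi k x).
pose u n x := enum_term (fun k => t k x) n.
have mt k : measurable_fun_C (t k).
  apply: measurable_CM; first exact: measurable_chi.
  by apply: measurable_CM; [exact: measurable_Ccst|exact: measurable_chi].
have nt k x : normc (t k x) = normc (a k).
  by rewrite !Normc.normcM !normc_chi mul1r mulr1.
have l1t x : l1_C (t^~ x) by apply: l1_C_le la => k; rewrite nt.
have iu n : integrable_C cube (u n).
  rewrite /u /enum_term; case: pickle_inv => [k|] /=.
    by apply: (integrable_cube_bounded (mt k)) => x; rewrite nt.
  by apply: (@integrable_cube_bounded _ _ _ 0) => [|x]; [exact: measurable_Ccst|rewrite Normc.normc0].
have tE x : chi (- c) x * fourier_Z a (hat_iota x) = sum_C setT (t^~ x).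
  rewrite -(sum_CZ _ (l1_char _ la)); apply: sum_C_eq => k _.
  by rewrite torus_char_chi.
have [_] := @dominated_C _ _ _ (@cube R d) (fun N x => \sum_(0 <= n < N) u n x)
  (fun x => sum_C setT (t^~ x)) (fun=> l1_norm a)
  (fun N => (integral_C_sum N iu).1.1) (fun x => sum_C_cvg (l1t x))
  (fun N x => ltac:(rewrite /= (_ : l1_norm a = l1_norm (t^~ x)); [exact: normc_partial_le|
     by congr fine; apply: eq_esum => k _; rewrite nt])) (integrable_cube_cst _).
under eq_fun do rewrite (integral_C_sum _ iu).2.
under [X in _ -> integral_C _ X = _]eq_fun do rewrite tE.
have iE n : integral_C cube (u n) = enum_term (fun k => a k * (k == c)%:R) n.
  rewrite /u /enum_term; case: pickle_inv => [k|] /=; last exact: integral_C0.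
  have -> : t k = (fun x => a k * chi (k - c) x).
    by apply/funext => x; rewrite /t addrC chiD mulrCA.
  rewrite integral_CZ ?integral_chi ?subr_eq0//.
  by apply: (@integrable_cube_bounded _ _ _ 1) => [|x]; [exact: measurable_chi|rewrite normc_chi].
under eq_fun do under eq_bigr do rewrite iE.
have la' : l1_C (fun k => a k * (k == c)%:R).
  apply: l1_C_le la => k; case: eqP => _; rewrite ?mulr1// mulr0 Normc.normc0.
  exact: normc_ge0.
move=> c1; rewrite (cvgC_unique c1 (sum_C_cvg la')) (@sum_C_single _ _ _ c).
  by rewrite eqxx mulr1.
by move=> k /negbTE ->; rewrite mulr0.
Qed.

End torus_fourier_series.

(** * Fourier coefficients of the dual bracket *)

Section translates.
Context {R : realType} {d : nat}.
Local Notation Rd := 'cV[R]_d.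
Local Notation Zd := 'cV[int]_d.
Local Notation mu := (leb d : {measure set Rd -> \bar R}).
Variable theta : {additive Zd -> Rd}.
Hypothesis Htheta : is_embedding theta.

Local Notation B := (emb_mx theta)^T.

Let uB : B \in unitmx.
Proof. by rewrite unitmx_tr; exact: (emb_mxP Htheta).1. Qed.

Lemma dual_bracketE p q z : dual_bracket theta p q z =
  (`|\det B|^-1)%:C * fiber_sum B (fun xi => (p xi)^* * q xi) z.
Proof. by rewrite /dual_bracket -det_tr. Qed.

(** This is the duality behind [hat_theta]: the transpose moves across the scalar product and turns
    [iota_Z c] into [theta c]. *)
Lemma char_hat_theta c (xi : Rd) : torus_char c (hat_theta theta xi) = expd xi (theta c).
Proof.
by rewrite torus_char_chi /chi /expd (emb_mxP Htheta).2 dotmul_mulmx.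
Qed.

Lemma integrable_dual_bracket p q : L2c mu p -> L2c mu q ->
  integrable_C haar (dual_bracket theta p q).
Proof.
move=> hp hq; rewrite (_ : dual_bracket _ _ _ = fun z => (`|\det B|^-1)%:C *
  fiber_sum B (fun xi => (p xi)^* * q xi) z); last by apply/funext => z; exact: dual_bracketE.
by apply: integrable_CZ; exact: (fiber_sum_integral uB (L2c_mulJ hp hq)).1.
Qed.

Lemma fourier_T_dual_bracket (f g p q : Rd -> R[i]) c : is_fourier f p -> is_fourier g q ->
  fourier_T (dual_bracket theta p q) c = bracket theta f g c.
Proof.
move=> Ff Fg; have [hf hp] := is_fourier_L2 Ff; have [hg hq] := is_fourier_L2 Fg.
pose P xi := (p xi)^* * q xi; have iP : integrable_C mu P := L2c_mulJ hp hq.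
pose P' xi := torus_char (- c) (hat_theta theta xi) * P xi.
have mch : measurable_fun_C (fun xi => torus_char (- c) (hat_theta theta xi)).
  by under eq_fun do rewrite char_hat_theta; exact: measurable_expi2pi (measurable_dotmul _ _).
have iP' : integrable_C mu P'.
  apply: (integrable_CMb (M := 1)) => // xi.
  by rewrite char_hat_theta normc_expd.
have [iS iSE] := fiber_sum_integral uB iP'.
have hdb := integrable_dual_bracket hp hq.
(* The character is constant on each fibre and so enters the sum, wherever the fibre is summable;
   that is almost everywhere. *)
transitivity (integral_C haar (fun z => (`|\det B|^-1)%:C * fiber_sum B P' z)).
  apply: ae_eq_integral_C.
  - by apply: measurable_CM; [exact: hdb.1|exact: measurable_torus_char].
  - by apply: measurable_CM; [exact: measurable_Ccst|exact: iS.1].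
  apply: filterS (ae_fiber_summable uB iP) => z.
  rewrite -(hat_iotaK z); set x := repr z => sz.
  rewrite dual_bracketE -mulrA; congr (_ * _); rewrite !fiber_sumE// mulrC -sum_CZ.
    apply: sum_C_eq => k _; rewrite /P' /hat_theta /fiber_pt mulKVmx//.
    by congr (torus_char _ _ * _); apply/esym/hat_iota_eqP; exists k.
  apply/l1_CE; move: sz; rewrite (reindex_esum _ _ _ _ (fiber_bij uB x))//.
rewrite integral_CZ// iSE mulrA -rmorphM/= mulVf ?mul1r; last first.
  by rewrite normr_eq0 -unitfE -unitmxE.
(* Translating [f] by [theta c] multiplies its transform by a character, whose conjugate is the
   factor produced by [- c]. *)
have := parseval (is_fourier_shift (theta c) Ff) Fg; rewrite /bracket /ip => ->.
congr integral_C; apply/funext => xi; rewrite /P' /P char_hat_theta raddfN.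
by rewrite rmorphM/= mulrA /expd dotmulNl expi2piN.
Qed.

End translates.

(** * The action of summable families on L^2 *)

Section action_properties.
Context {R : realType} {d : nat}.
Local Notation Rd := 'cV[R]_d.
Local Notation Zd := 'cV[int]_d.
Local Notation mu := (leb d : {measure set Rd -> \bar R}).
Variable theta : {additive Zd -> Rd}.
Variable a : Zd -> R[i].
Hypothesis la : l1_C a.
Implicit Types (w : Rd -> R[i]) (x xi : Rd).

(* [smear F] dominates the series defining [action] when [F] is the modulus,
   and by the weighted Cauchy-Schwarz inequality when it is the squared one. *)
Definition smear (F : Rd -> \bar R) (x : Rd) : \bar R :=
  esum setT (fun c : Zd => (normc (a c))%:E * F (x - theta c)%R)%E.

Section smear_measurable.
Variable F : Rd -> \bar R.
Hypotheses (mF : measurable_fun setT F) (F0 : forall x, (0 <= F x)%E).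

Let G (c : Zd) (x : Rd) : \bar R := ((normc (a c))%:E * F (x - theta c)%R)%E.

Let mG c : measurable_fun setT (G c).
Proof. by apply: measurable_funeM; exact: measurable_shift. Qed.

Let G0 c x : (0 <= G c x)%E.
Proof. by rewrite mule_ge0// lee_fin normc_ge0. Qed.

Lemma measurable_smear : measurable_fun setT (smear F).
Proof. exact: (@measurable_esum _ Zd _ _ G G0 mG). Qed.

Lemma smear_ge0 x : (0 <= smear F x)%E.
Proof. by apply: esum_ge0 => c _; exact: G0. Qed.

(** By translation invariance each term contributes the same integral, weighted by the modulus of
    its coefficient. *)
Lemma integral_smear : (\int[mu]_x F x < +oo)%E ->
  (\int[mu]_x smear F x = (l1_norm a)%:E * \int[mu]_x F x)%E.
Proof.
move=> fin; rewrite (@integral_esum _ Zd _ _ mu G G0 mG).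
have E0 : (0 <= \int[mu]_x F x)%E by exact: integral_ge0.
have fE : (\int[mu]_x F x = (fine (\int[mu]_x F x))%:E)%E by rewrite fineK// ge0_fin_numE.
transitivity (esum setT (fun c => (fine (\int[mu]_x F x))%:E * (normc (a c))%:E)%E).
  apply: eq_esum => c _; rewrite /G ge0_integralZl//; last first.
  - by rewrite lee_fin normc_ge0.
  - exact: measurable_shift.
  by rewrite muleC -fE (ge0_integral_shift _ mF F0).
rewrite esumZl ?fine_ge0//; last by move=> c; rewrite lee_fin normc_ge0.
by rewrite l1_normE// muleC -fE.
Qed.

Lemma integrable_smear : (\int[mu]_x F x < +oo)%E -> mu.-integrable setT (smear F).
Proof.
move=> fin; apply/integrableP; split; first exact: measurable_smear.
under eq_integral do rewrite gee0_abs ?smear_ge0//.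
by rewrite integral_smear// lte_mul_pinfty// lee_fin l1_norm_ge0.
Qed.

Lemma ae_smear_fin : (\int[mu]_x F x < +oo)%E -> {ae mu, forall x, (smear F x < +oo)%E}.
Proof.
move=> /integrable_smear/(integrable_ae measurableT); apply: filterS => x /(_ I).
by rewrite ge0_fin_numE// smear_ge0.
Qed.

End smear_measurable.

Lemma measurable_action w : measurable_fun_C w -> measurable_fun_C (action theta w a).
Proof.
move=> mw; apply: (@measurable_sum_C _ Zd _ _ (fun c (x : Rd) => a c * w (x - theta c))) => c.
apply: measurable_CM; first exact: measurable_Ccst.
by apply: (measurable_C_comp mw); exact: measurable_cV_addr.
Qed.

Local Notation nsmear w := (smear (fun y => (normc (w y))%:E)).
Local Notation qsmear w := (smear (fun y => (sqn (w y))%:E)).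

Lemma nsmearE w x : nsmear w x = esum setT (fun c => (normc (a c * w (x - theta c)))%:E).
Proof. by apply: eq_esum => c _; rewrite Normc.normcM EFinM. Qed.

(** Since [t <= 1 + t ^+ 2], the family is dominated by the coefficients plus the terms of the
    squared smear. *)
Lemma action_summable w x : (qsmear w x < +oo)%E -> l1_C (fun c => a c * w (x - theta c)).
Proof.
move=> fin; apply/l1_CE; apply: (@le_lt_trans _ _
    (esum setT (fun c => (normc (a c))%:E) + qsmear w x)%E); last first.
  by rewrite l1_normE// lte_add_pinfty// ltry.
rewrite -esumD; last 2 first.
- by move=> c _; rewrite lee_fin normc_ge0.
- by move=> c _; rewrite -EFinM lee_fin mulr_ge0 ?normc_ge0 ?sqn_ge0.
apply: le_esum => c _; rewrite -EFinM -EFinD lee_fin Normc.normcM -sqr_normc.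
rewrite -{2}(mulr1 (normc (a c))) -mulrDr ler_wpM2l ?normc_ge0//.
by set t := normc _; have := sqr_ge0 (t - 1); have := sqr_ge0 t; nra.
Qed.

Lemma sqn_action_le w x : (qsmear w x < +oo)%E ->
  ((sqn (action theta w a x))%:E <= (l1_norm a)%:E * qsmear w x)%E.
Proof.
move=> fin; have l1 := action_summable fin.
have q0 : (0 <= qsmear w x)%E by apply: smear_ge0 => y; rewrite lee_fin sqn_ge0.
have qE : qsmear w x = (fine (qsmear w x))%:E by rewrite fineK// ge0_fin_numE.
rewrite qE -EFinM lee_fin; apply: sqn_sum_C_le => // N.
have -> : \sum_(0 <= n < N) enum_term (fun c => a c * w (x - theta c)) n =
    \sum_(0 <= n < N) enum_term a n * enum_term (fun c => w (x - theta c)) n.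
  by apply: eq_bigr => n _; rewrite /enum_term; case: pickle_inv => //=; rewrite mulr0.
apply: le_trans (sqn_weighted_sum_le _ _ _) _.
apply: ler_pM.
- by apply: sumr_ge0 => n _; exact: normc_ge0.
- by apply: sumr_ge0 => n _; rewrite mulr_ge0 ?normc_ge0 ?sqn_ge0.
- rewrite -lee_fin -l1_normE//.
  have := enum_sum_le (g := fun c => normc (a c)) N (fun c => normc_ge0 _).
  apply: le_trans; rewrite lee_fin; apply: ler_sum => n _.
  by rewrite (enum_term_map (h := @Normc.normc R))// Normc.normc0.
- rewrite -lee_fin -qE.
  have g0 c : 0 <= normc (a c) * sqn (w (x - theta c)) by rewrite mulr_ge0 ?normc_ge0 ?sqn_ge0.
  have := enum_sum_le N g0; apply: le_trans; rewrite lee_fin; apply: ler_sum => n _.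
  by rewrite /enum_term; case: pickle_inv => //=; rewrite expr0n addr0 sqrtr0 mul0r.
Qed.

Lemma ae_qsmear w : L2c mu w -> {ae mu, forall x, (qsmear w x < +oo)%E}.
Proof.
move=> [mw iw]; apply: ae_smear_fin iw; first exact: measurable_EFin_sqn.
by move=> x; rewrite lee_fin sqn_ge0.
Qed.

(** Young's inequality for l^1 acting on L^2: one factor [l1_norm a] comes from the weighted
    Cauchy-Schwarz inequality, the other from integrating the smear. *)
Lemma N2_action_le w : L2c mu w ->
  (N2 mu (action theta w a) <= (l1_norm a ^+ 2)%:E * N2 mu w)%E.
Proof.
move=> hw; have [mw iw] := hw.
have m2 := measurable_EFin_sqn mw.
have p0 x : (0 <= (sqn (w x))%:E)%E by rewrite lee_fin sqn_ge0.
have -> : ((l1_norm a ^+ 2)%:E * N2 mu w = \int[mu]_x ((l1_norm a)%:E * qsmear w x))%E.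
  rewrite ge0_integralZl//.
  - by rewrite integral_smear// muleA.
  - exact: measurable_smear.
  - by move=> x _; exact: smear_ge0.
  - by rewrite lee_fin l1_norm_ge0.
apply: ae_ge0_le_integral => //.
- by move=> x _; rewrite lee_fin sqn_ge0.
- by apply: measurable_EFin_sqn; exact: measurable_action.
- by move=> x _; rewrite mule_ge0 ?lee_fin ?l1_norm_ge0 ?smear_ge0.
- by apply: measurable_funeM; exact: measurable_smear.
by apply: filterS (ae_qsmear hw) => x fin _; exact: sqn_action_le.
Qed.

Lemma L2c_action w : L2c mu w -> L2c mu (action theta w a).
Proof.
move=> hw; split; first exact: measurable_action hw.1.
apply: le_lt_trans (N2_action_le hw) _.
by rewrite lte_mul_pinfty// ?lee_fin ?sqr_ge0//; exact: hw.2.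
Qed.

Lemma L2cvg_action u w : (forall n, L2c mu (u n)) -> L2c mu w -> L2cvg mu u w ->
  L2cvg mu (fun n => action theta (u n) a) (action theta w a).
Proof.
move=> hu hw uw e e0.
pose K := l1_norm a ^+ 2 + 1; have K0 : 0 < K by rewrite ltr_wpDl// sqr_ge0.
apply: filterS (uw _ (divr_gt0 e0 K0)) => n le.
have hd := L2cB (hu n) hw.
(* Additivity of the action is obtained where both series converge absolutely, hence almost
   everywhere; elsewhere [sum_C] may take default values. *)
rewrite (@ae_eq_N2 _ _ _ mu _ (action theta (fun x => u n x - w x) a)); last 3 first.
- by apply: measurable_CB; apply: measurable_action; [exact: (hu n).1|exact: hw.1].
- exact: measurable_action hd.1.
- apply: filterS2 (ae_qsmear (hu n)) (ae_qsmear hw) => x ux wx.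
  rewrite /action -sum_CB; try exact: action_summable.
  by apply: sum_C_eq => c _; rewrite mulrBr.
apply: le_trans (N2_action_le hd) _.
apply: (@le_trans _ _ (K%:E * (e / K)%:E)%E); last first.
  by rewrite -EFinM lee_fin mulrCA divff ?mulr1// gt_eqF.
by apply: lee_pmul => //; rewrite ?lee_fin ?sqr_ge0 ?lerDl// N2_ge0.
Qed.

(** The series is integrated term by term; its partial sums are dominated by the smear of the
    modulus of [w], which is integrable, and each term is the transform of a translate. *)
Lemma fourier_L1_action w xi : integrable_C mu w ->
  integrable_C mu (fun x => action theta w a x * expd xi x) /\
  fourier_L1 (action theta w a) xi =
  fourier_L1 w xi * sum_C setT (fun c => a c * expd xi (theta c)).
Proof.
move=> iw; have [mw fw] := iw.
have mn : measurable_fun setT (fun x => (normc (w x))%:E).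
  exact: measurable_EFin_normc.
have n0 x : (0 <= (normc (w x))%:E)%E by rewrite lee_fin normc_ge0.
pose t (c : Zd) x := expd xi x * (a c * w (x - theta c)).
pose u n x := enum_term (t^~ x) n.
have it c : integrable_C mu (t c).
  rewrite /t; under eq_fun do rewrite mulrC.
  apply: integrable_expd; apply: integrable_CZ.
  exact: (integrable_C_change (measurable_cV_addr (- theta c)) ltr01 (change_shift (- theta c))).
have iu n : integrable_C mu (u n).
  rewrite /u /enum_term; case: pickle_inv => [c|] /=; first exact: it.
  by have := integrable_CZ 0 iw; congr integrable_C; apply/funext => x; rewrite mul0r.
have ntE x : (fun c => (normc (t c x))%:E) = (fun c => (normc (a c * w (x - theta c)))%:E).
  by apply/funext => c; rewrite /t Normc.normcM normc_expd mul1r.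
have sE x : (nsmear w x < +oo)%E -> action theta w a x * expd xi x = sum_C setT (t^~ x).
  rewrite (nsmearE w x) => h.
  have l1 : l1_C (fun c : Zd => a c * w (x - theta c)) by exact: (l1_CE _).2 h.
  by rewrite [LHS]mulrC /action -(sum_CZ _ l1).
have fin := ae_smear_fin mn n0 fw.
have cu : {ae mu, forall x, cvgC (fun N => \sum_(0 <= n < N) u n x) (action theta w a x * expd xi x)}.
  apply: filterS fin => x fx; rewrite sE//; apply: sum_C_cvg.
  by apply/l1_CE; rewrite ntE -nsmearE.
have bu : {ae mu, forall x N, normc (\sum_(0 <= n < N) u n x) <= fine (nsmear w x)}.
  apply: filterS fin => x fx N; rewrite -lee_fin fineK ?ge0_fin_numE ?smear_ge0//.
  by rewrite nsmearE -ntE; exact: normc_enum_sum_le.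
have ig : mu.-integrable setT (EFin \o (fun x => fine (nsmear w x))).
  have is_ := integrable_smear mn n0 fw.
  apply/integrableP; split.
    apply/measurable_EFinP; apply: (measurableT_comp (fine_measurable measurableT)).
    exact: measurable_smear.
  have /integrableP[_] := is_; apply: le_lt_trans; apply: ge0_le_integral => //.
  - apply: measurableT_comp => //; apply/measurable_EFinP.
    apply: (measurableT_comp (fine_measurable measurableT)); exact: measurable_smear.
  - by apply: measurableT_comp => //; exact: measurable_smear.
  - by move=> x _ /=; case: (nsmear w x) => [r||] //=; rewrite ?normr0 ?leey// leey.
have [i1 c1] := ae_dominated_C (fun N => (integral_C_sum N iu).1.1)
  (measurable_CM (measurable_action mw) (measurable_expd xi)) cu bu ig.
rewrite fourier_L1E; split => //.
move: c1; under eq_fun do rewrite (integral_C_sum _ iu).2.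
have la' : l1_C (fun c => a c * expd xi (theta c)).
  by apply: l1_C_le la => c; rewrite Normc.normcM normc_expd mulr1.
have uE n : integral_C mu (u n) =
    fourier_L1 w xi * enum_term (fun c => a c * expd xi (theta c)) n.
  rewrite /u /enum_term; case: pickle_inv => [c|] /=; last by rewrite integral_C0 mulr0.
  rewrite mulrC -mulrA -(fourier_L1_shift _ _ iw) fourier_L1E -integral_CZ.
    by congr integral_C; apply/funext => x; rewrite /t mulrC mulrA.
  apply: integrable_expd.
  exact: (integrable_C_change (measurable_cV_addr (- theta c)) ltr01 (change_shift (- theta c))).
under eq_fun do under eq_bigr do rewrite uE.
under eq_fun do rewrite -mulr_sumr.
by move=> /cvgC_unique; apply; exact: (cvgCM (cvgC_cst _) (sum_C_cvg la')).
Qed.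

(** This is the previous integrability at frequency zero, where the kernel is 1. *)
Lemma integrable_action w : integrable_C mu w -> integrable_C mu (action theta w a).
Proof.
move=> iw; have := (fourier_L1_action 0 iw).1; congr integrable_C.
apply/funext => x; rewrite /expd dotmulC (_ : dotmul 0 x = 0) ?expi2pi0 ?mulr1//.
by rewrite /dotmul big1// => i _; rewrite mxE mul0r.
Qed.

(** The multiplier [m] is bounded because [a] is summable, so both operations are continuous on L^2
    and the identity for integrable approximants passes to the limit. *)
Lemma is_fourier_action (Htheta : is_embedding theta) (f h : Rd -> R[i]) :
  is_fourier f h -> is_fourier (action theta f a) (dual_action theta h (fourier_Z a)).
Proof.
move=> /is_fourierP[hf hh [u [hu uf uh]]].
pose m xi := fourier_Z a (hat_theta theta xi).
have mE xi : m xi = sum_C setT (fun c => a c * expd xi (theta c)).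
  by apply: sum_C_eq => c _; rewrite char_hat_theta.
have mm : measurable_fun_C m.
  apply: (measurable_C_comp (measurable_fourier_Z a)).
  apply: (measurableT_comp (@measurable_hat_iota R d)); exact: measurable_mulmx.
have bm xi : sqn (m xi) <= l1_norm a ^+ 2 := sqn_fourier_Z_le _ la.
have dE (p : Rd -> R[i]) : dual_action theta p (fourier_Z a) = (fun xi => m xi * p xi).
  by apply/funext => xi; rewrite /dual_action mulrC.
apply/is_fourierP; split; [exact: L2c_action|by rewrite dE; exact: (L2cMb hh mm bm)|].
exists (fun n => action theta (u n) a); split.
- by move=> n; have [i l] := hu n; split; [exact: integrable_action|exact: L2c_action].
- by apply: L2cvg_action => // n; exact: (hu n).2.
- rewrite dE (_ : (fun n => _) = (fun n xi => m xi * fourier_L1 (u n) xi)).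
    apply: (L2cvgMb _ _ mm bm uh); last exact: hh.1.
    by move=> n; apply: measurable_fourier_L1; exact: (hu n).2.1.
  apply/funext => n; apply/funext => xi.
  by rewrite (fourier_L1_action xi (hu n).1).2 mE mulrC.
Qed.

End action_properties.

Theorem lemma3p7 (R : realType) (d : nat)
    (theta : {additive 'cV[int]_d -> 'cV[R]_d}) (Htheta : is_embedding theta) :
  (forall (f g : 'cV[R]_d -> R[i]) (a : 'cV[int]_d -> R[i]),
     L2 f -> L2 g -> l1_C a -> l1_C (bracket theta f g) ->
     {ae lebesgue_cV d, forall xi,
        dual_action theta (fourier f) (fourier_Z a) xi =
        fourier (action theta f a) xi} /\
     {ae haar, forall z,
        dual_bracket theta (fourier f) (fourier g) z =
        fourier_Z (bracket theta f g) z}) /\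
  (forall p q : 'cV[R]_d -> R[i],
     L2 p -> L2 q ->
     forall c : 'cV[int]_d,
       fourier_T (dual_bracket theta p q) c =
       bracket theta (inv_fourier p) (inv_fourier q) c).
Proof.
split=> [f g a Lf Lg la lb|p q Lp Lq c].
  have Ff := fourierP Lf; have Fg := fourierP Lg; split.
    (* Both sides are transforms of the same function; [fourier] being an arbitrary representative,
       they agree almost everywhere. *)
    apply: (is_fourier_unique (is_fourier_action la Htheta Ff)).
    by apply: fourierP; apply/L_C2P; apply: (L2c_action _ la); apply/L_C2P.
  have [_ Lfh] := is_fourier_L2 Ff; have [_ Lgh] := is_fourier_L2 Fg.
  apply: fourier_T_unique => [||c].
  - exact: integrable_dual_bracket.
  - apply: (@integrable_haar_bounded _ _ _ (l1_norm (bracket theta f g))) => [|z].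
      exact: measurable_fourier_Z.
    rewrite -ler_sqr ?nnegrE ?normc_ge0 ?l1_norm_ge0// sqr_normc.
    exact: sqn_fourier_Z_le.
  - by rewrite fourier_TK//; exact: fourier_T_dual_bracket.
by apply: fourier_T_dual_bracket => //; exact: inv_fourierP.
Qed.
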